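(* Fix $\nu>0$, $p\in(0,1)$ and let $q=1-p$. For any $\bar\alpha,\bar\beta,\bar\delta,\bar\epsilon,\bar\eta>0$, the two plane system with these parameters has a unique stationary distribution, and this stationary distribution is the limit in distribution as $t\to\infty$ of the process starting from any initial configuration.
   Context: The two plane system is the following continuous-time piecewise deterministic Markov process describing one particle. Its state is $(i,x,y)$ with $i\in\{0,1\}$ (the particle is in plane $i$) and $(x,y)\in[0,\infty)^2$ its location in that plane. While in plane $1$ the location $(x_1,y_1)$ moves according to $$\frac{dx_1}{dt}=\bar\eta+p\,y_1+\nu\bar\alpha\, y_1-\nu\bar\beta\, x_1,\qquad \frac{dy_1}{dt}=\bar\eta-y_1-p\,y_1-\nu\bar\alpha\, y_1+\nu\bar\beta\, x_1 .$$ While in plane $0$ the location $(x_0,y_0)$ moves according to $$\frac{dx_0}{dt}=\bar\eta-x_0-q\,x_0-\nu\bar\delta\, x_0+\nu\bar\epsilon\, y_0,\qquad \frac{dy_0}{dt}=\bar\eta+q\,x_0+\nu\bar\delta\, x_0-\nu\bar\epsilon\, y_0 .$$ The particle jumps from plane $1$ to plane $0$ at rate $\nu y_1$ (where $(x_1,y_1)$ is its current location), and from plane $0$ to plane $1$ at rate $\nu x_0$; at a jump only the plane index changes, and the location $(x,y)$ is kept. *)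

(* Defs.v *)
From HB Require Import structures.
From mathcomp Require Import all_boot all_order all_algebra.
From mathcomp Require Import all_classical all_reals all_analysis measurable_realfun.

Set Implicit Arguments.
Unset Strict Implicit.
Unset Printing Implicit Defensive.

Import Order.TTheory GRing.Theory Num.Theory.
Import numFieldNormedType.Exports.

Local Open Scope classical_set_scope.
Local Open Scope ring_scope.

(* A state is (i, (x, y)); the plane index is a boolean, true for plane 1 and
   false for plane 0. *)
Notation state R := (bool * (R * R))%type.

(* The actual state space {0,1} x [0,oo)^2. *)
Definition states (R : realType) : set (state R) :=
  [set z | 0 <= z.2.1 /\ 0 <= z.2.2].
Arguments states : clear implicits.

Section TwoPlaneSystem.
Context (R : realType).
Variables (nu p q alpha beta delta epsilon eta : R).

Definition drift (i : bool) (w : R * R) : R * R :=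
  let: (x, y) := w in
  if i then
    (eta + p * y + nu * alpha * y - nu * beta * x,
     eta - y - p * y - nu * alpha * y + nu * beta * x)
  else
    (eta - x - q * x - nu * delta * x + nu * epsilon * y,
     eta + q * x + nu * delta * x - nu * epsilon * y).

Definition jump_rate (z : state R) : R :=
  if z.1 then nu * z.2.2 else nu * z.2.1.

(* phi i w t is the location at time t of a particle that starts at w and never
   leaves plane i. The drift being affine, such a phi exists, is unique, and is
   defined for all real times. *)
Definition is_flow (phi : bool -> R * R -> R -> R * R) : Prop :=
  forall (i : bool) (w : R * R),
    phi i w 0 = w /\
    forall t : R,
      is_derive t 1 (fun s => (phi i w s).1) (drift i (phi i w t)).1 /\
      is_derive t 1 (fun s => (phi i w s).2) (drift i (phi i w t)).2.

(* Integrated jump rate over [0, s] along the flow line issued from z. *)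
Definition cumulative_rate (phi : bool -> R * R -> R -> R * R) (z : state R)
    (s : R) : R :=
  (\int[lebesgue_measure]_(u in `[0, s]) jump_rate (z.1, phi z.1 z.2 u))%R.

Section Process.
Context (d : measure_display) (Om : measurableType d).
Variables (phi : bool -> R * R -> R -> R * R)
  (X : R -> Om -> state R) (T : nat -> Om -> \bar R).

(* T n is the time of the n-th jump, with T 0 = 0 and T n = +oo when there are
   fewer than n jumps. Nothing is prescribed on X after the limit of the jump
   times: non-explosion is not part of the definition. *)
Definition pdmp_paths : Prop :=
  [/\ forall w, T 0 w = 0%E,
      forall n w, (T n w < +oo)%E -> (T n w < T n.+1 w)%E,
      forall n w, T n w = +oo%E -> T n.+1 w = +oo%E,
      forall n w (a t : R), T n w = a%:E -> a <= t -> (t%:E < T n.+1 w)%E ->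
        X t w = ((X a w).1, phi (X a w).1 (X a w).2 (t - a)) &
      forall n w (a b : R), T n w = a%:E -> T n.+1 w = b%:E ->
        X b w = (~~ (X a w).1, phi (X a w).1 (X a w).2 (b - a))].

(* The sigma-algebra generated by the first n jump times; when the initial state
   is deterministic this is, up to null sets, the full history of the process
   up to the n-th jump. *)
Definition jump_history (n : nat) : set (set Om) :=
  <<s [set H | exists (k : nat) (B : set (\bar R)),
        [/\ (k <= n)%N, measurable B & H = T k @^-1` B]] >>.

(* Given the history up to the n-th jump, the waiting time until the next jump
   exceeds s with probability exp (- cumulative rate over [0, s]). *)
Definition jumps_at_rate (Q : probability Om R) : Prop :=
  forall (n : nat) (s : R) (H : set Om), 0 <= s -> jump_history n H ->
    Q (H `&` [set w | (T n w < +oo)%E]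
         `&` [set w | (T n w + s%:E < T n.+1 w)%E]) =
    (\int[Q]_(w in H `&` [set w | (T n w < +oo)%E])
       (expR (- cumulative_rate phi (X (fine (T n w)) w) s))%:E)%E.

End Process.

(* (P z)_z is the Markov family of the system: under P z the process X starts
   from z. *)
Definition two_plane_process (d : measure_display) (Om : measurableType d)
    (P : state R -> probability Om R) (X : R -> Om -> state R) : Prop :=
  (forall t : R, 0 <= t -> measurable_fun setT (X t)) /\
  exists (phi : bool -> R * R -> R -> R * R) (T : nat -> Om -> \bar R),
    [/\ is_flow phi,
        forall n, measurable_fun setT (T n),
        pdmp_paths phi X T,
        forall z, states R z -> P z [set w | X 0 w = z] = 1%E &
        forall z, states R z -> jumps_at_rate phi X T (P z)].

End TwoPlaneSystem.

Section Stationarity.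
Context (R : realType) (d : measure_display) (Om : measurableType d).
Variables (P : state R -> probability Om R) (X : R -> Om -> state R).

Definition stationary (mu : probability (state R) R) : Prop :=
  mu (states R) = 1%E /\
  forall (t : R) (A : set (state R)), 0 <= t -> measurable A ->
    (\int[mu]_(z in states R) P z (X t @^-1` A))%E = mu A.

(* The state space is closed in bool * (R * R), so it is enough to test against
   the bounded continuous functions on the whole product. *)
Definition converges_in_distribution (Q : probability Om R)
    (mu : probability (state R) R) : Prop :=
  forall f : state R -> R, continuous f ->
    (exists M : R, forall z, `|f z| <= M) ->
    (\int[Q]_w (f (X t w))%:E)%E @[t --> +oo] --> (\int[mu]_z (f z)%:E)%E.

End Stationarity.

(* Main.v *)
Require Import Defs.
From HB Require Import structures.
From mathcomp Require Import all_boot all_order all_algebra.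
From mathcomp Require Import all_classical all_reals all_analysis measurable_realfun giry.
From mathcomp Require Import ring lra.

(* In either plane the total mass |w| = x + y gains 2 eta per unit time and
   loses the coordinate that governs the jump rate, so the integrated jump rate
   along a flow line is nu (2 eta t + |w| - |phi t w|). Two copies of the process
   in the same plane at w and v can therefore be coupled so as to jump together,
   except with probability at most 1 - exp (- nu |w - v|), while the distance
   between them decays exponentially in a quadratic norm adapted to both linear
   parts. Copies in different planes are both in plane 1 a bounded time later
   with probability bounded below on each of the compact boxes that both flows
   leave invariant. Hence the oscillation on a box of E_z f (X_t) decays
   geometrically for Lipschitz f. The coupling is carried out on functions, for
   the discrete chain that follows the flow for a time h and then switches planes
   with the probability of a jump; it differs from the process by O(h^2) per step
   because two jumps within h have probability O(h^2).

   So E_z f (X_t) converges, to a limit that does not depend on z. The limit is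
   the integral of f for a measure obtained as the image of the uniform law on
   [0, 1]: limits along an ultrafilter of the masses of dyadic cells prescribe the
   masses of nested intervals. Invariance and uniqueness follow because Lipschitz
   functions separate measures, and continuous test functions are reached from
   below by infimal convolution. *)

Set Implicit Arguments.
Unset Strict Implicit.
Unset Printing Implicit Defensive.

Import Order.TTheory GRing.Theory Num.Theory.
Import numFieldNormedType.Exports.

Local Open Scope classical_set_scope.
Local Open Scope ring_scope.

(** * Planar linear systems *)

(** The definition of the process gives the law of each waiting time given the earlier jump times,
    but neither a Markov property at a fixed date nor a bound on the number of jumps. Both are
    derived: non-explosion from the boundedness of the rate on an invariant box, and the semigroup
    law by approximating the process from every date [u], not only from 0, by one and the same
    chain.

    The coupling becomes a class of functions stable under one step of the chain: in one plane, a
    function of oscillation at most [s] may vary by [s] times the bound on the probability of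
    separation, plus a Lipschitz term. The first part reproduces itself because a difference of
    integrated jump rates is paid for by lost l1 distance. The second must shrink, which the l1 norm
    does not guarantee: its decrease stops when the leaking coordinates agree, whence the quadratic
    norm. Lipschitz constants then stay bounded uniformly in the number of steps, so local errors of
    order [h^2] add up to order [h]. *)

Section Monotone.
Context (R : realType).
Implicit Types f df : R -> R.

Lemma mean_value f df (s t : R) : (forall x : R, is_derive x 1 f (df x)) -> s <= t ->
  exists2 c, s <= c <= t & f t - f s = df c * (t - s).
Proof.
move=> fdf st.
have cf : {within `[s, t], continuous f}.
  apply: continuous_subspaceT => y.
  by apply/differentiable_continuous/derivable1_diffP; case: (fdf y).
have [c + ->] := MVT_segment st (fun x _ => fdf x) cf.
by rewrite in_itv/= => sct; exists c.
Qed.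

Lemma nonincreasing_of_derive f df (t : R) : (forall x : R, is_derive x 1 f (df x)) ->
  (forall x, 0 <= x -> df x <= 0) -> 0 <= t -> f t <= f 0.
Proof.
move=> fdf df0 t0; have [c /andP[c0 _] E] := mean_value fdf t0.
by rewrite -subr_le0 E subr0 mulr_le0_ge0 ?df0.
Qed.

(** Squaring removes the kink of [min y 0] at 0, so the negative part of a solution can be followed
    by differentiation. Each sign of [x] gets its own Caratheodory slope. *)
Lemma is_derive_sqr_min0 (x : R) :
  is_derive x 1 (fun y => Num.min y 0 ^+ 2) (2 * Num.min x 0).
Proof.
apply/is_derive1_caratheodory.
have [x0|x0|->] := ltgtP x 0.
- exists (fun z => if z < 0 then z + x else - (x ^+ 2 / (z - x))); split.
  + move=> z; have [z0|z0] := ltP z 0; first by ring.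
    have zx : z - x != 0 by rewrite gt_eqF//; lra.
    by field.
  + rewrite /prop_for /continuous_at x0 /=.
    apply: (@cvg_trans _ ((fun z => z + x) @ x)).
      apply: near_eq_cvg; near=> z; rewrite ifT//; near: z.
      exact: lt_nbhsl.
    apply: (cvgD cvg_id (cvg_cst x)).
  + by rewrite x0; ring.
- exists (fun z => if 0 < z then 0 else z ^+ 2 / (z - x)); split.
  + move=> z; have [z0|z0] := ltP 0 z; rewrite ?(ltW x0).
      by rewrite mul0r; ring.
    have zx : z - x != 0 by rewrite lt_eqF//; lra.
    by field.
  + rewrite /prop_for /continuous_at x0 /=.
    apply: (@cvg_trans _ ((fun z => 0 : R) @ x)).
      apply: near_eq_cvg; near=> z; rewrite ifT//; near: z.
      exact: lt_nbhsr.
    exact: (@cst_continuous R R 0 x).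
  + by rewrite x0; ring.
- exists (fun z => Num.min z 0); split.
  + move=> z; rewrite subr0; have [z0|z0] := leP z 0; ring.
  + have : {for 0, continuous ((id : R -> R) \min (fun=> 0 : R))}.
      by apply: continuous_min; [exact: cvg_id|exact: cst_continuous].
    by [].
  + by rewrite minxx mulr0.
Unshelve. all: by end_near. Qed.

End Monotone.

Section LinearFlow.
Context (R : realType) (k P : R).

(** Common form of both planes: mass enters each coordinate at rate [c] and leaks at unit rate from
    [b] only. The planes differ in which coordinate plays the role of [b]. *)
Definition solution (c : R) (a b : R -> R) := forall t : R,
  is_derive t 1 a (c - k * a t + P * b t) /\
  is_derive t 1 b (c + k * a t - (1 + P) * b t).

Lemma solutionB c c' a b a' b' : solution c a b -> solution c' a' b' ->
  solution (c - c') (fun t => a t - a' t) (fun t => b t - b' t).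
Proof.
move=> s s' t; have [da db] := s t; have [da' db'] := s' t; split.
- by apply: (is_derive_eq (is_deriveB da da')); ring.
- by apply: (is_derive_eq (is_deriveB db db')); ring.
Qed.

Lemma solutionD c c' a b a' b' : solution c a b -> solution c' a' b' ->
  solution (c + c') (fun t => a t + a' t) (fun t => b t + b' t).
Proof.
move=> s s' t; have [da db] := s t; have [da' db'] := s' t; split.
- by apply: (is_derive_eq (is_deriveD da da')); ring.
- by apply: (is_derive_eq (is_deriveD db db')); ring.
Qed.

Lemma solutionZ c a b (l : R) : solution c a b ->
  solution (l * c) (fun t => l * a t) (fun t => l * b t).
Proof.
move=> s t; have [da db] := s t; split.
- by apply: (is_derive_eq (is_deriveZ l da)); rewrite /GRing.scale/=; ring.
- by apply: (is_derive_eq (is_deriveZ l db)); rewrite /GRing.scale/=; ring.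
Qed.

Lemma solution_shift c a b (s : R) : solution c a b ->
  solution c (fun t => a (s + t)) (fun t => b (s + t)).
Proof.
move=> h t; have [da db] := h (s + t).
have ds : is_derive t 1 (fun t => s + t) 1.
  by apply: (is_derive_eq (is_deriveD (is_derive_cst s t 1) (is_derive_id t 1))); ring.
split.
- by apply: (is_derive_eq (is_derive1_comp da ds)); ring.
- by apply: (is_derive_eq (is_derive1_comp db ds)); ring.
Qed.

Lemma is_derive_expRM (l t : R) :
  is_derive t 1 (fun t => expR (l * t)) (l * expR (l * t)).
Proof.
have dl : is_derive t 1 (fun t => l * t) l.
  by apply: (is_derive_eq (is_deriveZ l (is_derive_id t 1))); rewrite /GRing.scale/=; ring.
by apply: (is_derive_eq (is_derive1_comp (is_derive_expR (l * t)) dl)); ring.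
Qed.

Hypotheses (k_ge0 : 0 <= k) (P_ge0 : 0 <= P).

(* The squared negative part [m a ^ 2 + m b ^ 2] grows at most exponentially,
   so it stays zero if it starts at zero. *)
Lemma solution_ge0 c a b (t : R) : 0 <= c -> solution c a b ->
  0 <= a 0 -> 0 <= b 0 -> 0 <= t -> 0 <= a t /\ 0 <= b t.
Proof.
move=> c0 sol a0 b0 t0; pose m (x : R) := Num.min x 0.
pose f (t : R) := expR (- (P + k) * t) * (m (a t) ^+ 2 + m (b t) ^+ 2).
pose df (t : R) := expR (- (P + k) * t) *
  (2 * m (a t) * (c - k * a t + P * b t) + 2 * m (b t) * (c + k * a t - (1 + P) * b t)
  - (P + k) * (m (a t) ^+ 2 + m (b t) ^+ 2)).
have fdf (s : R) : is_derive s 1 f (df s).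
  have [da db] := sol s.
  have d1 := is_derive1_comp (is_derive_sqr_min0 (a s)) da.
  have d2 := is_derive1_comp (is_derive_sqr_min0 (b s)) db.
  apply: (is_derive_eq (is_deriveM (is_derive_expRM (- (P + k)) s) (is_deriveD d1 d2))).
  by rewrite /df /GRing.scale/= /m !fctE/=; ring.
have mle0 x : m x <= 0 by rewrite ge_min lexx orbT.
have mx x : m x * x = m x ^+ 2.
  by rewrite /m; have [_|_] := leP x 0; ring.
have mle x : m x <= x by rewrite ge_min lexx.
have fle0 : f t <= 0.
  apply: (@le_trans _ _ (f 0)); last first.
    by rewrite /f /m !min_r// expr0n addr0 mulr0.
  apply: (nonincreasing_of_derive fdf) t0 => s _.
  rewrite /df mulr_ge0_le0 ?expR_ge0//.
  have := mx (a s); have := mx (b s); have := mle0 (a s); have := mle0 (b s).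
  have := mle (a s); have := mle (b s).
  move: (a s) (b s) (m (a s)) (m (b s)) => x y u v h1 h2 h3 h4 h5 h6.
  have e1 : u * P * y <= u * P * v.
    by apply: ler_wnM2l => //; rewrite mulr_le0_ge0.
  have e2 : v * k * x <= v * k * u.
    by apply: ler_wnM2l => //; rewrite mulr_le0_ge0.
  have e3 : u * c <= 0 by rewrite mulr_le0_ge0.
  have e4 : v * c <= 0 by rewrite mulr_le0_ge0.
  have e5 : 0 <= P * (u - v) ^+ 2 by rewrite mulr_ge0 ?sqr_ge0.
  have e6 : 0 <= k * (u - v) ^+ 2 by rewrite mulr_ge0 ?sqr_ge0.
  have e7 : 0 <= k * u ^+ 2 by rewrite mulr_ge0 ?sqr_ge0.
  have e8 : 0 <= P * v ^+ 2 by rewrite mulr_ge0 ?sqr_ge0.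
  have e9 := sqr_ge0 v.
  have -> : 2 * u * (c - k * x + P * y) + 2 * v * (c + k * x - (1 + P) * y) -
     (P + k) * (u ^+ 2 + v ^+ 2) =
     2 * (u * c) + 2 * (v * c) - 2 * k * (u * x) + 2 * (u * P * y) +
     2 * (v * k * x) - 2 * (1 + P) * (v * y) - (P + k) * (u ^+ 2 + v ^+ 2) by ring.
  by rewrite h5 h6; lra.
have : m (a t) ^+ 2 + m (b t) ^+ 2 <= 0.
  by move: fle0; rewrite /f pmulr_rle0 ?expR_gt0.
have := sqr_ge0 (m (a t)); have := sqr_ge0 (m (b t)) => h1 h2 h3.
have /eqP : m (a t) ^+ 2 = 0 by lra.
have /eqP : m (b t) ^+ 2 = 0 by lra.
rewrite !sqrf_eq0 => /eqP mb /eqP ma.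
by have := mle (a t); have := mle (b t); rewrite ma mb.
Qed.

(** Positivity applied to the two opposite differences, which solve the system with [c = 0]. Like
    positivity, it runs forward in time only. *)
Lemma solution_unique c a b a' b' (t : R) : solution c a b -> solution c a' b' ->
  a 0 = a' 0 -> b 0 = b' 0 -> 0 <= t -> a t = a' t /\ b t = b' t.
Proof.
move=> s s' ea eb t0.
have := solutionB s s'; have := solutionB s' s.
rewrite !subrr => h1 h2.
have z u v : u = v -> 0 <= u - v :> R by move=> ->; rewrite subrr.
have [h3 h4] := solution_ge0 (lexx 0) h1 (z _ _ (esym ea)) (z _ _ (esym eb)) t0.
have [h5 h6] := solution_ge0 (lexx 0) h2 (z _ _ ea) (z _ _ eb) t0.
by split; lra.
Qed.

End LinearFlow.

Section Quadratic.
Context (R : realType) (kap : R).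

(** The squared mass alone does not decrease when [b = 0]; a small Euclidean term repairs this. The
    symmetry in [a] and [b] lets one function serve both planes. *)
Definition quad (a b : R) : R := (a + b) ^+ 2 + kap * (a ^+ 2 + b ^+ 2).

Lemma quadC a b : quad a b = quad b a.
Proof. by rewrite /quad; ring. Qed.

Hypothesis kap_ge0 : 0 <= kap.

Lemma sqr_le_quad a b : (a + b) ^+ 2 <= quad a b.
Proof. by rewrite lerDl mulr_ge0// addr_ge0// sqr_ge0. Qed.

Lemma quad_ge0 a b : 0 <= quad a b.
Proof. by rewrite (le_trans (sqr_ge0 (a + b)))// sqr_le_quad. Qed.

Lemma le_quad a b a' b' : 0 <= a -> 0 <= b -> a <= a' -> b <= b' ->
  quad a b <= quad a' b'.
Proof.
move=> a0 b0 aa bb; have a'0 := le_trans a0 aa; have b'0 := le_trans b0 bb.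
by rewrite lerD// ?ler_wpM2l// ?lerD// ler_sqr// ?nnegrE ?addr_ge0// lerD.
Qed.

Section Decay.
Context (k P c g : R) (a b : R -> R).
Hypotheses (k_ge0 : 0 <= k) (P_ge0 : 0 <= P) (c_ge0 : 0 <= c) (g_gt0 : 0 < g).
Hypotheses (kapPk : kap * (P + k) <= 1) (g_kap : g * (2 + kap) <= kap * k).
Hypothesis (g_1 : g * (2 + kap) <= 1).
Hypotheses (sol : solution k P c a b) (a_ge0 : 0 <= a 0) (b_ge0 : 0 <= b 0).

Let D := (c * (2 + kap)) ^+ 2 / g.

(** For [c = 0] the derivative of [quad] is at most [- 2 * g] times [quad]: the squared mass
    contributes a cross term that absorbs the one of the Euclidean part, by [kapPk]. One half of
    this decay is spent on the inflow, by completing a square in [h6], which leaves rate [g] and the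
    constant [D]. *)
Lemma quad_solution t : 0 <= t ->
  quad (a t) (b t) <= D / g + expR (- g * t) * (quad (a 0) (b 0) - D / g).
Proof.
move=> t0; pose f (t : R) := expR (g * t) * (quad (a t) (b t) - D / g).
pose dq (t : R) := 2 * (a t + b t) * (2 * c - b t) +
  2 * kap * (a t * (c - k * a t + P * b t) + b t * (c + k * a t - (1 + P) * b t)).
have dqE (s : R) : is_derive s 1 (fun t => quad (a t) (b t)) (dq s).
  have [da db] := sol s.
  have dab := is_deriveD da db; have d1 := is_deriveM dab dab.
  have d2 := is_deriveD (is_deriveM da da) (is_deriveM db db).
  apply: (is_derive_eq (is_deriveD d1 (is_deriveZ kap d2))).
  by rewrite /dq /GRing.scale/= !fctE/=; ring.
have fdf (s : R) : is_derive s 1 f (expR (g * s) * (dq s + g * quad (a s) (b s) - D)).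
  have d1 := is_deriveB (dqE s) (is_derive_cst (D / g) s 1).
  apply: (is_derive_eq (is_deriveM (is_derive_expRM g s) d1)).
  rewrite /GRing.scale/= !fctE/=; field; exact: lt0r_neq0.
have /(nonincreasing_of_derive fdf) fle :
    forall s, 0 <= s -> expR (g * s) * (dq s + g * quad (a s) (b s) - D) <= 0.
  move=> s s0; rewrite pmulr_rle0 ?expR_gt0//.
  have [as0 bs0] := solution_ge0 k_ge0 P_ge0 c_ge0 sol a_ge0 b_ge0 s0.
  rewrite /dq /quad; move: (a s) (b s) as0 bs0 => x y x0 y0.
  have xy0 : 0 <= x * y by rewrite mulr_ge0.
  have h1 : (x + y) ^+ 2 + kap * (x ^+ 2 + y ^+ 2) <= (2 + kap) * (x ^+ 2 + y ^+ 2).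
    have -> : (2 + kap) * (x ^+ 2 + y ^+ 2) =
      (x + y) ^+ 2 + kap * (x ^+ 2 + y ^+ 2) + (x - y) ^+ 2 by ring.
    by rewrite lerDl sqr_ge0.
  have h2 : 0 <= (kap * k - g * (2 + kap)) * x ^+ 2.
    by rewrite mulr_ge0 ?sqr_ge0// subr_ge0.
  have h3 : 0 <= (1 - g * (2 + kap)) * y ^+ 2.
    by rewrite mulr_ge0 ?sqr_ge0// subr_ge0.
  have h4 : 0 <= (1 - kap * (P + k)) * (x * y).
    by rewrite mulr_ge0// subr_ge0.
  have h5 : 0 <= kap * (1 + P) * y ^+ 2 by rewrite !mulr_ge0 ?sqr_ge0// addr_ge0.
  have h6 : 2 * (c * (2 + kap)) * (x + y) <= g * (x + y) ^+ 2 + D.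
    have -> : g * (x + y) ^+ 2 + D = 2 * (c * (2 + kap)) * (x + y) +
       (g * (x + y) - c * (2 + kap)) ^+ 2 / g.
      by rewrite /D; field; exact: lt0r_neq0.
    by rewrite lerDl divr_ge0 ?sqr_ge0// ltW.
  have h7 : g * (x + y) ^+ 2 <= g * ((x + y) ^+ 2 + kap * (x ^+ 2 + y ^+ 2)).
    by rewrite ler_wpM2l ?(ltW g_gt0)// sqr_le_quad.
  have h8 : g * ((x + y) ^+ 2 + kap * (x ^+ 2 + y ^+ 2)) <=
    g * ((2 + kap) * (x ^+ 2 + y ^+ 2)) by rewrite ler_wpM2l ?(ltW g_gt0).
  have h9 := mulr_ge0 kap_ge0 (sqr_ge0 x).
  have h10 := mulr_ge0 kap_ge0 (sqr_ge0 y).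
  have -> : 2 * (x + y) * (2 * c - y) +
    2 * kap * (x * (c - k * x + P * y) + y * (c + k * x - (1 + P) * y)) =
    2 * (c * (2 + kap)) * (x + y) - 2 * (1 - kap * (P + k)) * (x * y)
    - 2 * (kap * k) * x ^+ 2 - 2 * y ^+ 2 - 2 * (kap * (1 + P) * y ^+ 2) by ring.
  lra.
have := fle _ t0; rewrite /f mulr0 expR0 mul1r => /(ler_wpM2l (expR_ge0 (- g * t))).
by rewrite mulrA -expRD mulNr addNr expR0 mul1r; lra.
Qed.

End Decay.

End Quadratic.

Section Norms.
Context (R : realType).
Implicit Types w v : R * R.

Definition norm1 w : R := `|w.1| + `|w.2|.

Lemma norm1_ge0 w : 0 <= norm1 w.
Proof. by rewrite addr_ge0. Qed.

Lemma norm1C w v : norm1 (w - v) = norm1 (v - w).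
Proof. by rewrite /norm1/= distrC (distrC w.2). Qed.

Lemma norm1_triangle u w v : norm1 (w - v) <= norm1 (w - u) + norm1 (u - v).
Proof.
rewrite /norm1/= addrACA lerD//.
  by rewrite -[w.1 - v.1](subrKA u.1) ler_normD.
by rewrite -[w.2 - v.2](subrKA u.2) ler_normD.
Qed.

(* [quad_norm kap] is contracted by the linear parts of both flows. *)
Definition quad_norm (kap : R) w : R := Num.sqrt (quad kap `|w.1| `|w.2|).

Context (kap : R).
Hypothesis kap_ge0 : 0 <= kap.

Lemma norm1_le_quad w : norm1 w <= quad_norm kap w.
Proof.
rewrite -[norm1 w]ger0_norm ?norm1_ge0// -sqrtr_sqr ler_sqrt ?sqr_le_quad//.
exact: quad_ge0.
Qed.

Lemma quad_le_norm1 w : kap <= 1 -> quad_norm kap w <= 2 * norm1 w.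
Proof.
move=> k1; rewrite -[2 * _]ger0_norm ?mulr_ge0 ?norm1_ge0// -sqrtr_sqr.
rewrite ler_sqrt ?sqr_ge0// /quad /norm1.
have := normr_ge0 w.1; have := normr_ge0 w.2; move: `|w.1| `|w.2| => x y y0 x0.
have h1 : kap * (x ^+ 2 + y ^+ 2) <= 1 * (x ^+ 2 + y ^+ 2).
  by rewrite ler_wpM2r// addr_ge0 ?sqr_ge0.
have h2 : 0 <= x * y by rewrite mulr_ge0.
have h3 := sqr_ge0 x; have h4 := sqr_ge0 y.
have -> : (2 * (x + y)) ^+ 2 = 4 * x ^+ 2 + 8 * (x * y) + 4 * y ^+ 2 by ring.
have -> : (x + y) ^+ 2 = x ^+ 2 + 2 * (x * y) + y ^+ 2 by ring.
lra.
Qed.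

End Norms.

(** * Flows of the two planes and their integrated jump rates *)

Section Flow.
Context (R : realType) (nu p q alpha beta delta epsilon eta kap g : R).
Hypotheses (nu_gt0 : 0 < nu) (p_gt0 : 0 < p) (q_gt0 : 0 < q).
Hypotheses (alpha_gt0 : 0 < alpha) (beta_gt0 : 0 < beta) (delta_gt0 : 0 < delta).
Hypotheses (epsilon_gt0 : 0 < epsilon) (eta_gt0 : 0 < eta).
Implicit Types (i : bool) (w v : R * R) (s t : R).

(* In plane [i] mass leaks out at unit rate from the coordinate [leak i] and
   flows from [leakless i] to [leak i] at rate [kk i], backwards at rate [PP i]. *)
Definition leak i w := if i then w.2 else w.1.
Definition leakless i w := if i then w.1 else w.2.
Definition kk i := if i then nu * beta else nu * epsilon.
Definition PP i := if i then p + nu * alpha else q + nu * delta.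

Context (phi : bool -> R * R -> R -> R * R).
Hypothesis phi_flow : is_flow nu p q alpha beta delta epsilon eta phi.
Hypotheses (kap_gt0 : 0 < kap) (kap_le1 : kap <= 1) (g_gt0 : 0 < g).
Hypotheses (kapPk : forall i, kap * (PP i + kk i) <= 1).
Hypotheses (g_kap : forall i, g * (2 + kap) <= kap * kk i) (g_1 : g * (2 + kap) <= 1).

Let kap_ge0 : 0 <= kap. Proof. exact: ltW. Qed.

Lemma kk_gt0 i : 0 < kk i.
Proof. by case: i; rewrite mulr_gt0. Qed.

Lemma PP_gt0 i : 0 < PP i.
Proof. by case: i; rewrite addr_gt0// mulr_gt0. Qed.

Let kk_ge0 i : 0 <= kk i. Proof. exact/ltW/kk_gt0. Qed.
Let PP_ge0 i : 0 <= PP i. Proof. exact/ltW/PP_gt0. Qed.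

Lemma flow0 i w : phi i w 0 = w.
Proof. by have [] := phi_flow i w. Qed.

Lemma flow_solution i w : solution (kk i) (PP i) eta
  (fun t => leakless i (phi i w t)) (fun t => leak i (phi i w t)).
Proof.
move=> t; have [_ /(_ t)[]] := phi_flow i w.
rewrite /drift/leak/leakless/kk/PP; case: i; case: (phi _ w t) => x y /= dx dy.
  by split; [apply: (is_derive_eq dx)|apply: (is_derive_eq dy)]; ring.
by split; [apply: (is_derive_eq dy)|apply: (is_derive_eq dx)]; ring.
Qed.

Lemma eq_plane i w v : leakless i w = leakless i v -> leak i w = leak i v -> w = v.
Proof. by case: w v i => [x y] [x' y'] [] /= -> ->. Qed.

Lemma leak_ge0 i w : 0 <= w.1 -> 0 <= w.2 -> 0 <= leak i w.
Proof. by case: i. Qed.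

Lemma leakless_ge0 i w : 0 <= w.1 -> 0 <= w.2 -> 0 <= leakless i w.
Proof. by case: i. Qed.

Lemma flow_ge0 i w t : 0 <= w.1 -> 0 <= w.2 -> 0 <= t ->
  0 <= (phi i w t).1 /\ 0 <= (phi i w t).2.
Proof.
move=> w1 w2 t0.
have := solution_ge0 (kk_ge0 i) (PP_ge0 i) (ltW eta_gt0) (@flow_solution i w) _ _ t0.
rewrite flow0 => /(_ (leakless_ge0 i w1 w2) (leak_ge0 i w1 w2)).
by rewrite /leak/leakless; case: i => -[].
Qed.

Lemma flowD i w s t : 0 <= t -> phi i (phi i w s) t = phi i w (s + t).
Proof.
move=> t0; have h1 := @flow_solution i (phi i w s).
have h2 := solution_shift s (@flow_solution i w).
have := solution_unique (kk_ge0 i) (PP_ge0 i) h1 h2 _ _ t0.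
rewrite flow0 addr0 => /(_ erefl erefl)[]; exact: eq_plane.
Qed.

Definition linear_flow i w t := phi i w t - phi i 0 t.

Lemma leakB i w v : leak i (w - v) = leak i w - leak i v.
Proof. by case: i. Qed.

Lemma leaklessB i w v : leakless i (w - v) = leakless i w - leakless i v.
Proof. by case: i. Qed.

Lemma flowB_solution i w v : solution (kk i) (PP i) 0
  (fun t => leakless i (phi i w t - phi i v t)) (fun t => leak i (phi i w t - phi i v t)).
Proof.
have := solutionB (@flow_solution i w) (@flow_solution i v).
by rewrite subrr; case: i.
Qed.

(** Reduces joint measurability of the flow in location and time to continuity in time of three
    trajectories. *)
Lemma flow_affine i w t : 0 <= t ->
  phi i w t = phi i 0 t + (w.1 *: linear_flow i (1, 0) t + w.2 *: linear_flow i (0, 1) t).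
Proof.
move=> t0; apply/eqP; rewrite -subr_eq0 -[eqbLHS](subrKC (phi i 0 t)).
have h0 := @flowB_solution i w 0.
have h1 := solutionZ w.1 (@flowB_solution i (1, 0) 0).
have h2 := solutionZ w.2 (@flowB_solution i (0, 1) 0).
have := solutionB h0 (solutionD h1 h2); rewrite !mulr0 addr0 subr0.
move/(solution_unique (kk_ge0 i) (PP_ge0 i)).
move=> /(_ _ _ _ (@flowB_solution i 0 0) _ _ t0).
rewrite !flow0 !subrr.
have h (f : R * R -> R) : f = leak i \/ f = leakless i ->
   f (w - 0) - (w.1 * f ((1, 0) - 0) + w.2 * f ((0, 1) - 0)) = f (0 : R * R).
  by case: w {h0 h1 h2} => x y; rewrite !subr0 /leak/leakless;
    case: i => -[] -> /=; ring.
move=> /(_ (h _ (or_intror erefl)) (h _ (or_introl erefl))).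
rewrite /linear_flow; move: (phi i w t) (phi i 0 t) (phi i (1, 0) t) (phi i (0, 1) t).
move=> [a1 a2] [b1 b2] [c1 c2] [d1 d2]; rewrite /leak/leakless.
by case: i {h0 h1 h2 h} => /= -[e1 e2]; apply/eqP; congr pair;
  rewrite /GRing.scale/= -![_ *: _]/(_ * _); lra.
Qed.

(* [A], [B] solve the homogeneous system from [|w - v|]. *)
Lemma flow_comparison i w v t : 0 <= t -> exists A B : R -> R,
  [/\ solution (kk i) (PP i) 0 A B,
      A 0 = `|leakless i (w - v)| /\ B 0 = `|leak i (w - v)|,
      forall s, 0 <= s -> `|leakless i (phi i w s - phi i v s)| <= A s &
      forall s, 0 <= s -> `|leak i (phi i w s - phi i v s)| <= B s].
Proof.
move=> t0; pose e : R * R := (`|(w - v).1|, `|(w - v).2|).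
have se := @flowB_solution i e 0; have s0 := @flowB_solution i w v.
have E0 : leakless i (phi i e 0 - phi i 0 0) = `|leakless i (w - v)|.
  by rewrite !flow0 subr0 /e; case: i {se s0}.
have E1 : leak i (phi i e 0 - phi i 0 0) = `|leak i (w - v)|.
  by rewrite !flow0 subr0 /e; case: i {se s0 E0}.
have h s : 0 <= s -> `|leakless i (phi i w s - phi i v s)| <= leakless i (phi i e s - phi i 0 s)
   /\ `|leak i (phi i w s - phi i v s)| <= leak i (phi i e s - phi i 0 s).
  have nx (x : R) : 0 <= `|x| + x by have := ler_norm (- x); rewrite normrN; lra.
  move=> s_ge0; rewrite !ler_norml.
  have sm := solutionB se s0; have sp := solutionD se s0.
  rewrite subrr in sm; rewrite addr0 in sp.
  have [] := solution_ge0 (kk_ge0 i) (PP_ge0 i) (lexx 0) sm _ _ s_ge0.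
  - by rewrite E0 !flow0 subr_ge0 ler_norm.
  - by rewrite E1 !flow0 subr_ge0 ler_norm.
  have [] := solution_ge0 (kk_ge0 i) (PP_ge0 i) (lexx 0) sp _ _ s_ge0.
  - by rewrite E0 !flow0 nx.
  - by rewrite E1 !flow0 nx.
  by move=> *; split; lra.
exists (fun t => leakless i (phi i e t - phi i 0 t)),
   (fun t => leak i (phi i e t - phi i 0 t)).
by split => // s /h[].
Qed.

Lemma quadE i w : quad kap `|w.1| `|w.2| = quad kap `|leakless i w| `|leak i w|.
Proof. by case: i => //=; rewrite quadC. Qed.

Lemma norm1E i w : norm1 w = `|leakless i w| + `|leak i w|.
Proof. by case: i => //=; rewrite addrC. Qed.

Lemma flow_contract i w v t : 0 <= t ->
  quad_norm kap (phi i w t - phi i v t) <= expR (- (g / 2) * t) * quad_norm kap (w - v).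
Proof.
move=> t0; have [A [B [sol [A0 B0] hA hB]]] := @flow_comparison i w v t t0.
have := quad_solution kap_ge0 (kk_ge0 i) (PP_ge0 i) (lexx 0) g_gt0 (kapPk i) (g_kap i) g_1 sol
   _ _ t0.
rewrite A0 B0 -quadE !(normr_ge0, mul0r, expr0n, add0r, subr0)/= => /(_ isT isT) h.
rewrite /quad_norm.
have -> : expR (- (g / 2) * t) = Num.sqrt (expR (- g * t)).
  rewrite -[LHS]ger0_norm ?expR_ge0// -sqrtr_sqr expr2 -expRD; congr (Num.sqrt (expR _)).
  by field.
rewrite -sqrtrM ?expR_ge0// ler_sqrt ?mulr_ge0 ?expR_ge0 ?quad_ge0//.
apply: le_trans h; rewrite (quadE i) le_quad//; [exact: hA|exact: hB].
Qed.

Definition lam (z : state R) t := nu * (2 * eta * t + (z.2.1 + z.2.2)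
  - ((phi z.1 z.2 t).1 + (phi z.1 z.2 t).2)).

Lemma sumE i w : w.1 + w.2 = leakless i w + leak i w.
Proof. by case: i => //=; rewrite addrC. Qed.

Lemma lam_derive i w t : is_derive t 1 (lam (i, w)) (nu * leak i (phi i w t)).
Proof.
have [da db] := @flow_solution i w t.
have dt := is_deriveZ (2 * eta) (is_derive_id t 1).
have := is_deriveB (is_deriveD dt (is_derive_cst (w.1 + w.2) t 1)) (is_deriveD da db).
move=> /(is_deriveZ nu) d.
have -> : lam (i, w) = nu \*: (2 * eta \*: id + cst (w.1 + w.2) -
   ((fun t => leakless i (phi i w t)) + (fun t => leak i (phi i w t)))).
  by apply/funext => s; rewrite /lam/= (sumE i (phi i w s)) !fctE.
by apply: (is_derive_eq d); rewrite /GRing.scale/=; ring.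
Qed.

(** The mass [A + B] of the comparison solution loses [B] per unit time, and [B] dominates the
    difference of the jump rates divided by [nu]. Hence [A + B] plus or minus the difference of the
    integrated rates over [nu] does not increase. *)
Lemma lam_coupling i w v t : 0 <= t ->
  `|lam (i, w) t - lam (i, v) t| <= nu * (norm1 (w - v) - norm1 (phi i w t - phi i v t)).
Proof.
move=> t0; have [A [B [sol [A0 B0] hA hB]]] := @flow_comparison i w v t t0.
have h (e : R) : `|e| = 1 -> (A t + B t) + e * ((lam (i, w) t - lam (i, v) t) / nu) <=
   norm1 (w - v).
  move=> e1.
  pose f s := (A s + B s) + (e / nu) * (lam (i, w) s - lam (i, v) s).
  have fdf s : is_derive s 1 f (- B s + (e / nu) * (nu * leak i (phi i w s) - nu * leak i (phi i v s))).
    have [da db] := sol s.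
    have d := is_deriveB (@lam_derive i w s) (@lam_derive i v s).
    apply: (is_derive_eq (is_deriveD (is_deriveD da db) (is_deriveZ (e / nu) d))).
    by rewrite /GRing.scale/=; ring.
  have := @nonincreasing_of_derive _ _ _ t fdf.
  have -> : f 0 = norm1 (w - v).
    by rewrite /f A0 B0 /lam/= !flow0 (norm1E i); ring.
  move=> hh; rewrite [X in _ + X](_ : _ = (e / nu) * (lam (i, w) t - lam (i, v) t)); last first.
    by rewrite mulrA mulrAC.
  apply: hh => // s s0; rewrite -mulrBr -leakB mulrA divfK ?lt0r_neq0// addrC subr_le0.
  by apply: le_trans (hB s s0); rewrite (le_trans (ler_norm _))// normrM e1 mul1r.
have h1 := h 1 (normr1 _); have h2 := h (-1) (normrN1 _).
have nuP : nu != 0 by rewrite lt0r_neq0.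
have -> : lam (i, w) t - lam (i, v) t = nu * ((lam (i, w) t - lam (i, v) t) / nu).
  by rewrite mulrC divfK.
rewrite normrM gtr0_norm// ler_wpM2l ?(ltW nu_gt0)// (norm1E i (phi i w t - _)).
have := hA _ t0; have := hB _ t0.
by move=> *; rewrite ler_norml; lra.
Qed.

Lemma lamD i w s t : 0 <= t ->
  lam (i, w) (s + t) = lam (i, w) s + lam (i, phi i w s) t.
Proof. by move=> t0; rewrite /lam/= flowD//; ring. Qed.

Lemma lam0 z : lam z 0 = 0.
Proof. by rewrite /lam flow0; ring. Qed.

Lemma lam_ge0 i w t : 0 <= w.1 -> 0 <= w.2 -> 0 <= t -> 0 <= lam (i, w) t.
Proof.
move=> w1 w2 t0; have [c /andP[c0 _] E] := mean_value (@lam_derive i w) t0.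
rewrite -[leLHS](lam0 (i, w)) -subr_ge0 E mulr_ge0 ?subr_ge0//.
have [? ?] := flow_ge0 i w1 w2 c0.
by rewrite mulr_ge0 ?leak_ge0// ltW.
Qed.

Definition box (r : R) w := [/\ 0 <= w.1, 0 <= w.2 & quad kap w.1 w.2 <= r].
(** The level [D / g] towards which [quad_solution] relaxes when [c = eta]; every larger sublevel
    set is invariant. *)
Definition box_radius := (eta * (2 + kap)) ^+ 2 / g / g.

Lemma box_le r i w : box r w ->
  [/\ 0 <= leak i w, 0 <= leakless i w, leak i w <= 1 + r & leakless i w <= 1 + r].
Proof.
case=> w1 w2 wr.
have := sqr_le_quad kap_ge0 w.1 w.2; have := sqr_ge0 (w.1 + w.2 - 1) => h1 h2.
have h3 : w.1 + w.2 <= 1 + r.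
  have E : (w.1 + w.2 - 1) ^+ 2 = (w.1 + w.2) ^+ 2 - 2 * (w.1 + w.2) + 1 by ring.
  lra.
by split; [exact: leak_ge0|exact: leakless_ge0| |];
  rewrite /leak/leakless; case: i; lra.
Qed.

Lemma flow_box r i w t : box_radius <= r -> box r w -> 0 <= t -> box r (phi i w t).
Proof.
move=> r0 [w1 w2 wr] t0; have [p1 p2] := flow_ge0 i w1 w2 t0; split => //.
have := quad_solution kap_ge0 (kk_ge0 i) (PP_ge0 i) (ltW eta_gt0) g_gt0
  (kapPk i) (g_kap i) g_1 (@flow_solution i w) _ _ t0.
rewrite flow0 => /(_ (leakless_ge0 i w1 w2) (leak_ge0 i w1 w2)).
have qE j (v : R * R) : quad kap (leakless j v) (leak j v) = quad kap v.1 v.2.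
  by case: j => //=; rewrite quadC.
rewrite !qE -/box_radius => h; apply: (le_trans h).
have e0 := expR_ge0 (- g * t).
have e1 : expR (- g * t) <= 1 by rewrite -expR0 ler_expR mulNr oppr_le0 mulr_ge0// ltW.
move: e0 e1; move: (expR _) => e e0 e1.
have h1 : e * (quad kap w.1 w.2 - box_radius) <= e * (r - box_radius).
  by rewrite ler_wpM2l// lerD2r.
have h2 : 0 <= (1 - e) * (r - box_radius) by rewrite mulr_ge0 ?subr_ge0.
lra.
Qed.

Definition speed (r : R) := 2 * (eta + (kk true + kk false + PP true + PP false + 1) * (1 + r)).

Lemma flow_speed r i w t : box_radius <= r -> box r w -> 0 <= t ->
  norm1 (phi i w t - w) <= speed r * t.
Proof.
move=> r0 bw t0; rewrite (norm1E i) leaklessB leakB.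
have key (f df : R -> R) : (forall s : R, is_derive s 1 f (df s)) ->
    (forall s, 0 <= s -> `|df s| <= speed r / 2) -> `|f t - f 0| <= speed r / 2 * t.
  move=> fdf hdf; have [c /andP[c0 _] ->] := mean_value fdf t0.
  by rewrite subr0 normrM (ger0_norm t0) ler_wpM2r// hdf.
have b s : 0 <= s -> box r (phi i w s) by move=> s0; apply: flow_box.
have [k1 k2] := (kk_gt0 true, kk_gt0 false); have [P1 P2] := (PP_gt0 true, PP_gt0 false).
have ki j : kk j <= kk true + kk false by case: j; lra.
have Pi j : PP j <= PP true + PP false by case: j; lra.
(* With [e = 0] the two terms add up to the derivative of the leakless coordinate; with [e = 1]
   their difference is that of the leaking one. *)
have bnd s (e : R) : 0 <= s -> e = 0 \/ e = 1 ->
   `|eta - e * leak i (phi i w s)| + `|- kk i * leakless i (phi i w s) + PP i * leak i (phi i w s)|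
    <= speed r / 2.
  move=> s0 he; have [a0 b0 aM bM] := box_le i (b s s0).
  move: (leak _ _) (leakless _ _) a0 b0 aM bM => x y x0 y0 xM yM.
  have h1 : kk i * y <= (kk true + kk false) * (1 + r) by rewrite ler_pM.
  have h2 : PP i * x <= (PP true + PP false) * (1 + r) by rewrite ler_pM.
  have h3 : 0 <= kk i * y by rewrite mulr_ge0.
  have h4 : 0 <= PP i * x by rewrite mulr_ge0.
  have n1 : `|eta - e * x| <= eta + (1 + r).
    by case: he => ->; rewrite ler_norml; have := eta_gt0; lra.
  have n2 : `|- kk i * y + PP i * x| <= (kk true + kk false + PP true + PP false) * (1 + r).
    by rewrite ler_norml; apply/andP; split; lra.
  rewrite /speed [leRHS](_ : _ = eta + (1 + r) + (kk true + kk false + PP true + PP false) * (1 + r)).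
    exact: lerD.
  by field.
have -> : speed r * t = speed r / 2 * t + speed r / 2 * t by field.
have d1 s := (@flow_solution i w s).1; have d2 s := (@flow_solution i w s).2.
apply: lerD.
  have := key _ _ d1; rewrite flow0; apply => s s0.
  apply: le_trans (bnd s 0 s0 (or_introl erefl)).
  by apply: le_trans (ler_normD _ _); rewrite le_eqVlt; apply/orP; left; apply/eqP; congr `|_|; ring.
have := key _ _ d2; rewrite flow0; apply => s s0.
apply: le_trans (bnd s 1 s0 (or_intror erefl)).
rewrite -[X in _ <= _ + X]normrN.
by apply: le_trans (ler_normD _ _); rewrite le_eqVlt; apply/orP; left; apply/eqP; congr `|_|; ring.
Qed.

Lemma lam_le r i w t : box_radius <= r -> box r w -> 0 <= t ->
  lam (i, w) t <= nu * (1 + r) * t.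
Proof.
move=> r0 bw t0; have [c /andP[c0 _] E] := mean_value (@lam_derive i w) t0.
rewrite -[lam _ _]subr0 -{1}(lam0 (i, w)) E subr0 ler_wpM2r// ler_wpM2l ?(ltW nu_gt0)//.
by have [] := box_le i (flow_box i r0 bw c0).
Qed.

(* [(1 + PP i) / nu * lam + leak] grows at rate at least [eta]. *)
Lemma lam_lower r i w t : box_radius <= r -> box r w -> 0 <= t ->
  nu * (eta * t - (1 + r)) <= (1 + PP i) * lam (i, w) t.
Proof.
move=> r0 bw t0.
pose f s := eta * s - (1 + PP i) / nu * lam (i, w) s - leak i (phi i w s).
have fdf s : is_derive s 1 f (- (kk i * leakless i (phi i w s))).
  have de := is_deriveZ eta (is_derive_id s 1).
  have [da db] := @flow_solution i w s.
  have dl := is_deriveZ ((1 + PP i) / nu) (@lam_derive i w s).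
  apply: (is_derive_eq (is_deriveB (is_deriveB de dl) db)).
  by rewrite -![_ *: _]/(_ * _); field; rewrite lt0r_neq0.
have := nonincreasing_of_derive fdf _ t0.
rewrite /f flow0 lam0 !mulr0 !subr0 sub0r => h.
have {}h : eta * t - (1 + PP i) / nu * lam (i, w) t - leak i (phi i w t) <= - leak i w.
  apply: h => s s0; rewrite oppr_le0 mulr_ge0//.
  by have [] := box_le i (flow_box i r0 bw s0).
have [l0 _ _ _] := box_le i bw.
have [_ _ l1 _] := box_le i (flow_box i r0 bw t0).
have -> : (1 + PP i) * lam (i, w) t = nu * ((1 + PP i) / nu * lam (i, w) t).
  by field; rewrite lt0r_neq0.
by rewrite ler_wpM2l ?(ltW nu_gt0)//; lra.
Qed.

Lemma leak_continuous i w : continuous (fun s => leak i (phi i w s)).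
Proof.
move=> s; apply/differentiable_continuous/derivable1_diffP.
by have [_ []] := @flow_solution i w s.
Qed.

(** The fundamental theorem of calculus, with the degenerate interval [t = 0] treated apart. *)
Lemma cumulative_rateE z t : 0 <= t -> cumulative_rate nu phi z t = lam z t.
Proof.
case: z => i w; rewrite le_eqVlt => /predU1P[<-|t0].
  by rewrite lam0 /cumulative_rate set_itv1 Rintegral_set1.
have jE u : jump_rate nu ((i, w).1, phi (i, w).1 (i, w).2 u) = nu * leak i (phi i w u).
  by rewrite /jump_rate/leak/=; case: i.
rewrite /cumulative_rate /Rintegral.
under eq_integral do rewrite jE.
have cl : continuous (lam (i, w)).
  move=> s; apply/differentiable_continuous/derivable1_diffP.
  by have [] := @lam_derive i w s.
rewrite (@continuous_FTC2 _ _ (lam (i, w)))//=.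
- by rewrite lam0 subr0.
- apply: continuous_subspaceT => s.
  exact: (cvgM (cvg_cst nu) (@leak_continuous i w s)).
- split.
  + by move=> s _; have [] := @lam_derive i w s.
  + exact/cvg_at_right_filter/cl.
  + exact/cvg_at_left_filter/cl.
- by move=> s _; rewrite derive1E; have [_ ->] := @lam_derive i w s.
Qed.

End Flow.

(** * Contraction of the discrete chain *)

(** What the coupling and the comparison need of the flows on one invariant set [B]; the whole
    quadrant is reached later by letting [B] grow. Only plane 0 needs the lower bound [cf_lower],
    because the copies are brought together in plane 1. *)
Record compact_flow (R : realType) (phi : bool -> R * R -> R -> R * R)
    (lam : state R -> R -> R) (N : R * R -> R) (B : set (R * R))
    (nu g D C L tau c : R) : Prop := CompactFlow {
  cf_nu : 0 < nu; cf_g : 0 < g; cf_D : 0 < D; cf_C : 0 <= C; cf_L : 0 <= L;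
  cf_tau : 0 <= tau; cf_c : 0 < c;
  cf_ge0 : forall w, B w -> 0 <= w.1 /\ 0 <= w.2;
  cf_norm : forall w, norm1 w <= N w <= 2 * norm1 w;
  cf_normC : forall w v, N (w - v) = N (v - w);
  cf_diam : forall w v, B w -> B v -> N (w - v) <= D;
  cf_flow0 : forall i w, phi i w 0 = w;
  cf_flowD : forall i w s t, 0 <= t -> phi i (phi i w s) t = phi i w (s + t);
  cf_flowB : forall i w t, B w -> 0 <= t -> B (phi i w t);
  cf_contract : forall i w v t, 0 <= t ->
    N (phi i w t - phi i v t) <= expR (- g * t) * N (w - v);
  cf_speed : forall i w t, B w -> 0 <= t -> norm1 (phi i w t - w) <= C * t;
  cf_lamD : forall i w s t, 0 <= t ->
    lam (i, w) (s + t) = lam (i, w) s + lam (i, phi i w s) t;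
  cf_lam_ge0 : forall i w t, B w -> 0 <= t -> 0 <= lam (i, w) t;
  cf_lam_le : forall i w t, B w -> 0 <= t -> lam (i, w) t <= L * t;
  cf_coupling : forall i w v t, 0 <= t -> `|lam (i, w) t - lam (i, v) t| <=
    nu * (norm1 (w - v) - norm1 (phi i w t - phi i v t));
  cf_lower : forall w t, B w -> tau <= t -> c <= lam (false, w) t }.

Lemma expRN_le1 (R : realType) (x : R) : 0 <= x -> expR (- x) <= 1.
Proof. by move=> x0; rewrite -expR0 ler_expR oppr_le0. Qed.

Lemma subr_expRN_le (R : realType) (x : R) : 1 - expR (- x) <= x.
Proof. by have := expR_ge1Dx (- x); lra. Qed.

Section Chain.
Context (R : realType) (phi : bool -> R * R -> R -> R * R) (lam : state R -> R -> R).
Implicit Types (f : state R -> R) (w v : R * R) (z : state R).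

(* The [min] only matters off the state space, where [lam] may be negative. *)
Definition stay (h : R) z : R := Num.min 1 (expR (- lam z h)).

Definition step (h : R) f z : R :=
  stay h z * f (z.1, phi z.1 z.2 h) + (1 - stay h z) * f (~~ z.1, phi z.1 z.2 h).

Lemma stay_ge0 h z : 0 <= stay h z.
Proof. by rewrite le_min ler01 expR_ge0. Qed.

Lemma stay_le1 h z : stay h z <= 1.
Proof. by rewrite ge_min lexx. Qed.

Lemma iter_stepZ n h f s : iter n (step h) (fun z => s * f z) =
  fun z => s * iter n (step h) f z.
Proof.
elim: n => //= n ->; apply/funext => z; rewrite /step; ring.
Qed.

Lemma iter_stepD n h f (a : R) : iter n (step h) (fun z => a + f z) =
  fun z => a + iter n (step h) f z.
Proof.
elim: n => //= n ->; apply/funext => z; rewrite /step; ring.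
Qed.

Context (N : R * R -> R) (B : set (R * R)) (nu g D C L tau c : R).
Hypothesis F : compact_flow phi lam N B nu g D C L tau c.

Let N_ge0 w : 0 <= N w.
Proof. by have /andP[+ _] := cf_norm F w; apply: le_trans; exact: norm1_ge0. Qed.

Lemma stayE h i w : B w -> 0 <= h -> stay h (i, w) = expR (- lam (i, w) h).
Proof.
by move=> Bw h0; rewrite /stay min_r// -expR0 ler_expR oppr_le0 (cf_lam_ge0 F).
Qed.

Lemma le_iter_step n h f f' : 0 <= h -> (forall i w, B w -> f (i, w) <= f' (i, w)) ->
  forall i w, B w -> iter n (step h) f (i, w) <= iter n (step h) f' (i, w).
Proof.
move=> h0 ff'; elim: n => [//|n IH] i w Bw /=.
have Bh := cf_flowB F i Bw h0.
by rewrite lerD// ler_wpM2l// ?stay_ge0 ?subr_ge0 ?stay_le1// IH.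
Qed.

Lemma iter_step_cst n h (a : R) : iter n (step h) (fun=> a) = fun=> a.
Proof. by elim: n => //= n ->; apply/funext => z; rewrite /step; ring. Qed.

Definition osc_le (s : R) f :=
  forall i w j v, B w -> B v -> f (i, w) - f (j, v) <= s.

(** Turns a bound on the oscillation into a pair of constants, which the chain, being monotone and
    fixing constants, carries along. *)
Lemma osc_le_range s f i0 w0 (S : set (state R)) : S (i0, w0) ->
  (forall z z', S z -> S z' -> f z - f z' <= s) ->
  exists a, forall z, S z -> a <= f z <= a + s.
Proof.
move=> S0 fs; exists (inf [set f z | z in S]) => z Sz; apply/andP; split.
  apply: ge_inf; last by exists z.
  exists (f z - s) => _ [z' Sz' <-]; have := fs _ _ Sz Sz'; lra.
rewrite -lerBlDr; apply: lb_le_inf; first by exists (f (i0, w0)), (i0, w0).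
by move=> _ [z' Sz' <-]; have := fs _ _ Sz Sz'; lra.
Qed.

Lemma iter_step_osc n h s f : 0 <= h -> osc_le s f -> osc_le s (iter n (step h) f).
Proof.
move=> h0 fs i w j v Bw Bv.
have [|z z' /= Sz Sz'|a fa] := @osc_le_range s f i w [set z | B z.2] => //.
  by case: z z' Sz Sz' => [? ?] [? ?]; apply: fs.
have h1 := @le_iter_step n h (fun=> a) f h0 (fun i w Bw => (andP (fa (i, w) Bw)).1).
have h2 := @le_iter_step n h f (fun=> a + s) h0 (fun i w Bw => (andP (fa (i, w) Bw)).2).
have := h1 _ _ Bv; have := h2 _ _ Bw => /(_ i) + /(_ j).
by rewrite !iter_step_cst; lra.
Qed.

(* [1 - expR (- nu * norm1 (w - v))] bounds the probability that two copies
   started in the same plane and coupled to jump together ever separate. *)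
Definition coupled (s K : R) f := forall i w v, B w -> B v ->
  `|f (i, w) - f (i, v)| <= s * (1 - expR (- nu * norm1 (w - v))) + K * N (w - v).

(** With staying probabilities [a <= a'], both copies stay with probability [a], both switch with
    probability [1 - a'], and they separate with probability [a' - a], at a cost of at most [s].
    Joint moves keep them in one plane, where the induction bound holds at the new distance. *)
Lemma step_coupled h s K f : 0 <= h -> 0 <= s -> 0 <= K -> osc_le s f ->
  coupled s K f -> coupled s (expR (- g * h) * K) (step h f).
Proof.
move=> h0 s0 K0 fs fK i; suff key w v : B w -> B v -> lam (i, v) h <= lam (i, w) h ->
    `|step h f (i, w) - step h f (i, v)| <=
    s * (1 - expR (- nu * norm1 (w - v))) + expR (- g * h) * K * N (w - v).
  move=> w v Bw Bv; have [/key|/ltW/key] := leP (lam (i, v) h) (lam (i, w) h).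
    exact.
  by move=> /(_ Bv Bw); rewrite distrC norm1C (cf_normC F).
move=> Bw Bv lvw.
have Bwh := cf_flowB F i Bw h0; have Bvh := cf_flowB F i Bv h0.
rewrite /step/= !stayE//.
have cpl := cf_coupling F i w v h0; have ctr := cf_contract F i w v h0.
set e := phi i w h - phi i v h in cpl ctr.
have fA := fK i _ _ Bwh Bvh; have fB := fK (~~ i) _ _ Bwh Bvh.
have fAB : `|f (~~ i, phi i w h) - f (i, phi i v h)| <= s.
  by rewrite ler_norml; have h1 := fs _ _ _ _ Bwh Bvh; have h2 := fs _ _ _ _ Bvh Bwh;
    apply/andP; split; [rewrite lerNl opprB; exact: h2|exact: h1].
set a := expR (- lam (i, w) h); set a' := expR (- lam (i, v) h).
have a0 : 0 <= a by exact: expR_ge0.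
have a'1 : a' <= 1 by rewrite -expR0 ler_expR oppr_le0 (cf_lam_ge0 F).
have aa' : a <= a' by rewrite ler_expR lerN2.
(* The bound on the probability of never separating is preserved: [a / a'] is at most [1 - (a' - a)]
   because [a' <= 1], and [cf_coupling] bounds [a / a'] from below by the loss of distance. *)
have rho : expR (- nu * norm1 (w - v)) <= (1 - (a' - a)) * expR (- nu * norm1 e).
  have -> : expR (- nu * norm1 (w - v)) =
      expR (- (nu * (norm1 (w - v) - norm1 e))) * expR (- nu * norm1 e).
    by rewrite -expRD; congr expR; ring.
  apply: ler_wpM2r; first exact: expR_ge0.
  apply: (@le_trans _ _ (expR (- (lam (i, w) h - lam (i, v) h)))).
    by rewrite ler_expR lerN2; apply: le_trans cpl; exact: ler_norm.
  have -> : expR (- (lam (i, w) h - lam (i, v) h)) = a / a'.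
    by rewrite /a /a' -expRN -expRD; congr expR; ring.
  have a'0 : 0 < a' by exact: expR_gt0.
  rewrite ler_pdivrMr//; have : 0 <= (1 - a') * (a' - a) by rewrite mulr_ge0 ?subr_ge0.
  lra.
set Z := expR (- g * h) * K * N (w - v).
have Z0 : 0 <= Z by rewrite !mulr_ge0 ?expR_ge0.
have ZE : K * N e <= Z.
  by rewrite /Z [_ * K]mulrC -mulrA ler_wpM2l.
move: fA fB fAB; rewrite -/e.
move: (f (i, phi i w h)) (f (i, phi i v h)) (f (~~ i, phi i w h)) (f (~~ i, phi i v h)).
move=> A A' b b' fA fB fAb.
set E := expR (- nu * norm1 e) in rho fA fB *; set E0 := expR _ in rho *.
have E_le : E <= 1 by rewrite -expR0 ler_expR mulNr oppr_le0 mulr_ge0 ?norm1_ge0// ltW ?(cf_nu F).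
have h1 : `|a * (A - A')| <= a * (s * (1 - E) + Z).
  by rewrite normrM (ger0_norm a0) ler_wpM2l//; lra.
have h2 : `|(1 - a') * (b - b')| <= (1 - a') * (s * (1 - E) + Z).
  by rewrite normrM ger0_norm ?subr_ge0// ler_wpM2l ?subr_ge0//; lra.
have h3 : `|(a' - a) * (b - A')| <= (a' - a) * s.
  by rewrite normrM ger0_norm ?subr_ge0// ler_wpM2l ?subr_ge0.
have -> : a * A + (1 - a) * b - (a' * A' + (1 - a') * b') =
  a * (A - A') + (1 - a') * (b - b') + (a' - a) * (b - A') by ring.
apply: le_trans (ler_normD _ _) _; apply: le_trans (lerD (ler_normD _ _) h3) _.
have h4 : s * E0 <= s * ((1 - (a' - a)) * E) by rewrite ler_wpM2l.
have h5 : 0 <= (a' - a) * Z by rewrite mulr_ge0 ?subr_ge0.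
lra.
Qed.

Lemma iter_step_coupled n h s K f : 0 <= h -> 0 <= s -> 0 <= K -> osc_le s f ->
  coupled s K f -> coupled s (expR (- g * (n%:R * h)) * K) (iter n (step h) f).
Proof.
move=> h0 s0 K0 fs fK; elim: n => [|n IH]; first by rewrite mul0r mulr0 expR0 mul1r.
have -> : expR (- g * (n.+1%:R * h)) * K = expR (- g * h) * (expR (- g * (n%:R * h)) * K).
  by rewrite mulrA -expRD; congr (expR _ * _); rewrite -natr1; ring.
by rewrite iterS; apply: step_coupled => //; [rewrite mulr_ge0 ?expR_ge0|exact: iter_step_osc].
Qed.

Definition lip (K : R) f := forall i w v, B w -> B v ->
  `|f (i, w) - f (i, v)| <= K * N (w - v).

Lemma lip_coupled s K f : 0 <= s -> lip K f -> coupled s K f.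
Proof.
move=> s0 fK i w v Bw Bv; apply: le_trans (fK i w v Bw Bv) _.
rewrite lerDr mulr_ge0// subr_ge0 -expR0 ler_expR mulNr oppr_le0.
by rewrite mulr_ge0 ?norm1_ge0// ltW ?(cf_nu F).
Qed.

Lemma coupled_lip s K f : 0 <= s -> coupled s K f -> lip (s * nu + K) f.
Proof.
move=> s0 fK i w v Bw Bv; apply: le_trans (fK i w v Bw Bv) _.
rewrite mulrDl lerD2r -mulrA ler_wpM2l// mulNr.
apply: le_trans (subr_expRN_le _) _.
by rewrite ler_wpM2l ?(ltW (cf_nu F))//; have /andP[] := cf_norm F (w - v).
Qed.

(** The constant never exceeds [s * nu + K], whatever [n] and [h]. This uniformity makes the
    one-step errors of [Ex_iter] summable. *)
Lemma iter_step_lip n h s K f : 0 <= h -> 0 <= s -> 0 <= K -> osc_le s f -> lip K f ->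
  lip (s * nu + expR (- g * (n%:R * h)) * K) (iter n (step h) f).
Proof.
move=> h0 s0 K0 fs fK; apply: coupled_lip => //.
by apply: iter_step_coupled => //; exact: lip_coupled.
Qed.

Definition in_plane1 z : R := if z.1 then 1 else 0.

(** From plane 1 it suffices never to switch. From plane 0 it suffices to switch once and not
    return; the absence of a return is charged for the whole duration, whenever the switch
    occurs. *)
Lemma iter_step_plane1 n h w : 0 <= h -> B w ->
  expR (- (L * (n%:R * h))) <= iter n (step h) in_plane1 (true, w) /\
  expR (- (L * (n%:R * h))) * (1 - expR (- lam (false, w) (n%:R * h)))
    <= iter n (step h) in_plane1 (false, w).
Proof.
move=> h0; elim: n w => [|n IH] w Bw.
  have l0 : lam (false, w) 0 = 0.
    by have := cf_lamD F false w 0 (lexx 0); rewrite (cf_flow0 F) addr0; lra.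
  by rewrite /= mul0r mulr0 l0 oppr0 expR0 subrr mulr0 /in_plane1/= lexx.
have [Bt Bf] := (cf_flowB F true Bw h0, cf_flowB F false Bw h0).
have nh : 0 <= n%:R * h by rewrite mulr_ge0.
have EL : expR (- (L * (n.+1%:R * h))) = expR (- (L * h)) * expR (- (L * (n%:R * h))).
  by rewrite -expRD; congr expR; rewrite -natr1; ring.
have [t1 f1] := IH _ Bt; have [t2 f2] := IH _ Bf.
rewrite !iterS /step/= !stayE// EL.
have q0 : 0 <= expR (- (L * (n%:R * h))) by exact: expR_ge0.
have Lh : expR (- (L * h)) <= 1.
  by rewrite -expR0 ler_expR oppr_le0 mulr_ge0// (cf_L F).
have l1 i : expR (- lam (i, w) h) <= 1.
  by rewrite -expR0 ler_expR oppr_le0 (cf_lam_ge0 F).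
have f0 : 0 <= iter n (step h) in_plane1 (false, phi true w h).
  by apply: le_trans f1; rewrite mulr_ge0// subr_ge0 expRN_le1// (cf_lam_ge0 F).
split.
  rewrite -[leLHS]addr0 lerD//; last by rewrite mulr_ge0// subr_ge0 l1.
  rewrite ler_pM ?expR_ge0// ler_expR lerN2; exact: (cf_lam_le F).
have -> : n.+1%:R * h = h + n%:R * h by rewrite -natr1; ring.
rewrite (cf_lamD F)// opprD expRD.
set E := expR (- lam (false, phi false w h) _) in f2 *.
set a := expR (- lam (false, w) h).
have a0 : 0 <= a by exact: expR_ge0.
have a1 : a <= 1 by exact: l1.
set q := expR (- (L * (n%:R * h))) in q0 t2 f2 *.
have E1 : E <= 1 by rewrite /E expRN_le1// (cf_lam_ge0 F).
have E0 : 0 <= E by exact: expR_ge0.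
have h1 : a * (q * (1 - E)) <= a * iter n (step h) in_plane1 (false, phi false w h).
  by rewrite ler_wpM2l.
have h2 : (1 - a) * q <= (1 - a) * iter n (step h) in_plane1 (true, phi false w h).
  by rewrite ler_wpM2l// subr_ge0.
have h3 : 0 <= (1 - expR (- (L * h))) * (q * (1 - a * E)).
  by rewrite !mulr_ge0 ?subr_ge0// -[1]mulr1 ler_pM.
lra.
Qed.

(** The extra unit of time leaves room for rounding [tau] up to a multiple of a step [h <= 1]. *)
Let eps := expR (- (L * (tau + 1))) * (1 - expR (- c)).

Let eps_gt0 : 0 < eps.
Proof. by rewrite mulr_gt0 ?expR_gt0// subr_gt0 -expR0 ltr_expR oppr_lt0 (cf_c F). Qed.

Lemma iter_step_plane1_ge n h i w : 0 <= h -> B w -> tau <= n%:R * h <= tau + 1 ->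
  eps <= iter n (step h) in_plane1 (i, w).
Proof.
move=> h0 Bw /andP[t1 t2]; have [p1 p0] := iter_step_plane1 n h0 Bw.
have e1 : expR (- (L * (tau + 1))) <= expR (- (L * (n%:R * h))).
  by rewrite ler_expR lerN2 ler_wpM2l ?(cf_L F).
have e2 : 1 - expR (- c) <= 1 - expR (- lam (false, w) (n%:R * h)).
  by rewrite lerD2l lerN2 ler_expR lerN2 (cf_lower F).
have c1 : expR (- c) <= 1 by rewrite -expR0 ler_expR oppr_le0 (ltW (cf_c F)).
case: i.
  apply: le_trans p1; apply: le_trans e1.
  by rewrite ger_pMr ?expR_gt0// gerBl expR_ge0.
by apply: le_trans p0; rewrite ler_pM ?expR_ge0// subr_ge0.
Qed.

(* Both copies are in plane 1 with probability at least [eps], where [f]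
   oscillates less. *)
Lemma iter_step_osc_contract n h s k f : 0 <= h -> tau <= n%:R * h <= tau + 1 -> 0 <= k <= 1 ->
  0 <= s -> osc_le s f ->
  (forall w v, B w -> B v -> f (true, w) - f (true, v) <= (1 - k) * s) ->
  osc_le ((1 - eps * k) * s) (iter n (step h) f).
Proof.
move=> h0 nh /andP[k0 k1] s0 fs fk i w j v Bw Bv.
have [|[i1 w1] [i2 w2] /= Sz Sz'|a fa] := @osc_le_range s f i w [set z | B z.2] => //.
  exact: fs.
have [|[i1 w1] [i2 w2] /= [-> Sz] [-> Sz']|b fb] :=
    @osc_le_range ((1 - k) * s) f true w [set z | z.1 = true /\ B z.2] => //.
  exact: fk.
have ew := iter_step_plane1_ge i h0 Bw nh.
have ev := iter_step_plane1_ge j h0 Bv nh.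
(* The values of [f] lie in [[a, a + s]] everywhere and between [l] and [u] on plane 1, so [f] is
   squeezed between two affine functions of [in_plane1], which the chain transforms explicitly. *)
pose u := Num.min (b + (1 - k) * s) (a + s); pose l := Num.max b a.
have ule : u <= a + s by rewrite ge_min lexx orbT.
have lge : a <= l by rewrite le_max lexx orbT.
have ul : u - l <= (1 - k) * s.
  have : u <= b + (1 - k) * s by rewrite ge_min lexx.
  have : b <= l by rewrite le_max lexx.
  lra.
have up i' w' : B w' -> f (i', w') <= (a + s) + (u - (a + s)) * in_plane1 (i', w').
  move=> Bw'; rewrite /in_plane1; have /andP[_ f1] := fa (i', w') Bw'.
  case: i' f1 => /= f1; last by rewrite mulr0 addr0.
  have /andP[_ f2] := fb (true, w') (conj erefl Bw').
  by rewrite mulr1 subrKC le_min f1 f2.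
have lo i' w' : B w' -> a + (l - a) * in_plane1 (i', w') <= f (i', w').
  move=> Bw'; rewrite /in_plane1; have /andP[f1 _] := fa (i', w') Bw'.
  case: i' f1 => /= f1; last by rewrite mulr0 addr0.
  have /andP[f2 _] := fb (true, w') (conj erefl Bw').
  by rewrite mulr1 subrKC ge_max f1 f2.
have h1 := @le_iter_step n h f (fun z => (a + s) + (u - (a + s)) * in_plane1 z) h0 up i _ Bw.
have h2 := @le_iter_step n h (fun z => a + (l - a) * in_plane1 z) f h0 lo j _ Bv.
rewrite iter_stepD iter_stepZ in h1; rewrite iter_stepD iter_stepZ in h2.
have h3 : 0 <= (a + s - u) * (iter n (step h) in_plane1 (i, w) - eps).
  by rewrite mulr_ge0 ?subr_ge0.
have h4 : 0 <= (l - a) * (iter n (step h) in_plane1 (j, v) - eps).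
  by rewrite mulr_ge0 ?subr_ge0.
have h5 : 0 <= eps * ((1 - k) * s - (u - l)) by rewrite mulr_ge0 ?subr_ge0// ltW.
lra.
Qed.

(** Two copies in one plane, at distance at most [D], never separate with probability at least
    [2 * k1]. One half of this gain is given up to the Lipschitz remainder. *)
Let k1 := expR (- (nu * D)) / 2.
(** The second entry is the contraction of the oscillation. The first suits the Lipschitz constant,
    which falls from [4 * nu * s] to at most [2 * nu * s]. *)
Let theta := Num.max (1 / 2) (1 - eps * k1).

Let theta_ge : 1 / 2 <= theta /\ 1 - eps * k1 <= theta.
Proof. by rewrite !le_max !lexx orbT. Qed.

Let k1_01 : 0 < k1 <= 1.
Proof.
rewrite divr_gt0 ?expR_gt0//= ler_pdivrMr// mul1r.
have : expR (- (nu * D)) <= 1.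
  by rewrite -expR0 ler_expR oppr_le0 mulr_ge0 ?ltW ?(cf_nu F)// (cf_D F).
lra.
Qed.

Let theta_lt1 : theta < 1.
Proof.
rewrite gt_max; apply/andP; split; first lra.
by rewrite ltrBlDr ltrDl mulr_gt0//; case/andP: k1_01.
Qed.

(* after time [t2] the contracted part of the bound is at most [nu] and [k1] *)
Let t2 := (4 * nu * (1 / nu + D / k1)) / g.

Let t20 : 0 <= t2.
Proof.
have [nu0 D0 g0] := (And3 (cf_nu F) (cf_D F) (cf_g F)).
have k0 : 0 < k1 by case/andP: k1_01.
apply/ltW/divr_gt0 => //; apply: mulr_gt0; first exact: mulr_gt0.
by apply: addr_gt0; exact: divr_gt0.
Qed.

(** From [x * expR (- x) <= 1] at [x = g * t]. The sum in [t2] makes the two ratios in [E1] add up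
    to at most 1, so each is at most 1. *)
Let t2_le t : t2 <= t ->
  expR (- g * t) * (4 * nu) <= nu /\ expR (- g * t) * (4 * nu) * D <= k1.
Proof.
have [nu0 D0 g0] := (And3 (cf_nu F) (cf_D F) (cf_g F)).
have k0 : 0 < k1 by case/andP: k1_01.
move=> tt; have gt : 4 * nu * (1 / nu + D / k1) <= g * t.
  by rewrite [leRHS]mulrC -ler_pdivrMr.
have q0 : 0 < g * t.
  apply: lt_le_trans gt; apply: mulr_gt0; first exact: mulr_gt0.
  by apply: addr_gt0; exact: divr_gt0.
have e : expR (- g * t) * (g * t) <= 1.
  rewrite mulNr expRN mulrC ler_pdivrMr ?expR_gt0// mul1r.
  by apply: le_trans (expR_ge1Dx _); lra.
have e0 := expR_ge0 (- g * t).
have h1 : 4 * nu * (1 / nu + D / k1) * expR (- g * t) <= 1.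
  by apply: le_trans e; rewrite mulrC ler_wpM2l.
have E1 : 4 * nu * (1 / nu + D / k1) * expR (- g * t) =
  expR (- g * t) * (4 * nu) / nu + expR (- g * t) * (4 * nu) * D / k1.
  by field; rewrite !lt0r_neq0.
have e4 : 0 < expR (- g * t) * (4 * nu) by rewrite mulr_gt0 ?expR_gt0// mulr_gt0.
have x0 : 0 < expR (- g * t) * (4 * nu) / nu by rewrite divr_gt0.
have y0 : 0 < expR (- g * t) * (4 * nu) * D / k1 by rewrite divr_gt0// mulr_gt0.
rewrite E1 in h1; split.
  by rewrite -[leRHS]mul1r -ler_pdivrMr//; lra.
by rewrite -[leRHS]mul1r -ler_pdivrMr//; lra.
Qed.

Let tstar := t2 + tau + 1.

(** Oscillation and Lipschitz constant shrink together, so the estimate can be iterated. In the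
    order of time, the first [m] steps, lasting about [tau], bring both copies to plane 1; the other
    [n - m], lasting at least [t2], are run coupled. *)
Lemma iter_step_contract n h s f : 0 < h <= 1 -> 0 <= s -> t2 + tau + 1 <= n%:R * h ->
  osc_le s f -> lip (4 * nu * s) f ->
  osc_le (theta * s) (iter n (step h) f) /\ lip (4 * nu * (theta * s)) (iter n (step h) f).
Proof.
move=> /andP[h0 h1] s0 nh fs fl.
have [nu0 D0 g0] := (And3 (cf_nu F) (cf_D F) (cf_g F)).
have [th1 th2] := theta_ge.
have hw := ltW h0; have tau0 := cf_tau F.
have K0 : 0 <= 4 * nu * s by rewrite !mulr_ge0// ltW.
have Ks t : expR (- g * t) * (4 * nu * s) = expR (- g * t) * (4 * nu) * s by ring.
split; last first.
  have tn : t2 <= n%:R * h by apply: (le_trans _ nh); lra.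
  have [E _] := t2_le tn.
  move=> i w v Bw Bv; have H := iter_step_lip n hw s0 K0 fs fl.
  apply: (le_trans (H i w v Bw Bv)).
  rewrite ler_wpM2r// Ks.
  have : expR (- g * (n%:R * h)) * (4 * nu) * s <= nu * s by rewrite ler_wpM2r.
  have : 0 <= (theta - 1 / 2) * (4 * nu * s) by rewrite mulr_ge0// subr_ge0.
  lra.
pose m := (Num.truncn (tau / h)).+1.
have /andP[m1 m2] := truncn_itv (divr_ge0 tau0 hw).
have mh1 : tau <= m%:R * h by rewrite -ler_pdivrMr// ltW.
have mh2 : m%:R * h <= tau + 1.
  rewrite /m -natr1 mulrDl mul1r lerD//.
  by rewrite -ler_pdivlMr.
have mn : (m <= n)%N.
  by rewrite -(ler_nat R) -(ler_pM2r h0); apply: (le_trans mh2); have := t20; lra.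
have nE : n = (m + (n - m))%N by rewrite subnKC.
have n2 : t2 <= (n - m)%:R * h.
  by rewrite natrB// mulrBl; lra.
have [_ E] := t2_le n2.
have cpl := iter_step_coupled (n - m) hw s0 K0 fs (lip_coupled s0 fl).
have osc := iter_step_osc (n - m) hw fs.
rewrite nE iterD.
move=> i w j v Bw Bv.
suff H : osc_le ((1 - eps * k1) * s) (iter m (step h) (iter (n - m) (step h) f)).
  by apply: (le_trans (H i w j v Bw Bv)); rewrite ler_wpM2r.
apply: iter_step_osc_contract => //.
- by rewrite mh1.
- by case/andP: k1_01 => /ltW -> ->.
- move=> w' v' Bw' Bv'; apply: le_trans (ler_norm _) _.
  apply: le_trans (cpl true _ _ Bw' Bv') _; rewrite Ks.
  have Dd := cf_diam F Bw' Bv'.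
  have n1D : norm1 (w' - v') <= D.
    by apply: le_trans Dd; have /andP[] := cf_norm F (w' - v').
  have e1 : 2 * k1 <= expR (- nu * norm1 (w' - v')).
    rewrite /k1 mulrC divfK// mulNr ler_expR lerN2 ler_wpM2l// ltW//.
  have e2 : expR (- g * ((n - m)%:R * h)) * (4 * nu) * s * N (w' - v') <= k1 * s.
    rewrite mulrAC ler_wpM2r//; apply: le_trans E; rewrite ler_wpM2l// mulr_ge0 ?expR_ge0//.
    by rewrite mulr_ge0// ltW.
  have e3 : 0 <= s * (expR (- nu * norm1 (w' - v')) - 2 * k1) by rewrite mulr_ge0 ?subr_ge0.
  lra.
Qed.

Lemma iter_step_ergodic_lip k n h s f : 0 < h <= 1 -> 0 <= s ->
  k%:R * (tstar + 1) <= n%:R * h -> osc_le s f -> lip (4 * nu * s) f ->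
  osc_le (theta ^+ k * s) (iter n (step h) f).
Proof.
move=> h01; have /andP[h0 h1] := h01; have hw := ltW h0; move=> s0 nh fs fl.
have [nu0 D0 g0] := (And3 (cf_nu F) (cf_D F) (cf_g F)).
have [th1 th2] := theta_ge.
have ts0 : 0 <= tstar.
  by have := t20; have := cf_tau F; rewrite /tstar; lra.
pose m := (Num.truncn (tstar / h)).+1.
have /andP[m1 m2] := truncn_itv (divr_ge0 ts0 hw).
have mh1 : tstar <= m%:R * h by rewrite -ler_pdivrMr// ltW.
have mh2 : m%:R * h <= tstar + 1.
  by rewrite /m -natr1 mulrDl mul1r lerD// -ler_pdivlMr.
have kmn : (k * m <= n)%N.
  rewrite -(ler_nat R) -(ler_pM2r h0); apply: le_trans nh.
  by rewrite natrM -mulrA ler_wpM2l.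
have -> : n = ((n - k * m) + k * m)%N by rewrite subnK.
rewrite iterD; apply: iter_step_osc => //.
suff : osc_le (theta ^+ k * s) (iter (k * m) (step h) f) /\
   lip (4 * nu * (theta ^+ k * s)) (iter (k * m) (step h) f) by case.
elim: k {nh kmn} => [|k [IH1 IH2]]; first by rewrite expr0 mul1r.
rewrite mulSn iterD exprS -mulrA; apply: iter_step_contract => //.
by rewrite mulr_ge0// exprn_ge0//; lra.
Qed.

Lemma iter_step_ergodic : exists t0 th : R, [/\ 0 < t0, 0 < th < 1 &
  forall k n h s K f, 0 < h <= 1 -> 0 <= s -> 0 <= K -> k%:R * t0 <= n%:R * h ->
    osc_le s f -> lip K f ->
    osc_le (th ^+ k * (s + K / (4 * nu))) (iter n (step h) f)].
Proof.
have [nu0 D0 g0] := (And3 (cf_nu F) (cf_D F) (cf_g F)).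
exists (tstar + 1), theta; split.
- by have := t20; have := cf_tau F; rewrite /tstar; lra.
- by rewrite theta_lt1 andbT; have [+ _] := theta_ge; apply: lt_le_trans.
move=> k n h s K f h01 s0 K0 nh fs fl.
(* Enlarging [s] by [K / (4 * nu)] makes any Lipschitz constant [K] admissible. *)
have s1 : s <= s + K / (4 * nu) by rewrite lerDl divr_ge0// mulr_ge0// ltW.
apply: iter_step_ergodic_lip => //.
- exact: le_trans s1.
- by move=> i w j v Bw Bv; apply: le_trans s1; exact: fs.
- move=> i w v Bw Bv; apply: le_trans (fl i w v Bw Bv) _; rewrite ler_wpM2r//.
  rewrite mulrDr [X in _ + X]mulrC divfK ?lt0r_neq0 ?mulr_gt0//.
  by rewrite lerDr !mulr_ge0// ltW.
Qed.

End Chain.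

(** * Expectations of bounded functions *)

Section BoundedMeasurable.
Context (R : realType) (d : measure_display) (Om : measurableType d).
Implicit Types (f g : Om -> R) (A : set Om).

Definition bmeas f := measurable_fun setT f /\ exists M : R, forall w, `|f w| <= M.

Lemma bmeas_cst (a : R) : bmeas (fun=> a).
Proof. by split; [exact: measurable_cst|exists `|a|]. Qed.

Lemma bmeasD f g : bmeas f -> bmeas g -> bmeas (fun w => f w + g w).
Proof.
move=> [mf [M fM]] [mg [M' gM]]; split; first exact: measurable_funD.
by exists (M + M') => w; rewrite (le_trans (ler_normD _ _))// lerD.
Qed.

Lemma bmeasM f g : bmeas f -> bmeas g -> bmeas (fun w => f w * g w).
Proof.
move=> [mf [M fM]] [mg [M' gM]]; split; first exact: measurable_funM.
by exists (M * M') => w; rewrite normrM ler_pM.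
Qed.

Lemma bmeasZ (a : R) f : bmeas f -> bmeas (fun w => a * f w).
Proof. exact/bmeasM/bmeas_cst. Qed.

Lemma bmeasN f : bmeas f -> bmeas (fun w => - f w).
Proof.
move=> [mf [M fM]]; split; first exact: measurable_funN.
by exists M => w; rewrite normrN.
Qed.

Lemma bmeasB f g : bmeas f -> bmeas g -> bmeas (fun w => f w - g w).
Proof. by move=> bf bg; apply: bmeasD => //; exact: bmeasN. Qed.

Lemma bmeas_norm f : bmeas f -> bmeas (fun w => `|f w|).
Proof.
move=> [mf [M fM]]; split; first exact: measurableT_comp.
by exists M => w; rewrite normr_id.
Qed.

Lemma bmeas_indic A : measurable A -> bmeas (\1_A : Om -> R).
Proof.
move=> mA; split; first exact: measurable_indic.
by exists 1 => w; rewrite indicE; case: (w \in A); rewrite ?normr1 ?normr0.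
Qed.

Lemma bmeas_sum (I : Type) (r : seq I) (F : I -> Om -> R) : (forall i, bmeas (F i)) ->
  bmeas (fun w => \sum_(i <- r) F i w).
Proof.
move=> bF; elim: r => [|i r IH].
  by under eq_fun do rewrite big_nil; exact: bmeas_cst.
by under eq_fun do rewrite big_cons; exact: bmeasD.
Qed.

Context (Q : probability Om R).

Definition Ex f : R := (\int[Q]_w f w)%R.

Lemma bmeas_integrable f : bmeas f -> Q.-integrable setT (EFin \o f).
Proof.
move=> [mf [M fM]]; apply: measurable_bounded_integrable => //.
  exact: (le_lt_trans (probability_le1 Q measurableT) (ltry 1)).
by exists M; split; [exact: num_real|move=> x Mx w _; exact: le_trans (fM w) (ltW Mx)].
Qed.

Lemma Ex_EFin f : bmeas f -> (\int[Q]_w (f w)%:E)%E = (Ex f)%:E.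
Proof.
by move=> bf; rewrite /Ex fineK//; apply: integrable_fin_num => //; exact: bmeas_integrable.
Qed.

Lemma ExD f g : bmeas f -> bmeas g -> Ex (fun w => f w + g w) = Ex f + Ex g.
Proof. by move=> bf bg; apply: RintegralD => //; exact: bmeas_integrable. Qed.

Lemma ExB f g : bmeas f -> bmeas g -> Ex (fun w => f w - g w) = Ex f - Ex g.
Proof. by move=> bf bg; apply: RintegralB => //; exact: bmeas_integrable. Qed.

Lemma ExZ (a : R) f : bmeas f -> Ex (fun w => a * f w) = a * Ex f.
Proof. by move=> bf; apply: RintegralZl => //; exact: bmeas_integrable. Qed.

Lemma Ex_cst (a : R) : Ex (fun=> a) = a.
Proof.
rewrite /Ex Rintegral_cst// [X in fine X](_ : _ = 1%E) ?mulr1//.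
exact: probability_setT.
Qed.

Lemma Ex_indic A : measurable A -> Ex \1_A = fine (Q A).
Proof. by move=> mA; rewrite /Ex /Rintegral integral_indic// setIT. Qed.

Lemma Ex_sum (I : Type) (r : seq I) (F : I -> Om -> R) : (forall i, bmeas (F i)) ->
  Ex (fun w => \sum_(i <- r) F i w) = \sum_(i <- r) Ex (F i).
Proof.
move=> bF; elim: r => [|i r IH].
  by under eq_fun do rewrite big_nil; rewrite Ex_cst big_nil.
under eq_fun do rewrite big_cons.
by rewrite ExD ?IH ?big_cons//; exact: bmeas_sum.
Qed.

Lemma Ex_le f g : bmeas f -> bmeas g -> (forall w, f w <= g w) -> Ex f <= Ex g.
Proof. by move=> bf bg fg; apply: le_Rintegral => //; exact: bmeas_integrable. Qed.

Lemma Ex_abs f : bmeas f -> `|Ex f| <= Ex (fun w => `|f w|).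
Proof. by move=> bf; apply: le_normr_Rintegral => //; exact: bmeas_integrable. Qed.

Context (G : set Om).
Hypotheses (mG : measurable G) (G1 : Q G = 1%E).

Lemma Ex_ae f : bmeas f -> Ex f = Ex (fun w => f w * \1_G w).
Proof.
move=> bf; have [mf [M fM]] := bf.
have bG := bmeas_indic mG; have bC := bmeas_indic (measurableC mG).
have -> : f = fun w => f w * \1_G w + f w * \1_(~` G) w.
  apply/funext => w; rewrite -mulrDr !indicE in_setC.
  by case: (w \in G); rewrite ?addr0 ?add0r mulr1.
rewrite ExD; try exact: bmeasM.
set h := (X in _ + Ex X).
have h0 : Ex h = 0.
  apply/eqP; rewrite -normr_le0; apply: (le_trans (Ex_abs _)); first exact: bmeasM.
  apply: (@le_trans _ _ (Ex (fun w => M * \1_(~` G) w))).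
    apply: Ex_le; [exact/bmeas_norm/bmeasM|exact: bmeasZ|move=> w].
    rewrite normrM ler_pM// indicE; by case: (w \in _); rewrite ?normr1 ?normr0.
  rewrite ExZ// Ex_indic; last exact: measurableC.
  by rewrite probability_setC// G1 subee//= mulr0.
rewrite h0 addr0; congr Ex; apply/funext => w; rewrite mulrDl -!mulrA !indicE in_setC.
by case: (w \in G); rewrite !(mulr0, mulr1, addr0, add0r).
Qed.

Lemma Ex_le_ae f g : bmeas f -> bmeas g -> (forall w, G w -> f w <= g w) -> Ex f <= Ex g.
Proof.
move=> bf bg fg; rewrite (Ex_ae bf) (Ex_ae bg).
apply: Ex_le; try by apply: bmeasM => //; exact: bmeas_indic.
move=> w; rewrite indicE; case: (boolP (w \in G)) => [|_]; last by rewrite !mulr0.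
by rewrite inE => /fg; rewrite !mulr1.
Qed.

Lemma Ex_eq_ae f g : bmeas f -> bmeas g -> (forall w, G w -> f w = g w) -> Ex f = Ex g.
Proof.
by move=> bf bg fg; apply/eqP; rewrite eq_le !Ex_le_ae// => w /fg ->.
Qed.

Lemma Ex_abs_le_ae f (M : R) : bmeas f -> (forall w, G w -> `|f w| <= M) -> `|Ex f| <= M.
Proof.
move=> bf fM; apply: (le_trans (Ex_abs bf)); rewrite -[leRHS](Ex_cst M).
by apply: Ex_le_ae => //; [exact: bmeas_norm|exact: bmeas_cst].
Qed.

End BoundedMeasurable.

Lemma bmeas_comp (R : realType) (d d' : measure_display) (Om : measurableType d)
    (S : measurableType d') (V : Om -> S) (f : S -> R) :
  measurable_fun setT V -> bmeas f -> bmeas (fun w => f (V w)).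
Proof.
by move=> mV [mf [M fM]]; split; [exact: measurableT_comp|exists M => w; exact: fM].
Qed.

(** * Comparison of integrals on an almost sure event *)

Section AlmostSure.
Context (R : realType) (d : measure_display) (Om : measurableType d) (Q : probability Om R).
Context (G : set Om).
Hypotheses (mG : measurable G) (G1 : Q G = 1%E).
Import HBNNSimple.
Local Open Scope ereal_scope.

(** No measurability is asked: the integrand of [jumps_at_rate] evaluates [X] at a random time,
    while [X] is only known to be measurable at fixed times. The comparison is therefore made on the
    simple functions below [f], cut off outside [G]. *)
Lemma le_integral_on (f g : Om -> \bar R) : (forall w, 0 <= f w) -> (forall w, 0 <= g w) ->
  (forall w, G w -> f w <= g w) -> \int[Q]_w f w <= \int[Q]_w g w.
Proof.
move=> f0 g0 fg; rewrite !ge0_integralTE//.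
apply/ge_ereal_sup => _ [h /= hf <-]; apply: ereal_sup_ubound.
exists (proj_nnsfun h mG).
  move=> w /=; rewrite mindicE; case: (boolP (w \in G)) => [|_]; last by rewrite mulr0.
  by rewrite inE => Gw; rewrite mulr1; exact: le_trans (hf w) (fg w Gw).
rewrite -mrestrict -integral_nnsfun//.
have := integral_nnsfun Q measurableT h; rewrite patch_setT => <-.
have h0 w : [set: Om] w -> 0 <= (h w)%:E by rewrite lee_fin.
have mh : measurable_fun [set: Om] (EFin \o h) by exact/measurable_EFinP.
have N0 : Q (~` G) = 0 by rewrite probability_setC// G1 subee.
by rewrite (ge0_negligible_integral (measurableC mG) measurableT mh h0 N0) setTD setCK.
Qed.

Lemma eq_integral_on (D : set Om) (f g : Om -> \bar R) :
  (forall w, 0 <= f w) -> (forall w, 0 <= g w) ->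
  (forall w, G w -> D w -> f w = g w) -> \int[Q]_(w in D) f w = \int[Q]_(w in D) g w.
Proof.
move=> f0 g0 fg; rewrite integral_mkcond [RHS]integral_mkcond.
apply/eqP; rewrite eq_le; apply/andP; split; apply: le_integral_on.
all: by move=> w; rewrite ?patchE; case: ifPn => //; rewrite inE => Dw /fg ->.
Qed.

End AlmostSure.

(** * Estimates tested on the events of a sub-sigma-algebra *)

Section SubSigmaAlgebra.
Context (R : realType) (d : measure_display) (Om : measurableType d) (Q : probability Om R).
Context (gens : set (set Om)) (sub : forall A, <<s gens >> A -> measurable A).
Local Notation Hs := (g_sigma_algebraType gens).
Local Notation E := (Ex Q).
Implicit Types (A S : set Om) (f h z : Om -> R).

Let subm A : measurable (A : set Hs) -> measurable A. Proof. exact: sub. Qed.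

Lemma sub_measurable_fun d' (U : measurableType d') (f : Om -> U) :
  measurable_fun (setT : set Hs) f -> measurable_fun (setT : set Om) f.
Proof.
by move=> mf _ Y mY; rewrite setTI; apply: sub; have := mf measurableT Y mY; rewrite setTI.
Qed.

(* An estimate proportional to the measure of [A] may be checked on the sets
   where [f] varies by at most [e]. *)
Lemma Ex_cells S f z (lo hi e k : R) : measurable_fun (setT : set Hs) f -> bmeas z -> 0 < e ->
  (forall A b, measurable (A : set Hs) -> A `<=` S -> lo <= b ->
    (forall w, A w -> b <= f w < b + e) -> `|E (fun w => \1_A w * z w)| <= k * E \1_A) ->
  forall A, measurable (A : set Hs) -> A `<=` S -> (forall w, A w -> lo <= f w <= hi) ->
    `|E (fun w => \1_A w * z w)| <= k * E \1_A.
Proof.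
move=> mf bz e0 cell.
suff key j A : measurable (A : set Hs) -> A `<=` S ->
    (forall w, A w -> lo <= f w < lo + j%:R * e) -> `|E (fun w => \1_A w * z w)| <= k * E \1_A.
  move=> A mA AS Af; apply: (key (Num.bound `|(hi - lo) / e|)) => // w Aw.
  have /andP[-> fhi] := Af w Aw; apply: (le_lt_trans fhi).
  rewrite -ltrBlDl -ltr_pdivrMr//; apply: (le_lt_trans _ (archi_boundP (normr_ge0 _))).
  exact: ler_norm.
elim: j A => [|j IH] A mA AS Af.
  have -> : A = set0.
    by apply/seteqP; split => // w /Af; rewrite mul0r addr0 => /andP[]; lra.
  have -> : (fun w => \1_set0 w * z w) = fun=> 0.
    by apply/funext => w; rewrite indicE in_set0 mul0r.
  by rewrite Ex_cst normr0 Ex_indic// measure0/= mulr0.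
set b := lo + j%:R * e.
have mC : measurable ([set w | f w < b] : set Hs).
  rewrite [X in measurable X](_ : _ = setT `&` f @^-1` `]-oo, b[%classic).
    by apply: mf => //; exact: measurable_itv.
  by rewrite setTI; apply/seteqP; split => w /=; rewrite in_itv.
have mA1 := measurableI _ _ mA mC; have mA2 := measurableD mA mC.
have h1 : `|E (fun w => \1_(A `&` [set w | f w < b]) w * z w)| <= k * E \1_(A `&` [set w | f w < b]).
  by apply: IH => //; [by move=> w [/AS]|move=> w [/Af /andP[-> _]]].
have h2 : `|E (fun w => \1_(A `\` [set w | f w < b]) w * z w)| <= k * E \1_(A `\` [set w | f w < b]).
  apply: (cell _ b) => //; first by move=> w [/AS].
    by rewrite lerDl mulr_ge0// ltW.
  move=> w [/Af /andP[_ fw] /negP]; rewrite -leNgt => -> /=.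
  by apply: lt_le_trans fw _; rewrite /b -natr1 mulrDl mul1r addrA.
have iE w : \1_A w = \1_(A `&` [set w | f w < b]) w + \1_(A `\` [set w | f w < b]) w :> R.
  rewrite !indicE in_setI in_setD; case: (w \in A) => /=; last by rewrite addr0.
  by case: (w \in _); rewrite ?addr0 ?add0r.
have i1 := bmeas_indic R (subm mA1); have i2 := bmeas_indic R (subm mA2).
under eq_fun do rewrite iE mulrDl.
have -> : \1_A = (fun w => \1_(A `&` [set w | f w < b]) w + \1_(A `\` [set w | f w < b]) w) :> (Om -> R).
  by apply/funext => w; rewrite -iE.
rewrite !ExD//; try exact: bmeasM.
by rewrite mulrDr; apply: le_trans (ler_normD _ _) _; exact: lerD.
Qed.

(** On a slice where [f] is within [e] of a constant [b], the part [b * z] integrates to 0 and the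
    rest costs at most [e * M'] times the mass of the slice. This takes the place of conditional
    expectations. *)
Lemma Ex_test z f : bmeas z -> (forall A, measurable (A : set Hs) -> E (fun w => \1_A w * z w) = 0) ->
  measurable_fun (setT : set Hs) f -> (exists M : R, forall w, `|f w| <= M) ->
  E (fun w => f w * z w) = 0.
Proof.
move=> bz z0 mf [M fM]; have [mz [M' zM]] := bz.
have bf : bmeas f by split; [exact: sub_measurable_fun|exists M].
have bfz := bmeasM bf bz.
have M'0 : 0 <= M' by apply: le_trans (zM point).
suff key (e : R) : 0 < e -> `|E (fun w => f w * z w)| <= e * M'.
  apply/eqP; rewrite -normr_le0; apply/ler_addgt0Pr => e e0; rewrite add0r.
  have M1 : 0 < M' + 1 by lra.
  apply: le_trans (key (e / (M' + 1)) (divr_gt0 e0 M1)) _.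
  by rewrite -mulrA ger_pMr// ler_pdivrMl//; lra.
move=> e0.
have := @Ex_cells setT f (fun w => f w * z w) (- M) M e (e * M') mf bfz e0.
move=> /(_ _ setT measurableT).
rewrite Ex_indic// probability_setT mulr1.
have -> : (fun w => \1_[set: Om] w * (f w * z w)) = fun w => f w * z w.
  by apply/funext => w; rewrite indicT mul1r.
apply => //; last by move=> w _; rewrite -ler_norml.
move=> A b mA _ _ Ab; have bA := bmeas_indic R (subm mA).
have bh : bmeas (fun w => \1_A w * ((f w - b) * z w)).
  by apply: bmeasM => //; apply: bmeasM => //; apply: bmeasB => //; exact: bmeas_cst.
have -> : E (fun w => \1_A w * (f w * z w)) = E (fun w => \1_A w * ((f w - b) * z w)).
  have -> : (fun w => \1_A w * (f w * z w)) =
      fun w => \1_A w * ((f w - b) * z w) + b * (\1_A w * z w).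
    by apply/funext => w; ring.
  rewrite ExD ?ExZ ?z0 ?mulr0 ?addr0//; first exact: bmeasM.
  by apply: bmeasZ; exact: bmeasM.
apply: (le_trans (Ex_abs _ bh)); rewrite -ExZ//.
apply: Ex_le; [exact: bmeas_norm|exact: bmeasZ|].
move=> w; rewrite normrM indicE; case: (boolP (w \in A)) => [|_]; last by rewrite normr0 mul0r mulr0.
rewrite inE => /Ab /andP[h1 h2]; rewrite normr1 mul1r mulr1 normrM ler_pM//.
by rewrite ger0_norm; lra.
Qed.

End SubSigmaAlgebra.

(** * Comparison of the process with the chain *)

Lemma max0r (R : realType) (x : R) : 0 <= x -> Num.max 0 x = x.
Proof. exact: max_r. Qed.

Lemma expRN_sub (R : realType) (a b : R) : 0 <= a -> a <= b -> expR (- a) - expR (- b) <= b - a.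
Proof.
move=> a0 ab; have -> : expR (- b) = expR (- a) * expR (- (b - a)).
  by rewrite -expRD; congr expR; ring.
have h1 := expR_ge1Dx (- (b - a)); have h2 := expRN_le1 a0; have h3 := expR_ge0 (- a).
have : 0 <= (1 - expR (- a)) * (b - a) by rewrite mulr_ge0 ?subr_ge0.
have : expR (- a) * (1 + - (b - a)) <= expR (- a) * expR (- (b - a)) by rewrite ler_wpM2l.
lra.
Qed.

Lemma expRN_bracket (R : realType) (a t b k : R) : 0 <= a -> a <= t <= b -> b <= a + k ->
  expR (- a) <= expR (- t) + k /\ expR (- t) <= expR (- b) + k.
Proof.
move=> a0 /andP[at_ tb] bk.
have h1 := expRN_sub a0 at_; have h2 := expRN_sub (le_trans a0 at_) tb.
by split; lra.
Qed.

Lemma norm_sub_bracket (R : realType) (p q a b k : R) :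
  p <= a -> b <= p -> a <= q + k -> q <= b + k -> `|p - q| <= k.
Proof. by move=> *; rewrite ler_norml; apply/andP; split; lra. Qed.

Lemma add_max_le (R : realType) (t u b e : R) : t < b + e -> t <= u ->
  t + Num.max 0 (u - b - e) <= u.
Proof. by move=> h1 h2; have [_|_] := leP 0 (u - b - e); lra. Qed.

Lemma le_add_max (R : realType) (t u b : R) : b <= t -> u <= t + Num.max 0 (u - b).
Proof. by move=> h1; have [h|h] := leP 0 (u - b); lra. Qed.

Lemma indic_in (R : realType) (U : Type) (A : set U) w : A w -> \1_A w = 1 :> R.
Proof. by move=> Aw; rewrite indicE mem_set. Qed.

Lemma indic_out (R : realType) (U : Type) (A : set U) w : ~ A w -> \1_A w = 0 :> R.
Proof. by move=> Aw; rewrite indicE memNset. Qed.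

Section Paths.
Context (R : realType) (phi : bool -> R * R -> R -> R * R) (lam : state R -> R -> R).
Context (N : R * R -> R) (B : set (R * R)) (nu gam D C L tau c : R).
Hypothesis F : compact_flow phi lam N B nu gam D C L tau c.
Hypothesis cumE : forall z t, 0 <= t -> cumulative_rate nu phi z t = lam z t.
Hypothesis phi_meas : forall i,
  measurable_fun setT (fun a : (R * R) * R => phi i a.1 (Num.max 0 a.2)).
Hypothesis lam_meas : forall i,
  measurable_fun setT (fun a : (R * R) * R => lam (i, a.1) (Num.max 0 a.2)).

(** Times are cut off at 0 because the affine form of the flow is established forward in time
    only. *)
Lemma measurable_fun_phi d (U : measurableType d) (z : U -> state R) (s : U -> R) :
  measurable_fun setT z -> measurable_fun setT s ->
  measurable_fun setT (fun x => phi (z x).1 (z x).2 (Num.max 0 (s x))).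
Proof.
move=> mz ms.
have mz1 : measurable_fun setT (fun x => (z x).1) := measurableT_comp measurable_fst mz.
have mz2 : measurable_fun setT (fun x => (z x).2) := measurableT_comp measurable_snd mz.
have mzs : measurable_fun setT (fun x => ((z x).2, s x)) by exact: measurable_fun_pair.
rewrite (_ : (fun x => _) = fun x => if (z x).1 then phi true (z x).2 (Num.max 0 (s x))
   else phi false (z x).2 (Num.max 0 (s x))); last first.
  by apply/funext => x; case: (z x).1.
by apply: measurable_fun_ifT => //;
  [exact: (measurableT_comp (phi_meas true) mzs)|exact: (measurableT_comp (phi_meas false) mzs)].
Qed.

Lemma measurable_fun_lam d (U : measurableType d) (z : U -> state R) (s : U -> R) :
  measurable_fun setT z -> measurable_fun setT s ->
  measurable_fun setT (fun x => lam (z x) (Num.max 0 (s x))).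
Proof.
move=> mz ms.
have mz1 : measurable_fun setT (fun x => (z x).1) := measurableT_comp measurable_fst mz.
have mz2 : measurable_fun setT (fun x => (z x).2) := measurableT_comp measurable_snd mz.
have mzs : measurable_fun setT (fun x => ((z x).2, s x)) by exact: measurable_fun_pair.
rewrite (_ : (fun x => _) = fun x => if (z x).1 then lam (true, (z x).2) (Num.max 0 (s x))
   else lam (false, (z x).2) (Num.max 0 (s x))); last first.
  by apply/funext => x; case: (z x) => -[].
by apply: measurable_fun_ifT => //;
  [exact: (measurableT_comp (lam_meas true) mzs)|exact: (measurableT_comp (lam_meas false) mzs)].
Qed.

Lemma measurable_step h f : 0 <= h -> measurable_fun setT f ->
  measurable_fun setT (step phi lam h f).
Proof.
move=> h0 mf.
have mh : measurable_fun setT (cst h : state R -> R) by exact: measurable_cst.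
have mid := @measurable_id _ (state R) setT.
have mphi : measurable_fun setT (fun z : state R => phi z.1 z.2 h).
  by have := measurable_fun_phi mid mh; under eq_fun do rewrite /= max0r//.
have mlam : measurable_fun setT (fun z : state R => lam z h).
  by have := measurable_fun_lam mid mh; under eq_fun do rewrite /= max0r//.
have m1 : measurable_fun setT (fun z : state R => z.1) by exact: measurable_fst.
have mstay : measurable_fun setT (fun z : state R => stay lam h z).
  apply: measurable_minr; first exact: measurable_cst.
  apply: measurableT_comp; first exact: measurable_expR.
  exact: measurable_funN.
apply: measurable_funD; apply: measurable_funM => //.
- by apply: (measurableT_comp mf); exact: measurable_fun_pair.
- by apply: measurable_funB => //; exact: measurable_cst.
- apply: (measurableT_comp mf); apply: measurable_fun_pair => //.
  exact: measurable_neg.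
Qed.

Lemma step_bounded h f (M : R) : (forall z, `|f z| <= M) -> forall z, `|step phi lam h f z| <= M.
Proof.
move=> fM z; rewrite /step; have s0 := stay_ge0 lam h z; have s1 := stay_le1 lam h z.
have s2 : 0 <= 1 - stay lam h z by rewrite subr_ge0.
apply: (le_trans (ler_normD _ _)); rewrite !normrM (ger0_norm s0) (ger0_norm s2).
have h1 : stay lam h z * `|f (z.1, phi z.1 z.2 h)| <= stay lam h z * M by rewrite ler_wpM2l.
have h2 : (1 - stay lam h z) * `|f (~~ z.1, phi z.1 z.2 h)| <= (1 - stay lam h z) * M.
  by rewrite ler_wpM2l// subr_ge0.
lra.
Qed.

Lemma bmeas_step h f : 0 <= h -> bmeas f -> bmeas (step phi lam h f).
Proof.
move=> h0 [mf [M fM]]; split; first exact: measurable_step.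
by exists M; exact: step_bounded.
Qed.

Lemma bmeas_iter_step n h f : 0 <= h -> bmeas f -> bmeas (iter n (step phi lam h) f).
Proof. by move=> h0 bf; elim: n => //= n; exact: bmeas_step. Qed.

Context (d : measure_display) (Om : measurableType d).
Context (X : R -> Om -> state R) (T : nat -> Om -> \bar R).
Context (Q : probability Om R) (z0 : state R).
Hypothesis Bz0 : B z0.2.
Hypothesis X_meas : forall t, 0 <= t -> measurable_fun setT (X t).
Hypothesis T_meas : forall n, measurable_fun setT (T n).
Hypothesis paths : pdmp_paths phi X T.
Hypothesis X_start : Q [set w | X 0 w = z0] = 1%E.
Hypothesis rate : jumps_at_rate nu phi X T Q.
Local Notation E := (Ex Q).

(** The generators of [jump_history n], named so that the sigma-algebra can be used as a measurable
    space. *)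
Let gens n := [set H | exists (k : nat) (A : set (\bar R)),
  [/\ (k <= n)%N, measurable A & H = T k @^-1` A]].
Local Notation Hist n := (g_sigma_algebraType (gens n)).

Let hist_sub n A : <<s gens n >> A -> measurable A.
Proof.
apply: smallest_sub; first exact: sigma_algebra_measurable.
by move=> _ [k [A' [_ mA ->]]]; rewrite -[X in measurable X]setTI; exact: T_meas.
Qed.

Let hist_mono n m : (n <= m)%N -> <<s gens n >> `<=` <<s gens m >>.
Proof.
move=> nm; apply: sub_sigma_algebra2 => H [k [A [kn mA ->]]].
by exists k, A; split => //; exact: leq_trans nm.
Qed.

Let hist_fun_mono d' (U : measurableType d') n m (f : Om -> U) : (n <= m)%N ->
  measurable_fun (setT : set (Hist n)) f -> measurable_fun (setT : set (Hist m)) f.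
Proof. by move=> nm mf mT Y mY; apply: (hist_mono nm); exact: mf. Qed.

Let hist_T n k : (k <= n)%N -> measurable_fun (setT : set (Hist n)) (T k).
Proof.
by move=> kn _ Y mY; rewrite setTI; apply: sub_sigma_algebra; exists k, Y.
Qed.

Let T0 w : T 0 w = 0%E. Proof. by have [] := paths. Qed.

Let T_ge0 n w : (0 <= T n w)%E.
Proof.
have [_ T1 T2 _ _] := paths; elim: n => [|n IH]; first by rewrite T0.
have [e|/eqP e] := eqVneq (T n w) +oo%E; first by rewrite T2.
by apply: (le_trans IH); apply/ltW/T1; rewrite ltey; apply/eqP.
Qed.

Let T_mono n m w : (n <= m)%N -> (T n w <= T m w)%E.
Proof.
have [_ T1 T2 _ _] := paths; elim: m => [|m IH]; first by rewrite leqn0 => /eqP ->.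
rewrite leq_eqVlt => /predU1P[->//|/IH] h; apply: (le_trans h).
have [e|/eqP e] := eqVneq (T m w) +oo%E; first by rewrite T2// e.
by apply/ltW/T1; rewrite ltey; apply/eqP.
Qed.

Let T_fin n w : (T n w < +oo)%E -> T n w = (fine (T n w))%:E.
Proof. by move=> h; rewrite fineK// ge0_fin_numE. Qed.

(** When [T n.+1 w] is infinite, [fine] sends it to 0 and the cutoff gives the harmless value 0, so
    that [post_jump] stays in [B] for every [w]. *)
Let gap n w : R := Num.max 0 (fine (T n.+1 w) - fine (T n w)).

(* the state at the [n]-th jump, read off the jump times alone *)
Fixpoint post_jump n w : state R :=
  if n is m.+1 then let z := post_jump m w in (~~ z.1, phi z.1 z.2 (gap m w)) else z0.

Local Notation Z := post_jump.

Let Z_box n w : B (Z n w).2.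
Proof.
by elim: n => //= n IH; apply: (cf_flowB F) => //; rewrite le_max lexx.
Qed.

Let hist_Z n : measurable_fun (setT : set (Hist n)) (Z n).
Proof.
elim: n => [|n IH]; first exact: measurable_cst.
have mZ := hist_fun_mono (leqnSn n) IH.
apply: measurable_fun_pair.
  apply: measurable_neg; exact: (measurableT_comp measurable_fst mZ).
apply: measurable_fun_phi => //; apply: measurable_funB.
  by apply: measurableT_comp => //; exact: hist_T.
by apply: measurableT_comp => //; exact: hist_T.
Qed.

(** What the state at [u] would be if no jump followed the [n]-th. Unlike [X u], it depends on the
    first [n] jump times only. *)
Definition at_time n u w : state R :=
  ((Z n w).1, phi (Z n w).1 (Z n w).2 (Num.max 0 (u - fine (T n w)))).

Let at_time_box n u w : B (at_time n u w).2.
Proof. by apply: (cf_flowB F); [exact: Z_box|rewrite le_max lexx]. Qed.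

Let hist_fine n : measurable_fun (setT : set (Hist n)) (fun w => fine (T n w)).
Proof. by apply: measurableT_comp => //; exact: hist_T. Qed.

Let hist_at_time n u : measurable_fun (setT : set (Hist n)) (at_time n u).
Proof.
have mZ := @hist_Z n.
apply: measurable_fun_pair; first exact: (measurableT_comp measurable_fst mZ).
apply: measurable_fun_phi => //; apply: measurable_funB => //; exact: measurable_cst.
Qed.

Let good := [set w | X 0 w = z0].

Let good_meas : measurable good.
Proof.
rewrite (_ : good = X 0 @^-1` [set z0]); last by [].
rewrite -[X in measurable X]setTI; apply: X_meas => //.
rewrite (_ : [set z0] = [set z0.1] `*` ([set z0.2.1] `*` [set z0.2.2])).
  by apply: measurableX => //; apply: measurableX; exact: measurable_set1.
apply/seteqP; split => [z ->//|[i [x y]] /= [-> [-> ->]]].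
by rewrite -!surjective_pairing.
Qed.

Let X_jump n w a : good w -> T n w = a%:E -> X a w = Z n w.
Proof.
have [_ T1 T2 _ X2] := paths; move=> gw; elim: n a => [|n IH] b Tb.
  by move: Tb; rewrite T0 => -[<-].
have Tn : (T n w < +oo)%E.
  by rewrite ltey; apply/eqP => /T2; rewrite Tb.
have Ta := T_fin Tn; set a := fine (T n w) in Ta.
have ab : a < b by rewrite -lte_fin -Ta -Tb; exact: T1.
rewrite (X2 n w a b Ta Tb) (IH a Ta) /= /gap Tb /= -/a max0r//; lra.
Qed.

Let X_between n w u : good w -> (T n w <= u%:E)%E -> (u%:E < T n.+1 w)%E ->
  X u w = at_time n u w.
Proof.
have [_ _ _ X1 _] := paths; move=> gw Tu uT.
have Tn : (T n w < +oo)%E by apply: (le_lt_trans Tu); exact: ltry.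
have Ta := T_fin Tn; set a := fine (T n w) in Ta.
have au : a <= u by rewrite -lee_fin -Ta.
rewrite (X1 n w a u Ta au uT) (X_jump gw Ta) /at_time -/a max0r//; lra.
Qed.

(* survival probability of the plane chosen at the [n]-th jump up to time [u] *)
Let surv n u w : R := expR (- lam (Z n w) (Num.max 0 (u - fine (T n w)))).

Let lam_ge0 z t : B z.2 -> 0 <= t -> 0 <= lam z t.
Proof. by case: z => i w; exact: (cf_lam_ge0 F). Qed.

Let lamD z s t : 0 <= t -> lam z (s + t) = lam z s + lam (z.1, phi z.1 z.2 s) t.
Proof. by case: z => i w; exact: (cf_lamD F). Qed.

Let lam_le z t : B z.2 -> 0 <= t -> lam z t <= L * t.
Proof. by case: z => i w; exact: (cf_lam_le F). Qed.

Let hist_surv n u : measurable_fun (setT : set (Hist n)) (surv n u).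
Proof.
apply: measurableT_comp; first exact: measurable_expR.
apply: measurable_funN; apply: measurable_fun_lam; first exact: hist_Z.
by apply: measurable_funB => //; exact: measurable_cst.
Qed.

Let hist_meas n d' (U : measurableType d') (f : Om -> U) :
  measurable_fun (setT : set (Hist n)) f -> measurable_fun setT f.
Proof. exact: (sub_measurable_fun (@hist_sub n)). Qed.

Let surv_01 n u w : 0 < surv n u w <= 1.
Proof.
rewrite expR_gt0 /= expRN_le1//; apply: lam_ge0; first exact: Z_box.
by rewrite le_max lexx.
Qed.

Let bmeas_surv n u : bmeas (surv n u).
Proof.
split; first exact: (hist_meas (@hist_surv n u)).
by exists 1 => w; have /andP[/ltW h0 h1] := surv_01 n u w; rewrite ger0_norm.
Qed.

Let b_exp n t : 0 <= t -> bmeas (fun w => expR (- lam (Z n w) t)).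
Proof.
move=> t0; split; last first.
  by exists 1 => w; rewrite ger0_norm ?expR_ge0// expRN_le1// lam_ge0//; exact: Z_box.
apply: measurableT_comp; first exact: measurable_expR.
apply: measurable_funN.
have := measurable_fun_lam (hist_meas (@hist_Z n)) (@measurable_cst _ _ _ _ setT t).
by under eq_fun do rewrite max0r//.
Qed.

Let hist_le n k u : (k <= n)%N -> measurable ([set w | (T k w <= u%:E)%E] : set (Hist n)).
Proof.
move=> kn; rewrite [X in measurable X](_ : _ = setT `&` T k @^-1` `]-oo, u%:E]%classic).
  by apply: hist_T => //; exact: emeasurable_itv.
by rewrite setTI; apply/seteqP; split => w /=; rewrite in_itv.
Qed.

Let meas_lt k u : measurable [set w | (u%:E < T k w)%E].
Proof.
apply: (@hist_sub k); rewrite [X in <<s _ >> X](_ : _ = ~` [set w | (T k w <= u%:E)%E]).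
  exact: (measurableC (hist_le u (leqnn k))).
by apply/seteqP; split => w /=; rewrite ltNge => /negP.
Qed.

Let meas_gap k s : measurable [set w | (T k w + s%:E < T k.+1 w)%E].
Proof.
rewrite -[X in measurable X]setTI; apply: measurable_lte => //.
by apply: emeasurable_funD => //; exact: measurable_cst.
Qed.

(** The hypothesis [rate] with [post_jump] in place of [X] at the jump time, which agrees with it
    almost surely and makes the integrand measurable. *)
Lemma rate_Ex n s (A : set Om) : 0 <= s -> measurable (A : set (Hist n)) ->
  (forall w, A w -> (T n w < +oo)%E) ->
  E (fun w => \1_A w * \1_[set w | (T n w + s%:E < T n.+1 w)%E] w) =
  E (fun w => \1_A w * expR (- lam (Z n w) s)).
Proof.
move=> s0 mA Afin.
have AE : A `&` [set w | (T n w < +oo)%E] = A.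
  by apply/seteqP; split => w // => [[]//|Aw]; split => //; exact: Afin.
have mA' : measurable A by exact: (@hist_sub n).
have bA := bmeas_indic R mA'.
have bl := b_exp n s0.
have mg := meas_gap n s.
apply: EFin_inj; rewrite -!Ex_EFin; [|exact: bmeasM|apply: bmeasM => //; exact: bmeas_indic].
have := rate s0 mA; rewrite AE => h.
transitivity (Q (A `&` [set w | (T n w + s%:E < T n.+1 w)%E])).
  rewrite -[in RHS](setIT (A `&` _)) -integral_indic//; last exact: measurableI.
  by apply: eq_integral => w _; rewrite !indicE in_setI; case: (w \in A); case: (w \in _);
    rewrite ?(mulr0, mul0r, mulr1).
rewrite h.
transitivity (\int[Q]_(w in A) (expR (- lam (Z n w) s))%:E)%E.
  apply: (eq_integral_on good_meas X_start) => [w|w|w gw Aw].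
  - by rewrite lee_fin expR_ge0.
  - by rewrite lee_fin expR_ge0.
  - by rewrite cumE// (X_jump gw (T_fin (Afin _ Aw))).
rewrite integral_mkcond; apply: eq_integral => w _.
by rewrite patchE indicE; case: (w \in A); rewrite ?mul1r ?mul0r.
Qed.

Local Notation le_ n u := (\1_[set w | (T n w <= u%:E)%E] : Om -> R).
Local Notation lt_ n u := (\1_[set w | (u%:E < T n w)%E] : Om -> R).

Let meas_le k u : measurable [set w | (T k w <= u%:E)%E].
Proof. exact: (@hist_sub k _ (hist_le u (leqnn k))). Qed.

Let b_le n u : bmeas (le_ n u). Proof. exact: bmeas_indic. Qed.
Let b_lt n u : bmeas (lt_ n u). Proof. exact: bmeas_indic. Qed.

Let lam_mono z s t : B z.2 -> 0 <= s -> s <= t -> lam z s <= lam z t <= lam z s + L * (t - s).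
Proof.
move=> Bz s0 st; have ts : 0 <= t - s by rewrite subr_ge0.
have Bs := cf_flowB F z.1 Bz s0.
have -> : lam z t = lam z s + lam (z.1, phi z.1 z.2 s) (t - s) by rewrite -lamD// subrKC.
by rewrite lerDl lerD2l lam_le// lam_ge0.
Qed.

Let lam_bracket n u b e w : fine (T n w) <= u -> b <= fine (T n w) < b + e ->
  let s := Num.max 0 (u - b) in let s' := Num.max 0 (u - b - e) in
  lam (Z n w) s' <= lam (Z n w) (Num.max 0 (u - fine (T n w))) <= lam (Z n w) s
   /\ lam (Z n w) s <= lam (Z n w) s' + L * e.
Proof.
move=> Tu /andP[h1 h2] s s'; have Bz := Z_box n w; have L0 := cf_L F.
have s'0 : 0 <= s' by rewrite le_max lexx.
have t0 : 0 <= u - fine (T n w) by lra.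
rewrite (max0r t0).
have sE : s = u - b by apply: max0r; lra.
have h3 : s' <= u - fine (T n w) by rewrite /s' ge_max; apply/andP; split; lra.
have h4 : u - fine (T n w) <= s by lra.
have /andP[m1 m2] := lam_mono Bz s'0 h3.
have /andP[m3 m4] := lam_mono Bz t0 h4.
have /andP[m5 m6] := lam_mono Bz s'0 (le_trans h3 h4).
have h6 : u - b - e <= s' by rewrite /s' le_max lexx orbT.
have h7 : L * (s - s') <= L * e by rewrite ler_wpM2l//; lra.
by split; [apply/andP; split|lra].
Qed.

(** Survival up to [u] minus its prediction at the [n]-th jump: on [T n <= u] its conditional
    expectation given the first [n] jump times is 0. *)
Let eta n u w := lt_ n.+1 u w - surv n u w.

Let b_eta n u : bmeas (eta n u).
Proof. exact: bmeasB. Qed.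

(** Passes from a fixed waiting time to a fixed date, for which the waiting time [u - T n] is
    random. On a slice [b <= T n < b + e] it is bracketed by the constants [s'] and [s], at a
    relative error [L * e]; then [e] tends to 0. *)
Lemma survival_event n u (A : set Om) : 0 <= u -> measurable (A : set (Hist n)) ->
  (forall w, A w -> (T n w <= u%:E)%E) -> E (fun w => \1_A w * eta n u w) = 0.
Proof.
move=> u0 mA Au.
suff key (e : R) : 0 < e -> `|E (fun w => \1_A w * eta n u w)| <= L * e * E \1_A.
  have E0 : 0 <= E \1_A.
    by rewrite -(Ex_cst Q 0); apply: Ex_le => //; [exact: bmeas_cst|
      apply: bmeas_indic; exact: (@hist_sub n)].
  have L0 := cf_L F; have l1 : 0 < L * E \1_A + 1 by rewrite ltr_wpDl// mulr_ge0.
  apply/eqP; rewrite -normr_le0; apply/ler_addgt0Pr => e e0; rewrite add0r.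
  apply: (le_trans (key (e / (L * E \1_A + 1)) (divr_gt0 e0 l1))).
  have -> : L * (e / (L * E \1_A + 1)) * E \1_A = e * (L * E \1_A) / (L * E \1_A + 1).
    by field; rewrite lt0r_neq0.
  by rewrite ler_pdivrMr//; lra.
move=> e0.
have fin w : (T n w <= u%:E)%E -> T n w = (fine (T n w))%:E.
  by move=> h; apply: T_fin; apply: (le_lt_trans h); exact: ltry.
apply: (@Ex_cells _ _ _ Q _ (@hist_sub n) [set w | (T n w <= u%:E)%E] (fun w => fine (T n w))
  _ 0 u e) => //; last first.
  by move=> w Aw; rewrite fine_ge0//= -lee_fin -fin; exact: Au.
move=> {mA Au}A b mA Au b0 Ab.
have mA' : measurable A by exact: (@hist_sub n).
have bA := bmeas_indic R mA'.
pose s := Num.max 0 (u - b); pose s' := Num.max 0 (u - b - e).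
have s0 : 0 <= s by rewrite le_max lexx.
have s'0 : 0 <= s' by rewrite le_max lexx.
have Afin w : A w -> (T n w < +oo)%E by move=> /Au Tu; exact: (le_lt_trans Tu (ltry _)).
have R1 := rate_Ex s0 mA Afin; have R2 := rate_Ex s'0 mA Afin.
have bs := b_exp n s0; have bs' := b_exp n s'0.
have bg t : bmeas (\1_[set w | (T n w + t%:E < T n.+1 w)%E] : Om -> R).
  exact/bmeas_indic/meas_gap.
have bAs := bmeasM bA (bmeas_surv n u); have bAl := bmeasM bA (b_lt n.+1 u).
have EE : E (fun w => \1_A w * eta n u w) =
    E (fun w => \1_A w * lt_ n.+1 u w) - E (fun w => \1_A w * surv n u w).
  by rewrite -ExB//; congr Ex; apply/funext => w; rewrite /eta mulrBr.
have Tu w : A w -> fine (T n w) <= u.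
  by move=> Aw; rewrite -lee_fin -fin; exact: Au.
have lams w : A w -> lam (Z n w) s' <= lam (Z n w) (Num.max 0 (u - fine (T n w))) <= lam (Z n w) s
   /\ lam (Z n w) s <= lam (Z n w) s' + L * e.
  by move=> Aw; exact: (lam_bracket (Tu w Aw) (Ab w Aw)).
(* Survival to [u] outlasts the shorter wait [s']; conversely, in [lo], outlasting the longer wait
   [s] entails survival to [u]. *)
have up : E (fun w => \1_A w * lt_ n.+1 u w) <= E (fun w => \1_A w * expR (- lam (Z n w) s')).
  rewrite -R2; apply: Ex_le; [exact: bmeasM|exact: bmeasM|move=> w].
  rewrite indicE; case: (boolP (w \in A)); rewrite ?mul0r// inE !mul1r => Aw.
  rewrite !indicE ler_nat; case: (boolP (w \in [set w | (u%:E < T n.+1 w)%E])) => //.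
  rewrite inE/= => uT; rewrite mem_set//=; apply: (le_lt_trans _ uT).
  have /andP[h1 h2] := Ab w Aw; rewrite /= (fin w (Au w Aw)) -EFinD lee_fin.
  exact: (add_max_le h2 (Tu w Aw)).
have lo : E (fun w => \1_A w * expR (- lam (Z n w) s)) <= E (fun w => \1_A w * lt_ n.+1 u w).
  rewrite -R1; apply: Ex_le; [exact: bmeasM|exact: bmeasM|move=> w].
  rewrite indicE; case: (boolP (w \in A)); rewrite ?mul0r// inE !mul1r => Aw.
  rewrite !indicE ler_nat; case: (boolP (w \in [set w | (T n w + s%:E < T n.+1 w)%E])) => //.
  rewrite inE/= => uT; rewrite mem_set//=; apply: (le_lt_trans _ uT).
  have /andP[h1 h2] := Ab w Aw; rewrite /= (fin w (Au w Aw)) -EFinD lee_fin.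
  exact: le_add_max.
have c1 : E (fun w => \1_A w * expR (- lam (Z n w) s')) <=
    E (fun w => \1_A w * surv n u w + L * e * \1_A w).
  apply: Ex_le; [exact: bmeasM|by apply: bmeasD => //; exact: bmeasZ|move=> w].
  rewrite indicE; case: (boolP (w \in A)); rewrite ?mul0r ?mulr0 ?addr0// inE !mul1r mulr1 => Aw.
  by have [l1 l2] := lams w Aw; have [] := expRN_bracket (lam_ge0 (Z_box n w) s'0) l1 l2.
have c2 : E (fun w => \1_A w * surv n u w) <=
    E (fun w => \1_A w * expR (- lam (Z n w) s) + L * e * \1_A w).
  apply: Ex_le => //; first by apply: bmeasD => //; [exact: bmeasM|exact: bmeasZ].
  move=> w.
  rewrite indicE; case: (boolP (w \in A)); rewrite ?mul0r ?mulr0 ?addr0// inE !mul1r mulr1 => Aw.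
  by have [l1 l2] := lams w Aw; have [] := expRN_bracket (lam_ge0 (Z_box n w) s'0) l1 l2.
rewrite ExD// in c1; last exact: bmeasZ.
rewrite ExD// in c2; [|exact: bmeasM|exact: bmeasZ].
rewrite ExZ// in c1; rewrite ExZ// in c2.
by rewrite EE; exact: norm_sub_bracket up lo c1 c2.
Qed.

Lemma survival_fun n u (G : Om -> R) : 0 <= u -> measurable_fun (setT : set (Hist n)) G ->
  (exists M : R, forall w, `|G w| <= M) -> E (fun w => G w * (le_ n u w * eta n u w)) = 0.
Proof.
move=> u0 mG GM.
apply: (Ex_test (@hist_sub n)) => //; first exact: bmeasM.
move=> A mA.
rewrite -[RHS](@survival_event n u (A `&` [set w | (T n w <= u%:E)%E]) u0).
- by congr Ex; apply/funext => w; rewrite !indicE in_setI mulrA; case: (w \in A);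
    case: (w \in _); rewrite ?mulr1 ?mulr0 ?mul0r.
- by apply: measurableI => //; exact: hist_le.
- by move=> w [].
Qed.

Let cur n u w : R := le_ n u w * lt_ n.+1 u w.

Let b_cur n u : bmeas (cur n u). Proof. exact: bmeasM. Qed.

Let hist_indic n (A : set Om) : measurable (A : set (Hist n)) ->
  measurable_fun (setT : set (Hist n)) (\1_A : Om -> R).
Proof. exact: measurable_indic. Qed.

Let bounded_stay n u h w : 0 <= h -> `|expR (- lam (at_time n u w) h)| <= 1.
Proof.
by move=> h0; rewrite ger0_norm ?expR_ge0// expRN_le1// lam_ge0//; exact: at_time_box.
Qed.

Let hist_stay n u h : 0 <= h ->
  measurable_fun (setT : set (Hist n)) (fun w => expR (- lam (at_time n u w) h)).
Proof.
move=> h0; apply: measurableT_comp; first exact: measurable_expR.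
apply: measurable_funN.
have := measurable_fun_lam (@hist_at_time n u) (@measurable_cst _ _ _ _ setT h).
by under eq_fun do rewrite max0r//.
Qed.

(** A Markov property at the fixed date [u]. By additivity of [lam], the predicted survival to
    [u + h] is that to [u] times the survival over [h] from [at_time n u]; the claim is the
    difference of two instances of [survival_fun]. *)
Lemma Ex_no_jump n u h (G : Om -> R) : 0 <= u -> 0 <= h ->
  measurable_fun (setT : set (Hist n)) G -> (exists M : R, forall w, `|G w| <= M) ->
  E (fun w => G w * (cur n u w * lt_ n.+1 (u + h) w)) =
  E (fun w => G w * (cur n u w * expR (- lam (at_time n u w) h))).
Proof.
move=> u0 h0 mG [M GM]; have uh0 : 0 <= u + h by rewrite addr_ge0.
have bG : bmeas G by split; [exact: (hist_meas mG)|exists M].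
have M0 : 0 <= M by exact: (le_trans (normr_ge0 (G point)) (GM point)).
have ml := hist_indic (hist_le u (leqnn n)).
have bs : bmeas (fun w => expR (- lam (at_time n u w) h)).
  by split; [exact: (hist_meas (hist_stay _ _))|exists 1 => w; exact: bounded_stay].
have ind1 (A : set Om) w : `|\1_A w : R| <= 1.
  by rewrite indicE; case: (w \in A); rewrite ?normr1 ?normr0.
have h1 := @survival_fun n (u + h) (fun w => G w * le_ n u w) uh0 (measurable_funM mG ml).
have h2 := @survival_fun n u (fun w => G w * expR (- lam (at_time n u w) h)) u0
  (measurable_funM mG (hist_stay u h0)).
have e1 : E (fun w => G w * le_ n u w * (le_ n (u + h) w * eta n (u + h) w)) = 0.
  by apply: h1; exists M => w; rewrite normrM -[M]mulr1 ler_pM//.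
have e2 : E (fun w => G w * expR (- lam (at_time n u w) h) * (le_ n u w * eta n u w)) = 0.
  by apply: h2; exists M => w; rewrite normrM -[M]mulr1 ler_pM//; exact: bounded_stay.
have b1 : bmeas (fun w => G w * (cur n u w * lt_ n.+1 (u + h) w)).
  by apply: bmeasM => //; exact: bmeasM.
have b2 : bmeas (fun w => G w * (cur n u w * expR (- lam (at_time n u w) h))).
  by apply: bmeasM => //; exact: bmeasM.
apply/eqP; rewrite -subr_eq0 -ExB// -[X in _ == X]subr0 -{1}e1 -{1}e2 -ExB; last 2 first.
- by apply: bmeasM; [exact: bmeasM|exact: bmeasM].
- by apply: bmeasM; [exact: bmeasM|exact: bmeasM].
apply/eqP; congr Ex; apply/funext => w; rewrite /eta /cur.
have l1 : le_ n u w * le_ n (u + h) w = le_ n u w.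
  rewrite !indicE; case: (boolP (w \in [set w | (T n w <= u%:E)%E])); rewrite ?mul0r// inE/= => Tu.
  by rewrite mem_set ?mulr1//=; apply: (le_trans Tu); rewrite lee_fin lerDl.
have l2 : lt_ n.+1 u w * lt_ n.+1 (u + h) w = lt_ n.+1 (u + h) w.
  rewrite !indicE; case: (boolP (w \in [set w | ((u + h)%:E < T n.+1 w)%E])); rewrite ?mulr0// inE/= => Tu.
  by rewrite mem_set ?mul1r//=; apply: le_lt_trans Tu; rewrite lee_fin lerDl.
have l3 : le_ n u w * surv n (u + h) w = le_ n u w * (surv n u w * expR (- lam (at_time n u w) h)).
  rewrite indicE; case: (boolP (w \in [set w | (T n w <= u%:E)%E])); rewrite ?mul0r// inE/= => Tu.
  have Tf : fine (T n w) <= u.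
    by rewrite -lee_fin -T_fin//; apply: (le_lt_trans Tu); exact: ltry.
  have t0 : 0 <= u - fine (T n w) by rewrite subr_ge0.
  have t1 : 0 <= u + h - fine (T n w) by rewrite addrAC addr_ge0.
  rewrite !mul1r /surv /at_time (max0r t0) (max0r t1) addrAC lamD//= -expRD.
  by congr expR; rewrite opprD.
move: (le_ n u w) (le_ n (u + h) w) (lt_ n.+1 u w) (lt_ n.+1 (u + h) w) (surv n u w) (surv n (u + h) w)
  (expR _) (G w) l1 l2 l3 => x x' y y' s s' e z l1 l2 l3.
have -> : z * x * (x' * (y' - s')) - z * e * (x * (y - s)) =
  z * (x * x') * y' - z * ((x * x') * s') - z * (x * y * e) + z * (x * (s * e)) by ring.
have -> : x * y * y' = x * y' by rewrite -mulrA l2.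
by rewrite l1 l3; ring.
Qed.

(** If the [n]-th jump comes after [u], a further one by [u + h] requires a wait of at most [h].
    Applied with [n.+1], it bounds the probability of two jumps in one step. *)
Lemma Ex_jump_le n u h (A : set Om) : 0 <= u -> 0 <= h ->
  measurable (A : set (Hist n)) -> (forall w, A w -> (T n w < +oo)%E) ->
  (forall w, A w -> (u%:E <= T n w)%E) ->
  E (fun w => \1_A w * (1 - lt_ n.+1 (u + h) w)) <= L * h * E \1_A.
Proof.
move=> u0 h0 mA Afin Au; have mA' : measurable A by exact: (@hist_sub n).
have bA := bmeas_indic R mA'.
have bg : bmeas (\1_[set w | (T n w + h%:E < T n.+1 w)%E] : Om -> R).
  exact/bmeas_indic/meas_gap.
have bl := b_exp n h0.
have b1 := bmeas_cst Om (1 : R).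
apply: (@le_trans _ _ (E (fun w => \1_A w * (1 - \1_[set w | (T n w + h%:E < T n.+1 w)%E] w)))).
  apply: Ex_le; [exact/bmeasM/bmeasB|exact/bmeasM/bmeasB|move=> w].
  rewrite indicE; case: (boolP (w \in A)); rewrite ?mul0r// inE !mul1r => Aw.
  rewrite lerD2l lerN2 !indicE ler_nat.
  case: (boolP (w \in [set w | (T n w + h%:E < T n.+1 w)%E])) => //.
  rewrite inE/= => uT; rewrite mem_set//=; apply: le_lt_trans uT.
  by rewrite EFinD leeD2r// Au.
have -> : (fun w => \1_A w * (1 - \1_[set w | (T n w + h%:E < T n.+1 w)%E] w)) =
    fun w => \1_A w - \1_A w * \1_[set w | (T n w + h%:E < T n.+1 w)%E] w :> R.
  by apply/funext => w; rewrite mulrBr mulr1.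
rewrite ExB//; last exact: bmeasM.
rewrite rate_Ex// -ExB//; last exact: bmeasM.
rewrite -ExZ//; apply: Ex_le; [exact/bmeasB/bmeasM|exact: bmeasZ|move=> w].
rewrite indicE; case: (boolP (w \in A)); rewrite ?mul0r ?mulr0 ?subr0// inE !mul1r mulr1 => Aw.
exact: (le_trans (subr_expRN_le _) (lam_le (Z_box n w) h0)).
Qed.

(** * Non-explosion *)

Fixpoint short_gaps k m : set Om :=
  if m is m'.+1 then short_gaps k m' `&` [set w | (T (k + m') w < +oo)%E]
    `&` [set w | (T (k + m').+1 w <= T (k + m') w + 1%:E)%E]
  else setT.

Let hist_fin n : measurable ([set w | (T n w < +oo)%E] : set (Hist n)).
Proof.
rewrite [X in measurable X](_ : _ = setT `&` T n @^-1` `[-oo%E, +oo%E[%classic).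
  by apply: hist_T => //; exact: emeasurable_itv.
by rewrite setTI; apply/seteqP; split => w /=; rewrite in_itv//= leNye.
Qed.

Let setC_gap n : [set w | (T n.+1 w <= T n w + 1%:E)%E] =
  ~` [set w | (T n w + 1%:E < T n.+1 w)%E].
Proof. by apply/seteqP; split => w /=; rewrite leNgt => /negP. Qed.

Let hist_gap n : measurable ([set w | (T n.+1 w <= T n w + 1%:E)%E] : set (Hist n.+1)).
Proof.
rewrite setC_gap; apply: measurableC; rewrite -[X in measurable X]setTI.
apply: measurable_lte => //; last exact: hist_T.
by apply: emeasurable_funD; [exact: hist_T|exact: measurable_cst].
Qed.

Let hist_short_gaps k m : measurable (short_gaps k m : set (Hist (k + m))).
Proof.
elim: m => [|m IH]; first exact: measurableT.
apply: measurableI; last by rewrite addnS; exact: hist_gap.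
apply: measurableI; rewrite addnS; first exact: (hist_mono (leqnSn _) IH).
by apply: (hist_mono (leqnSn (k + m))); exact: hist_fin.
Qed.

Let rho := 1 - expR (- L).

Let rho_01 : 0 <= rho < 1.
Proof. by rewrite subr_ge0 expRN_le1 ?(cf_L F)//= gtrBl expR_gt0. Qed.

(** Given the past, a gap is of length at most 1 with probability at most [rho], since the
    integrated rate over unit time is at most [L] on the box. *)
Lemma short_gaps_small k m : E \1_(short_gaps k m) <= rho ^+ m.
Proof.
elim: m => [|m IH]; first by rewrite expr0 /= Ex_indic// probability_setT.
have hA := measurableI _ _ (@hist_short_gaps k m) (@hist_fin (k + m)).
set A := short_gaps k m `&` [set w | (T (k + m) w < +oo)%E] in hA *.
have mA : measurable A by exact: (hist_sub hA).
have bA := bmeas_indic R mA.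
have bg : bmeas (\1_[set w | (T (k + m) w + 1%:E < T (k + m).+1 w)%E] : Om -> R).
  exact/bmeas_indic/meas_gap.
have R1 := rate_Ex ler01 hA (fun w Aw => Aw.2).
have -> : \1_(short_gaps k m.+1) = (fun w => \1_A w -
    \1_A w * \1_[set w | (T (k + m) w + 1%:E < T (k + m).+1 w)%E] w) :> (Om -> R).
  apply/funext => w; rewrite /= -/A setC_gap !indicE in_setI in_setC.
  by case: (w \in A); case: (w \in _); rewrite /= ?mulr0 ?mulr1 ?subr0 ?subrr.
rewrite ExB//; last exact: bmeasM.
rewrite R1.
have bl := b_exp (k + m) ler01.
rewrite -ExB//; last exact: bmeasM.
have /andP[r0 _] := rho_01.
apply: (@le_trans _ _ (E (fun w => rho * \1_(short_gaps k m) w))).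
  apply: Ex_le; [exact/bmeasB/bmeasM|apply/bmeasZ/bmeas_indic|move=> w].
    exact: (hist_sub (@hist_short_gaps k m)).
  rewrite indicE in_setI; case: (boolP (w \in short_gaps k m)) => wS /=; last first.
    by rewrite mul0r subr0 mulr_ge0// indicE.
  rewrite indicE wS mulr1; case: (w \in _); last by rewrite mul0r subr0.
  rewrite mul1r lerD2l lerN2 ler_expR lerN2 -[leRHS]mulr1; apply: lam_le => //; exact: Z_box.
rewrite ExZ; last by apply: bmeas_indic; exact: (hist_sub (@hist_short_gaps k m)).
by rewrite exprS ler_wpM2l.
Qed.

Let not_short_gaps k m w : ~ short_gaps k m w -> (T (k + m) w < +oo)%E ->
  (T k w + 1%:E <= T (k + m) w)%E.
Proof.
elim: m => [[]//|m IH] /= ns; rewrite addnS => fin.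
have Tm : (T (k + m) w <= T (k + m).+1 w)%E by exact: T_mono.
have fm : (T (k + m) w < +oo)%E := le_lt_trans Tm fin.
have [sg|/IH h] := pselect (short_gaps k m w); last exact: (le_trans (h fm) Tm).
have {}ns : ~ (T (k + m).+1 w <= T (k + m) w + 1%:E)%E by move=> h; apply: ns; split.
move/negP: ns; rewrite -ltNge => /ltW; apply: le_trans.
by rewrite leeD2r// T_mono// leq_addr.
Qed.

(** Among [J] blocks of [m] gaps, some block has only gaps of length at most 1; otherwise every
    block takes at least unit time and the last jump comes no earlier than [J > u]. *)
Lemma many_jumps_small J m u : u < J%:R -> E (le_ (J * m) u) <= J%:R * rho ^+ m.
Proof.
move=> uJ.
have mS j : measurable (short_gaps (j * m) m) by exact: (hist_sub (@hist_short_gaps _ _)).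
apply: (@le_trans _ _ (E (fun w => \sum_(j <- iota 0 J) \1_(short_gaps (j * m) m) w))).
  apply: Ex_le => //; first by apply: bmeas_sum => j; exact: bmeas_indic.
  move=> w; rewrite [leLHS]indicE; case: (boolP (w \in _)); last first.
    by move=> _; apply: sumr_ge0 => j _; rewrite indicE.
  rewrite inE /= => Tu.
  have finJ j : (j <= J)%N -> (T (j * m) w < +oo)%E.
    move=> jJ; apply: (le_lt_trans _ (ltry u)); apply: le_trans Tu.
    by apply: T_mono; rewrite leq_mul2r jJ orbT.
  suff [j jJ wj] : exists2 j, (j < J)%N & short_gaps (j * m) m w.
    rewrite (bigD1_seq j) ?iota_uniq ?mem_iota//= indicE mem_set//.
    by rewrite lerDl sumr_ge0// => i _; rewrite indicE.
  apply: contrapT => h.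
  have hj j : (j <= J)%N -> (j%:R%:E <= T (j * m) w)%E.
    elim: j => [|j IH] jJ; first exact: T_ge0.
    have nsg : ~ short_gaps (j * m) m w by move=> sg; apply: h; exists j.
    have := not_short_gaps nsg; rewrite -mulSnr => /(_ (finJ _ jJ)); apply: le_trans.
    by rewrite -natr1 EFinD leeD2r// IH// ltnW.
  have := le_trans (hj J (leqnn J)) Tu; rewrite lee_fin leNgt uJ//.
rewrite Ex_sum; last by move=> j; exact: bmeas_indic.
apply: (@le_trans _ _ (\sum_(j <- iota 0 J) rho ^+ m)).
  by apply: ler_sum => j _; exact: short_gaps_small.
by rewrite big_const_seq count_predT size_iota iter_addr_0 mulr_natl.
Qed.

Lemma nonexplosion u (e : R) : 0 < e -> exists n, E (le_ n u) < e.
Proof.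
move=> e0; pose J := Num.bound `|u|.
have uJ : u < J%:R by apply: (le_lt_trans (ler_norm u)); exact: archi_boundP.
have J0 : 0 < J%:R + 1 :> R by rewrite ltr_wpDl.
have /andP[r0 r1] := rho_01.
have : rho ^+ m @[m --> \oo] --> (0 : R) by apply: cvg_expr; rewrite ger0_norm.
move=> /cvgrPdist_lt /(_ _ (divr_gt0 e0 J0)) [m _ /(_ m (leqnn m))] /=.
rewrite sub0r normrN ger0_norm ?exprn_ge0// => rm.
exists (J * m)%N; apply: (le_lt_trans (many_jumps_small m uJ)).
move: rm; rewrite ltr_pdivlMr// mulrC; apply: le_lt_trans.
by rewrite ler_wpM2r ?exprn_ge0// lerDl.
Qed.

(** Off this event, [X u] is not controlled: the start is wrong, or [u] is not before the limit of
    the jump times. *)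
Let regular u := good `&` \bigcup_n [set w | (u%:E < T n w)%E].

Let meas_regular u : measurable (regular u).
Proof. by apply: measurableI => //; apply: bigcupT_measurable. Qed.

Let regular1 u : Q (regular u) = 1%E.
Proof.
have mr := meas_regular u.
apply/eqP; rewrite eq_le probability_le1//= -[Q _]fineK ?fin_num_measure//.
rewrite lee_fin -Ex_indic//; apply/ler_addgt0Pr => e /(nonexplosion u)[n En].
apply: (@le_trans _ _ (E (fun w => \1_(regular u) w + le_ n u w))).
  rewrite -[leLHS](Ex_cst Q 1); apply: (Ex_le_ae good_meas X_start).
  - exact: bmeas_cst.
  - by apply: bmeasD; [exact: bmeas_indic|exact: b_le].
  move=> w gw; have [Tn|Tn] := leP (T n w) u%:E.
    by rewrite [X in _ + X]indic_in// lerDr indicE.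
  by rewrite indic_in ?lerDl ?indicE//; split => //; exists n.
by rewrite ExD//; [rewrite lerD2l ltW|exact: bmeas_indic].
Qed.

Lemma X_box u w : 0 <= u -> regular u w -> B (X u w).2.
Proof.
move=> u0 [gw [n _ /= un]].
elim: n un => [|n IH] un; first by move: un; rewrite T0 lte_fin ltNge u0.
have [h|h] := leP (T n w) u%:E; last exact: IH.
by rewrite (X_between gw h un); exact: at_time_box.
Qed.

(** First term: one jump, of probability at most [L * h], displaces the location by at most
    [4 * C * h] in [N]. Second term: two jumps, of probability at most [(L * h) ^+ 2], cost the full
    oscillation. *)
Definition jump_error (K s : R) := 4 * K * C * L + s * L ^+ 2.

Lemma bmeas_X u (f : state R -> R) : 0 <= u -> bmeas f -> bmeas (fun w => f (X u w)).
Proof. by move=> u0; exact: bmeas_comp (X_meas u0). Qed.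

(** The process changes planes at a time [a] within the step, the chain at its end. Both locations
    are reached from the common point at [a] in the remaining time [b]. *)
Lemma norm1_split_flow i j w a b : B w -> 0 <= a -> 0 <= b ->
  norm1 (phi i (phi j w a) b - phi j w (a + b)) <= 2 * (C * b).
Proof.
move=> Bw a0 b0; have Ba := cf_flowB F j Bw a0.
apply: (le_trans (norm1_triangle (phi j w a) _ _)).
rewrite mulr_natl mulr2n lerD//; first exact: (cf_speed F).
by rewrite norm1C -(cf_flowD F)//; exact: (cf_speed F).
Qed.

Lemma Ex_step_cur n u h (g : state R -> R) (K s : R) : 0 <= u -> 0 <= h -> 0 <= K -> 0 <= s ->
  bmeas g -> osc_le B s g -> lip N B K g ->
  `|E (fun w => cur n u w * (g (X (u + h) w) - step phi lam h g (X u w)))|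
    <= jump_error K s * h ^+ 2 * E (cur n u).
Proof.
move=> u0 h0 K0 s0 bg gs gK; have [mg [M gM]] := bg.
have uh0 : 0 <= u + h by rewrite addr_ge0.
pose a w := expR (- lam (at_time n u w) h).
pose p1 w := g ((at_time n u w).1, phi (at_time n u w).1 (at_time n u w).2 h).
pose p2 w := g (~~ (at_time n u w).1, phi (at_time n u w).1 (at_time n u w).2 h).
pose v w := lt_ n.+1 (u + h) w; pose v' w := lt_ n.+2 (u + h) w.
have hx1 : measurable_fun (setT : set (Hist n)) (fun w => (at_time n u w).1).
  exact: (measurableT_comp measurable_fst (@hist_at_time n u)).
have hx2 : measurable_fun (setT : set (Hist n))
    (fun w => phi (at_time n u w).1 (at_time n u w).2 h).
  have := measurable_fun_phi (@hist_at_time n u) (@measurable_cst _ _ _ _ setT h).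
  by under eq_fun do rewrite max0r//.
have hp1 : measurable_fun (setT : set (Hist n)) p1.
  by apply: (measurableT_comp mg); exact: measurable_fun_pair.
have hp2 : measurable_fun (setT : set (Hist n)) p2.
  by apply: (measurableT_comp mg); apply: measurable_fun_pair => //; exact: measurable_neg.
have bp1 : bmeas p1 by split; [exact: (hist_meas hp1)|exists M => w; exact: gM].
have bp2 : bmeas p2 by split; [exact: (hist_meas hp2)|exists M => w; exact: gM].
have ba : bmeas a.
  by split; [exact: (hist_meas (@hist_stay n u h h0))|exists 1 => w; exact: bounded_stay].
have bv : bmeas v by exact: b_lt.
have bv' : bmeas v' by exact: b_lt.
have b1 := bmeas_cst Om (1 : R).
have bcur := b_cur n u.
have bX t : 0 <= t -> bmeas (fun w => g (X t w)) by move=> t0; exact: bmeas_X.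
have bS : bmeas (fun w => step phi lam h g (X u w)) by apply: bmeas_X => //; exact: bmeas_step.
have no_jump (f : Om -> R) : measurable_fun (setT : set (Hist n)) f ->
    (exists M : R, forall w, `|f w| <= M) ->
    E (fun w => f w * (cur n u w * v w)) = E (fun w => f w * (cur n u w * a w)).
  exact: Ex_no_jump.
(* replace [step] by what a single jump at time [u + h] would give *)
have E1 : E (fun w => cur n u w * (g (X (u + h) w) - step phi lam h g (X u w))) =
    E (fun w => cur n u w * (g (X (u + h) w) - (v w * p1 w + (1 - v w) * p2 w))).
  have e : E (fun w => (p1 w - p2 w) * (cur n u w * v w)) =
      E (fun w => (p1 w - p2 w) * (cur n u w * a w)).
    apply: no_jump; first exact: measurable_funB.
    by exists (M + M) => w; apply: (le_trans (ler_normB _ _)); apply: lerD; exact: gM.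
  have bE x : bmeas x -> bmeas (fun w => cur n u w * (g (X (u + h) w) -
      (x w * p1 w + (1 - x w) * p2 w))).
    move=> bx; apply: bmeasM => //; apply: bmeasB; first exact: bX.
    by apply: bmeasD; apply: bmeasM => //; exact: bmeasB.
  transitivity (E (fun w => cur n u w * (g (X (u + h) w) - (a w * p1 w + (1 - a w) * p2 w)))).
    apply: (Ex_eq_ae good_meas X_start) => //.
    - by apply: bmeasM => //; apply: bmeasB => //; exact: bX.
    - exact: bE.
    move=> w gw; rewrite /cur !indicE.
    case: (boolP (w \in [set w | (T n w <= u%:E)%E])); rewrite ?mul0r// inE/= => Tu.
    case: (boolP (w \in [set w | (u%:E < T n.+1 w)%E])); rewrite ?mulr0 ?mul0r// inE/= => uT.
    rewrite mulr1 !mul1r (X_between gw Tu uT) /step /stay min_r//.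
    by rewrite expRN_le1// lam_ge0//; exact: at_time_box.
  have X1 x : bmeas x -> E (fun w => cur n u w * (g (X (u + h) w) - (x w * p1 w + (1 - x w) * p2 w)))
     = E (fun w => cur n u w * (g (X (u + h) w) - p2 w)) - E (fun w => (p1 w - p2 w) * (cur n u w * x w)).
    move=> bx; rewrite -ExB.
    - by congr Ex; apply/funext => w; ring.
    - by apply: bmeasM => //; apply: bmeasB => //; exact: bX.
    - by apply: bmeasM; [exact: bmeasB|exact: bmeasM].
  by rewrite !X1// e.
rewrite E1.
pose A := [set w | (T n w <= u%:E)%E] `&` [set w | (u%:E < T n.+1 w)%E]
  `&` [set w | (T n.+1 w <= (u + h)%:E)%E].
have hA : measurable (A : set (Hist n.+1)).
  apply: measurableI; last exact: hist_le.
  apply: measurableI; first by apply: hist_le.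
  rewrite [X in measurable X](_ : _ = ~` [set w | (T n.+1 w <= u%:E)%E]).
    by apply: measurableC; exact: hist_le.
  by apply/seteqP; split => w /=; rewrite ltNge => /negP.
have mA : measurable A by exact: (@hist_sub n.+1).
have bA := bmeas_indic R mA.
have AE w : \1_A w = cur n u w * (1 - v w).
  rewrite /A /cur /v !indicE !in_setI.
  case: (w \in _) => /=; last by rewrite !mul0r.
  case: (w \in _) => /=; last by rewrite mulr0 mul0r.
  rewrite mulr1 mul1r.
  have -> : (w \in [set w | (T n.+1 w <= (u + h)%:E)%E]) = ~~ (w \in [set w | ((u + h)%:E < T n.+1 w)%E]).
    by apply/idP/idP; rewrite notin_setE inE/= leNgt => /negP.
  by case: (w \in _); rewrite /= ?subrr ?subr0.
have A_small : E \1_A <= L * h * E (cur n u).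
  have -> : \1_A = (fun w => cur n u w * (1 - v w)) by apply/funext.
  have nj : E (fun w => cur n u w * v w) = E (fun w => cur n u w * a w).
    have e1 x : (fun w => cur n u w * x w) = (fun w => 1 * (cur n u w * x w)).
      by apply/funext => w; rewrite mul1r.
    rewrite (e1 v) (e1 a); apply: no_jump; first exact: measurable_cst.
    by exists 1 => w; rewrite normr1.
  have -> : (fun w => cur n u w * (1 - v w)) = (fun w => cur n u w - cur n u w * v w).
    by apply/funext => w; rewrite mulrBr mulr1.
  rewrite ExB//; last exact: bmeasM.
  rewrite nj -ExB//; last exact: bmeasM.
  rewrite -ExZ//; apply: Ex_le; [exact/bmeasB/bmeasM|exact: bmeasZ|move=> w].
  have c0 : 0 <= cur n u w by rewrite mulr_ge0// indicE.
  rewrite -[X in X - _]mulr1 -mulrBr mulrC ler_wpM2r//.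
  exact: (le_trans (subr_expRN_le _) (lam_le (at_time_box n u w) h0)).
have A_two : E (fun w => \1_A w * (1 - v' w)) <= L * h * E \1_A.
  apply: Ex_jump_le => //.
  - by move=> w [_ /= Tu]; exact: (le_lt_trans Tu (ltry _)).
  - by move=> w [[_ /= /ltW]].
(* Three cases: without a jump the difference vanishes, with one jump only the locations differ, and
   with more only the oscillation of [g] is used. *)
have pt w : regular (u + h) w ->
   `|cur n u w * (g (X (u + h) w) - (v w * p1 w + (1 - v w) * p2 w))| <=
   4 * K * C * h * \1_A w + s * (\1_A w * (1 - v' w)).
  move=> rw; have [gw _] := rw; have BX := X_box uh0 rw.
  rewrite !AE /cur !indicE.
  case: (boolP (w \in [set w | (T n w <= u%:E)%E])) => [|_]; last by rewrite !(mul0r, mulr0) normr0 addr0.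
  rewrite inE/= => Tu.
  case: (boolP (w \in [set w | (u%:E < T n.+1 w)%E])) => [|_]; last by rewrite !(mul0r, mulr0) normr0 addr0.
  rewrite inE/= => uT.
  have Tf : T n w = (fine (T n w))%:E by apply: T_fin; exact: (le_lt_trans Tu (ltry _)).
  have t0 : 0 <= u - fine (T n w) by rewrite subr_ge0 -lee_fin -Tf.
  have Bz := Z_box n w.
  have eh : phi (Z n w).1 (phi (Z n w).1 (Z n w).2 (u - fine (T n w))) h =
      phi (Z n w).1 (Z n w).2 (u + h - fine (T n w)).
    by rewrite (cf_flowD F)// addrAC.
  rewrite /v /v' !indicE /p1 /p2 /at_time/= (max0r t0) eh !mul1r.
  case: (boolP (w \in [set w | ((u + h)%:E < T n.+1 w)%E])) => [|].
    rewrite inE/= => uhT.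
    have Tuh : (T n w <= (u + h)%:E)%E by apply: (le_trans Tu); rewrite lee_fin lerDl.
    rewrite (X_between gw Tuh uhT) /at_time max0r; last by rewrite addrAC addr_ge0.
    by rewrite subrr !mul0r !mulr0 !addr0 mul1r subrr normr0.
  rewrite notin_setE/= => /negP; rewrite -leNgt => Tuh.
  have Tf' : T n.+1 w = (fine (T n.+1 w))%:E by apply: T_fin; exact: (le_lt_trans Tuh (ltry _)).
  rewrite mul0r add0r subr0 !mul1r mulr1.
  case: (boolP (w \in [set w | ((u + h)%:E < T n.+2 w)%E])) => [|_]; last first.
    rewrite subr0 mulr1 ler_wpDl ?mulr_ge0 ?(cf_C F)//.
    move: BX; case: (X (u + h) w) => i x /= BX.
    have B2 := cf_flowB F (Z n w).1 Bz (addr_ge0 t0 h0).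
    rewrite addrAC in B2.
    by rewrite ler_norml lerNl opprB !gs.
  rewrite inE/= => uhT; rewrite subrr mulr0 addr0.
  rewrite (X_between gw Tuh uhT) /at_time.
  have e1 : 0 <= fine (T n.+1 w) - fine (T n w).
    by rewrite subr_ge0 -lee_fin -Tf -Tf'; exact: T_mono.
  have e2 : 0 <= u + h - fine (T n.+1 w) by rewrite subr_ge0 -lee_fin -Tf'.
  rewrite (max0r e2) /= /gap (max0r e1).
  set x := phi _ _ (u + h - fine (T n.+1 w)); set y := phi _ _ (u + h - fine (T n w)).
  have B1 : B x by apply: (cf_flowB F) => //; apply: (cf_flowB F).
  have B2 : B y by apply: (cf_flowB F) => //; rewrite addrAC addr_ge0.
  apply: (le_trans (gK _ _ _ B1 B2)).
  have e3 : u + h - fine (T n w) = (fine (T n.+1 w) - fine (T n w)) + (u + h - fine (T n.+1 w)).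
    by ring.
  have := norm1_split_flow (~~ (Z n w).1) (Z n w).1 Bz e1 e2; rewrite -e3 -/x -/y => h1.
  have /andP[_ h2] := cf_norm F (x - y).
  have h3 : u + h - fine (T n.+1 w) <= h by rewrite addrAC gerDr subr_le0 -lee_fin -Tf' ltW.
  have h4 : C * (u + h - fine (T n.+1 w)) <= C * h by rewrite ler_wpM2l ?(cf_C F).
  have -> : 4 * K * C * h = K * (2 * (2 * (C * h))) by ring.
  rewrite ler_wpM2l//; apply: (le_trans h2); rewrite ler_wpM2l//; apply: (le_trans h1).
  by rewrite ler_wpM2l.
have bpt : bmeas (fun w => cur n u w * (g (X (u + h) w) - (v w * p1 w + (1 - v w) * p2 w))).
  apply: bmeasM => //; apply: bmeasB; first exact: bX.
  by apply: bmeasD; apply: bmeasM => //; exact: bmeasB.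
have bA' : bmeas (fun w => \1_A w * (1 - v' w)) by apply: bmeasM => //; exact: bmeasB.
apply: (le_trans (Ex_abs _ bpt)).
apply: (@le_trans _ _ (E (fun w => 4 * K * C * h * \1_A w + s * (\1_A w * (1 - v' w))))).
  apply: (Ex_le_ae (meas_regular (u + h)) (regular1 (u + h))) => //; first exact: bmeas_norm.
  by apply: bmeasD; exact: bmeasZ.
rewrite ExD ?ExZ//; try exact: bmeasZ.
have C0 := cf_C F; have L0 := cf_L F.
have k0 : 0 <= 4 * K * C * h by rewrite !mulr_ge0.
have h1 : 4 * K * C * h * E \1_A <= 4 * K * C * h * (L * h * E (cur n u)) by rewrite ler_wpM2l.
have h2 : s * E (fun w => \1_A w * (1 - v' w)) <= s * (L * h * (L * h * E (cur n u))).
  by rewrite ler_wpM2l// (le_trans A_two)// ler_wpM2l// mulr_ge0.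
apply: (le_trans (lerD h1 h2)); rewrite /jump_error.
by rewrite le_eqVlt; apply/orP; left; apply/eqP; ring.
Qed.

Let sum_cur n u w : 0 <= u -> \sum_(k <- iota 0 n) cur k u w = lt_ n u w.
Proof.
move=> u0; elim: n => [|n IH].
  by rewrite big_nil indic_out//= T0 lte_fin; apply/negP; rewrite -leNgt.
rewrite -[n.+1]addn1 iotaD big_cat/= IH big_seq1 add0n addn1 /cur.
have [Tn|Tn] := leP (T n w) u%:E.
  rewrite [lt_ n u w]indic_out/=; last by apply/negP; rewrite -leNgt.
  by rewrite [le_ n u w]indic_in// mul1r add0r.
rewrite [lt_ n u w]indic_in// [le_ n u w]indic_out/=; last by apply/negP; rewrite -ltNge.
rewrite mul0r addr0 indic_in//=; apply: (lt_le_trans Tn); exact: T_mono.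
Qed.

(** Sums the previous estimate over the number of jumps before [u]. Non-explosion makes the event of
    at least [n] jumps negligible. *)
Lemma Ex_step u h (g : state R -> R) (K s : R) : 0 <= u -> 0 <= h -> 0 <= K -> 0 <= s ->
  bmeas g -> osc_le B s g -> lip N B K g ->
  `|E (fun w => g (X (u + h) w)) - E (fun w => step phi lam h g (X u w))|
    <= jump_error K s * h ^+ 2.
Proof.
move=> u0 h0 K0 s0 bg gs gK; have uh0 : 0 <= u + h by rewrite addr_ge0.
have [mg [M gM']] := bg.
have M0 : 0 <= M := le_trans (normr_ge0 (g point)) (gM' point).
have bX t : 0 <= t -> bmeas (fun w => g (X t w)) by move=> t0; exact: bmeas_X.
have bS : bmeas (fun w => step phi lam h g (X u w)) by apply: bmeas_X => //; exact: bmeas_step.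
rewrite -ExB//; last exact: bX.
set f := fun w => g (X (u + h) w) - step phi lam h g (X u w).
have bf : bmeas f by apply: bmeasB => //; exact: bX.
have je0 : 0 <= jump_error K s * h ^+ 2.
  by rewrite mulr_ge0 ?sqr_ge0// addr_ge0// !mulr_ge0 ?sqr_ge0 ?(cf_C F) ?(cf_L F).
have fM w : `|f w| <= 2 * M.
  by rewrite (le_trans (ler_normB _ _))// mulr_natl mulr2n lerD// step_bounded.
apply/ler_addgt0Pr => e e0.
have M1 : 0 < 2 * M + 1 by rewrite ltr_wpDl// mulr_ge0.
have [n En] := nonexplosion u (divr_gt0 e0 M1).
have -> : f = fun w => \sum_(k <- iota 0 n) cur k u w * f w + le_ n u w * f w.
  apply/funext => w; rewrite -mulr_suml sum_cur// -mulrDl.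
  have [Tn|Tn] := leP (T n w) u%:E.
    rewrite [lt_ n u w]indic_out/=; last by apply/negP; rewrite -leNgt.
    by rewrite indic_in// add0r mul1r.
  rewrite [lt_ n u w]indic_in// [le_ n u w]indic_out/=; last by apply/negP; rewrite -ltNge.
  by rewrite addr0 mul1r.
have bcf k : bmeas (fun w => cur k u w * f w) by exact: bmeasM.
rewrite ExD; [|exact: bmeas_sum|exact: bmeasM].
apply: (le_trans (ler_normD _ _)); apply: lerD.
  rewrite Ex_sum//; apply: (le_trans (ler_norm_sum _ _ _)).
  apply: (@le_trans _ _ (\sum_(k <- iota 0 n) jump_error K s * h ^+ 2 * E (cur k u))).
    by apply: ler_sum => k _; exact: Ex_step_cur.
  rewrite -mulr_sumr -Ex_sum//.
  have -> : (fun w => \sum_(k <- iota 0 n) cur k u w) = lt_ n u by apply/funext => w; exact: sum_cur.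
  rewrite -[leRHS]mulr1 ler_wpM2l// -(Ex_cst Q 1); apply: Ex_le => //; first exact: bmeas_cst.
apply: (@le_trans _ _ (E (fun w => 2 * M * le_ n u w))).
  apply: (le_trans (Ex_abs _ (bmeasM (b_le n u) bf))).
  apply: Ex_le; [exact/bmeas_norm/bmeasM|exact: bmeasZ|move=> w].
  by rewrite normrM mulrC ler_pM// indicE; case: (w \in _); rewrite ?normr1 ?normr0.
rewrite ExZ//.
move: En; rewrite ltr_pdivlMr// => /ltW; apply: le_trans.
rewrite mulrC ler_wpM2l ?lerDl//.
by rewrite -(Ex_cst Q 0); apply: Ex_le => //; exact: bmeas_cst.
Qed.

(** Telescoping, one step at a time. Every intermediate function has oscillation at most [s] and
    Lipschitz constant at most [s * nu + K], so the [n] errors share one bound. *)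
Lemma Ex_iter n u h (f : state R -> R) (K s : R) : 0 <= u -> 0 <= h -> 0 <= K -> 0 <= s ->
  bmeas f -> osc_le B s f -> lip N B K f ->
  `|E (fun w => f (X (u + n%:R * h) w)) - E (fun w => iter n (step phi lam h) f (X u w))|
    <= n%:R * (jump_error (s * nu + K) s * h ^+ 2).
Proof.
move=> u0 h0 K0 s0 bf fs fK; elim: n u u0 => [|n IH] u u0.
  by rewrite !mul0r addr0 subrr normr0.
have uh0 : 0 <= u + h by rewrite addr_ge0.
have -> : u + n.+1%:R * h = (u + h) + n%:R * h by rewrite -natr1; ring.
rewrite -(subrKA (E (fun w => iter n (step phi lam h) f (X (u + h) w)))).
apply: (le_trans (ler_normD _ _)).
rewrite -natr1 [leRHS]mulrDl mul1r lerD//; first exact: IH.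
apply: Ex_step => //.
- by rewrite addr_ge0// mulr_ge0// ltW ?(cf_nu F).
- exact: bmeas_iter_step.
- exact: (iter_step_osc F).
- move=> i w v Bw Bv.
  apply: (le_trans (iter_step_lip F n h0 s0 K0 fs fK i Bw Bv)).
  have N0 : 0 <= N (w - v).
    by have /andP[+ _] := cf_norm F (w - v); apply: le_trans; exact: norm1_ge0.
  rewrite ler_wpM2r// lerD2l ler_piMl// mulNr expRN_le1// !mulr_ge0//.
  exact: ltW (cf_g F).
Qed.

(** The approximating function depends on [t] and [n], not on [u]: this is how the Markov property
    at fixed dates enters later. *)
Lemma Ex_limit t u n (f : state R -> R) (K s : R) : 0 <= t -> 0 <= u -> 0 <= K -> 0 <= s ->
  bmeas f -> osc_le B s f -> lip N B K f -> (0 < n)%N ->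
  `|E (fun w => f (X (u + t) w)) - E (fun w => iter n (step phi lam (t / n%:R)) f (X u w))|
    <= jump_error (s * nu + K) s * t ^+ 2 / n%:R.
Proof.
move=> t0 u0 K0 s0 bf fs fK n_gt0.
have nP : 0 < n%:R :> R by rewrite ltr0n.
have h0 : 0 <= t / n%:R by rewrite divr_ge0// ltW.
have := Ex_iter n u0 h0 K0 s0 bf fs fK.
rewrite [n%:R * (t / _)]mulrC divfK ?lt0r_neq0//; move/le_trans; apply.
rewrite le_eqVlt; apply/orP; left; apply/eqP.
by field; rewrite lt0r_neq0.
Qed.

Lemma Ex_start (f : state R -> R) : bmeas f -> E (fun w => f (X 0 w)) = f z0.
Proof.
move=> bf; rewrite -[RHS](Ex_cst Q); apply: (Ex_eq_ae good_meas X_start).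
- exact: bmeas_X.
- exact: bmeas_cst.
- by move=> w ->.
Qed.

Lemma Ex_near u (f : state R -> R) (a e : R) : 0 <= u -> bmeas f ->
  (forall z, B z.2 -> `|f z - a| <= e) -> `|E (fun w => f (X u w)) - a| <= e.
Proof.
move=> u0 bf fa; rewrite -(Ex_cst Q a) -ExB; [|exact: bmeas_X|exact: bmeas_cst].
apply: (Ex_abs_le_ae (meas_regular u) (regular1 u)).
  by apply: bmeasB; [exact: bmeas_X|exact: bmeas_cst].
by move=> w rw; apply: fa; exact: X_box.
Qed.

End Paths.

(** * Lipschitz test functions *)

Section PlaneTopology.
Context (R : realType).

Let rect (a b c d : rat) : set (R * R) :=
  `]ratr a, ratr b[%classic `*` `]ratr c, ratr d[%classic.

(** An open set is the countable union of the rational rectangles that it contains; [D] is empty for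
    the others. *)
Lemma open_measurable_plane (A : set (R * R)) : open A -> measurable A.
Proof.
move=> oA.
pose D a b c d := if `[< rect a b c d `<=` A >] then rect a b c d else set0.
have -> : A = \bigcup_a \bigcup_b \bigcup_c \bigcup_d D a b c d.
  apply/seteqP; split => [[x y] Axy|z [a _ [b _ [c _ [d _]]]]]; last first.
    by rewrite /D; case: ifPn => // /asboolP; apply.
  have /nbhs_ballP[e /= e0 eA] : nbhs (x, y) A by exact: open_nbhs_nbhs.
  have [xl xr] : x - e < x /\ x < x + e by split; lra.
  have [yl yr] : y - e < y /\ y < y + e by split; lra.
  have [a] := rat_in_itvoo xl; have [b] := rat_in_itvoo xr.
  have [c] := rat_in_itvoo yl; have [d] := rat_in_itvoo yr.
  rewrite !in_itv/= => /andP[d1 d2] /andP[c1 c2] /andP[b1 b2] /andP[a1 a2].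
  exists a => //; exists b => //; exists c => //; exists d => //.
  rewrite /D ifT; first by split => /=; rewrite in_itv/=; apply/andP.
  apply/asboolP => -[x' y'] [/=]; rewrite !in_itv/= => /andP[x1 x2] /andP[y1 y2].
  by apply: eA; split => /=; rewrite /ball/= ltr_norml; apply/andP; split; lra.
apply: bigcupT_measurable_rat => a; apply: bigcupT_measurable_rat => b.
apply: bigcupT_measurable_rat => c; apply: bigcupT_measurable_rat => d.
rewrite /D; case: ifP => // _; apply: measurableX; exact: measurable_itv.
Qed.

Lemma continuous_measurable_plane (f : R * R -> R) : continuous f -> measurable_fun setT f.
Proof.
move=> cf; apply: (measurability _ (RGenOInfty.measurableE R)) => _ [_ [a ->] <-].
rewrite setTI; apply: open_measurable_plane.
by apply: open_comp => //; exact: interval_open.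
Qed.

Lemma continuous_measurable_state (f : state R -> R) :
  (forall i, continuous (fun w => f (i, w))) -> measurable_fun setT f.
Proof.
move=> cf; rewrite (_ : f = fun z => if z.1 then f (true, z.2) else f (false, z.2)); last first.
  by apply/funext => -[[] w].
have m i : measurable_fun setT (fun z : state R => f (i, z.2)).
  exact: (measurableT_comp (continuous_measurable_plane (cf i)) measurable_snd).
by apply: measurable_fun_ifT => //; exact: measurable_fst.
Qed.

Lemma lipschitz_continuous_plane (K : R) (f : R * R -> R) : 0 <= K ->
  (forall w v, `|f w - f v| <= K * norm1 (w - v)) -> continuous f.
Proof.
move=> K0 fK w; apply/cvgrPdist_lt => e e0.
have K1 : 0 < 2 * K + 1 by lra.
have : nbhs w (ball w (e / (2 * K + 1))) by apply: nbhsx_ballx; exact: divr_gt0.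
apply: filterS => v [/= b1 b2]; rewrite /ball/= in b1 b2.
apply: (le_lt_trans (fK w v)).
apply: (@le_lt_trans _ _ (K * (e / (2 * K + 1) + e / (2 * K + 1)))).
  by rewrite ler_wpM2l// /norm1 lerD// ltW.
have -> : K * (e / (2 * K + 1) + e / (2 * K + 1)) = e * (2 * K) / (2 * K + 1) by ring.
by rewrite ltr_pdivrMr// ltr_pM2l//; lra.
Qed.

End PlaneTopology.

Section TestFunctions.
Context (R : realType).
Implicit Types f g : state R -> R.

Definition lip_test (K : R) f := 0 <= K /\
  forall i w v, `|f (i, w) - f (i, v)| <= K * norm1 (w - v).

Definition test f := (exists M : R, forall z, `|f z| <= M) /\ exists K, lip_test K f.

Lemma test_measurable f : test f -> measurable_fun setT f.
Proof.
move=> [_ [K [K0 fK]]]; apply: continuous_measurable_state => i.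
by apply: lipschitz_continuous_plane K0 _ => w v; exact: fK.
Qed.

Lemma test_bmeas f : test f -> bmeas f.
Proof. by move=> tf; split; [exact: test_measurable|case: tf]. Qed.

(** A 1-Lipschitz retraction onto the state space. Expectations are controlled for starting points
    there only; composing with [clip] extends them to test functions on the whole product. *)
Definition clip (z : state R) : state R := (z.1, (Num.max 0 z.2.1, Num.max 0 z.2.2)).

Lemma clip_states z : states R (clip z).
Proof. by split; rewrite /= le_max lexx. Qed.

Lemma clip_id z : states R z -> clip z = z.
Proof. by case: z => i [x y] [/= x0 y0]; rewrite /clip/= !max0r. Qed.

Lemma max0_lipschitz (x y : R) : `|Num.max 0 x - Num.max 0 y| <= `|x - y|.
Proof.
have [x0|x0] := leP 0 x; have [y0|y0] := leP 0 y => //.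
- by rewrite subr0 !ger0_norm; lra.
- by rewrite sub0r normrN ger0_norm// ler0_norm; lra.
- by rewrite subrr normr0.
Qed.

Lemma norm1_clip i w v : norm1 ((clip (i, w)).2 - (clip (i, v)).2) <= norm1 (w - v).
Proof. by rewrite /norm1 lerD// max0_lipschitz. Qed.

End TestFunctions.

(** * Lipschitz functions separate measures *)

Section Quadrants.
Context (R : realType).
Implicit Types (f : state R -> R) (i : bool) (a b : R).

Definition quadrant i a b : set (state R) :=
  [set z | [/\ z.1 = i, z.2.1 <= a & z.2.2 <= b]].

Definition quadrants : set (set (state R)) :=
  [set A | A = set0 \/ exists i a b, A = quadrant i a b].

Lemma quadrantsI : setI_closed quadrants.
Proof.
move=> A A' [->|[i [a [b ->]]]]; first by rewrite set0I; left.
move=> [->|[i' [a' [b' ->]]]]; first by rewrite setI0; left.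
have [<-|ii'] := eqVneq i i'.
  right; exists i, (Num.min a a'), (Num.min b b'); apply/seteqP; split => z /=.
    by move=> [[zi x1 y1] [_ x2 y2]]; split => //; rewrite le_min ?x1 ?y1.
  by rewrite /quadrant/= !le_min => -[zi /andP[x1 x2] /andP[y1 y2]].
left; apply/seteqP; split => // z [[/= zi _ _] [/= zi' _ _]].
by move: ii'; rewrite -zi -zi' eqxx.
Qed.

Lemma quadrant_measurable i a b : measurable (quadrant i a b).
Proof.
rewrite (_ : quadrant i a b = [set i] `*` (`]-oo, a]%classic `*` `]-oo, b]%classic)).
  by apply: measurableX => //; apply: measurableX; exact: measurable_itv.
by apply/seteqP; split => z /=; rewrite !in_itv/=; [case|case=> ? []].
Qed.

Lemma measurable_quadrants : @measurable _ (state R) = <<s quadrants >>.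
Proof.
apply/seteqP; split; last first.
  apply: smallest_sub; first exact: sigma_algebra_measurable.
  by move=> _ [->//|[i [a [b ->]]]]; exact: quadrant_measurable.
pose U := g_sigma_algebraType quadrants.
have mq i a b : measurable (quadrant i a b : set U).
  by apply: sub_sigma_algebra; right; exists i, a, b.
have m1 : measurable_fun (setT : set U) (fun z : state R => z.1).
  apply: (@measurable_fun_bool _ _ _ _ true); rewrite setTI.
  rewrite (_ : _ @^-1` _ = \bigcup_n quadrant true n%:R n%:R).
    exact: bigcupT_measurable.
  apply/seteqP; split => [z /= zt|z [n _ []]//].
  exists (Num.bound (`|z.2.1| + `|z.2.2|)) => //.
  have := archi_boundP (addr_ge0 (normr_ge0 z.2.1) (normr_ge0 z.2.2)).
  have := ler_norm z.2.1; have := ler_norm z.2.2.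
  have := normr_ge0 z.2.1; have := normr_ge0 z.2.2.
  by move: (_%:R : R) => ?; split => //; lra.
have coord (p : R * R -> R) (q : bool -> R -> nat -> set (state R)) :
    (forall i a n, measurable (q i a n : set U)) ->
    (forall z a, p z.2 <= a <-> exists n, q z.1 a n z) ->
    (forall i a n z, q i a n z -> z.1 = i) ->
    measurable_fun (setT : set U) (fun z : state R => p z.2).
  move=> qm pE qi; apply: (measurability _ (RGenOInfty.measurableE R)) => _ [_ [a ->] <-].
  rewrite setTI (_ : _ @^-1` _ = ~` (\bigcup_n (q true a n `|` q false a n))).
    by apply: measurableC; apply: bigcupT_measurable => n; exact: measurableU.
  apply/seteqP; split => z /=; rewrite in_itv/= andbT.
    move=> az [n _ qz]; move: az; rewrite ltNge => /negP; apply; apply/pE; exists n.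
    by case: qz => /[dup] /qi ->.
  move=> nq; rewrite ltNge; apply/negP => /pE[n qz]; apply: nq; exists n => //.
  by move: qz; case: (z.1); [left|right].
have bnd (x : R) : exists n : nat, x <= n%:R.
  by exists (Num.bound x); rewrite (le_trans (ler_norm x))// ltW// /Num.bound truncnS_gt.
have m21 : measurable_fun (setT : set U) (fun z : state R => z.2.1).
  apply: (coord fst (fun i a n => quadrant i a n%:R)) => //.
    move=> z a; split => [za|[n []]//]; have [n zn] := bnd z.2.2.
    by exists n.
  by move=> i a n z [].
have m22 : measurable_fun (setT : set U) (fun z : state R => z.2.2).
  apply: (coord snd (fun i a n => quadrant i n%:R a)) => //.
    move=> z a; split => [za|[n []]//]; have [n zn] := bnd z.2.1.
    by exists n.
  by move=> i a n z [].
have m : measurable_fun (setT : set U) (fun z : state R => (z.1, (z.2.1, z.2.2))).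
  by apply: measurable_fun_pair => //; exact: measurable_fun_pair.
move=> A mA; have := m measurableT A mA; rewrite setTI.
by congr (<<s _ >> _); apply/funext => -[? []].
Qed.

Definition ramp (x : R) := Num.max 0 (1 - Num.max 0 x).

Lemma ramp_01 x : 0 <= ramp x <= 1.
Proof. by rewrite le_max lexx/= ge_max ler01/= gerBl le_max lexx. Qed.

Lemma ramp_lipschitz x y : `|ramp x - ramp y| <= `|x - y|.
Proof.
apply: (le_trans (max0_lipschitz _ _)).
rewrite [X in `|X|](_ : _ = Num.max 0 y - Num.max 0 x); last by ring.
by apply: (le_trans (max0_lipschitz _ _)); rewrite distrC.
Qed.

(** Lipschitz approximation of the indicator of a quadrant, equal to 1 on it and cut off within
    distance [1 / k] in each coordinate. *)
Definition quad_test i a b (k : nat) (z : state R) : R :=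
  if z.1 == i then ramp (k%:R * (z.2.1 - a)) * ramp (k%:R * (z.2.2 - b)) else 0.

Lemma quad_test_01 i a b k z : 0 <= quad_test i a b k z <= 1.
Proof.
rewrite /quad_test; case: ifP => _; last by rewrite lexx ler01.
have /andP[x0 x1] := ramp_01 (k%:R * (z.2.1 - a)).
by have /andP[y0 y1] := ramp_01 (k%:R * (z.2.2 - b)); rewrite mulr_ge0//= mulr_ile1.
Qed.

Lemma quad_test_test i a b k : test (quad_test i a b k).
Proof.
split.
  by exists 1 => z; have /andP[h0 h1] := quad_test_01 i a b k z; rewrite ger0_norm.
exists k%:R; split => // j w v; rewrite /quad_test/=; case: ifP => _; last first.
  by rewrite subrr normr0 mulr_ge0// norm1_ge0.
rewrite /norm1/= [leRHS]mulrDr.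
have h1 := ramp_lipschitz (k%:R * (w.1 - a)) (k%:R * (v.1 - a)).
have h2 := ramp_lipschitz (k%:R * (w.2 - b)) (k%:R * (v.2 - b)).
have kE (x y c : R) : `|k%:R * (x - c) - k%:R * (y - c)| = k%:R * `|x - y|.
  by rewrite -mulrBr normrM ger0_norm//; congr (_ * `|_|); ring.
rewrite kE in h1; rewrite kE in h2.
have /andP[x0 x1] := ramp_01 (k%:R * (w.1 - a)).
have /andP[y0 y1] := ramp_01 (k%:R * (v.2 - b)).
move: h1 h2 x0 x1 y0 y1.
set x := ramp (k%:R * (w.1 - a)); set y := ramp (k%:R * (w.2 - b)).
set x' := ramp (k%:R * (v.1 - a)); set y' := ramp (k%:R * (v.2 - b)).
move=> h1 h2 x0 x1 y0 y1.
have -> : x * y - x' * y' = x * (y - y') + (x - x') * y' by ring.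
apply: (le_trans (ler_normD _ _)); rewrite addrC !normrM (ger0_norm x0) (ger0_norm y0).
apply: lerD.
  by apply: le_trans h1; rewrite ler_piMr.
by apply: le_trans h2; rewrite ler_piMl.
Qed.

Lemma ramp_cvg (x : R) : ramp (k%:R * x) @[k --> \oo] --> ((x <= 0)%R%:R : R).
Proof.
have [x0|x0] := leP x 0.
  rewrite [X in X @ _](_ : _ = fun=> 1); first exact: cvg_cst.
  apply/funext => k; have e : Num.max 0 (k%:R * x) = 0 by apply: max_l; rewrite mulr_ge0_le0.
  by rewrite /ramp e subr0 max0r.
apply: (@cvg_trans _ ((fun=> 0 : R) @ \oo)); last exact: cvg_cst.
apply: near_eq_cvg; exists (Num.bound x^-1) => // k /= xk.
have x1 : 1 <= k%:R * x.
  rewrite -ler_pdivrMr// div1r; apply: (@le_trans _ _ (Num.bound x^-1)%:R).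
    by rewrite ltW// archi_boundP// ltW// invr_gt0.
  by rewrite ler_nat.
rewrite /ramp (@max0r _ (k%:R * x)); last exact: le_trans x1.
by rewrite max_l// subr_le0.
Qed.

Lemma quad_test_cvg i a b z :
  quad_test i a b k z @[k --> \oo] --> (\1_(quadrant i a b) z : R).
Proof.
rewrite indicE /quad_test.
have -> : (z \in quadrant i a b) = [&& z.1 == i, z.2.1 <= a & z.2.2 <= b].
  apply/idP/idP; rewrite inE /quadrant/=; first by case=> -> -> ->; rewrite eqxx.
  by case/and3P => /eqP.
case: (z.1 == i) => /=; last exact: cvg_cst.
have -> : (z.2.1 <= a) = (z.2.1 - a <= 0) by rewrite subr_le0.
have -> : (z.2.2 <= b) = (z.2.2 - b <= 0) by rewrite subr_le0.
rewrite -mulnb natrM.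
by apply: cvgM; exact: ramp_cvg.
Qed.

Lemma integral_quad_test (m : {measure set (state R) -> \bar R}) i a b :
  (m setT < +oo)%E ->
  (\int[m]_z (quad_test i a b k z)%:E)%E @[k --> \oo] --> m (quadrant i a b).
Proof.
move=> mfin.
have -> : m (quadrant i a b) = (\int[m]_z (\1_(quadrant i a b) z)%:E)%E.
  by rewrite integral_indic ?setIT//; exact: quadrant_measurable.
apply: (@dominated_cvg _ _ _ m setT measurableT (fun k z => (quad_test i a b k z)%:E)
   (fun z => (\1_(quadrant i a b) z)%:E) (fun=> 1%E)) => //.
- move=> k; apply/measurable_EFinP; apply: test_measurable; exact: quad_test_test.
- by move=> z _; apply: cvg_EFin; [exact: nearW|exact: quad_test_cvg].
- apply/integrableP; split; first exact: measurable_cst.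
  by under eq_integral do rewrite abse1; rewrite integral_cst// mul1e.
- move=> k z _; have /andP[h0 h1] := quad_test_01 i a b k z.
  by rewrite /= lee_fin ger0_norm.
Qed.

Lemma giry_setC d (U : measurableType d) (m : giry U R) (S : set U) : m setT = 1%E ->
  measurable S -> m (~` S) = (1 - m S)%E.
Proof.
move=> m1 mS; have fm : (m setT < +oo)%E by exact: (le_lt_trans (@sprobability_setT _ _ _ m) (ltry 1)).
have := measureD measurableT mS fm; rewrite setTD setTI => ->.
by congr (_ - _)%E.
Qed.

(** Test functions reach the masses of quadrants by dominated convergence, and quadrants form a
    generating pi-system. The type [giry] covers the laws built by [giry_bind], whose total mass is
    known by proof only. *)
Lemma measure_eq_test (m1 m2 : giry (state R) R) : m1 setT = 1%E -> m2 setT = 1%E ->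
  (forall f, test f -> (forall z, 0 <= f z) ->
     (\int[m1]_z (f z)%:E)%E = (\int[m2]_z (f z)%:E)%E) ->
  forall A, measurable A -> m1 A = m2 A.
Proof.
move=> m11 m21 m12 A mA.
have fin1 (B : set (state R)) : measurable B -> m1 B \is a fin_num.
  move=> mB; rewrite ge0_fin_numE//; apply: (@le_lt_trans _ _ (m1 setT)).
    by apply: le_measure; rewrite ?inE.
  by rewrite m11 ltry.
apply: (@dynkin_induction _ _ quadrants (fun A => m1 A = m2 A) measurable_quadrants quadrantsI) => //.
- by rewrite m11 m21.
- move=> _ [->|[i [a [b ->]]]]; first by rewrite !measure0.
  have l1 := @integral_quad_test m1 i a b (le_lt_trans (@sprobability_setT _ _ _ m1) (ltry 1)).
  have l2 := @integral_quad_test m2 i a b (le_lt_trans (@sprobability_setT _ _ _ m2) (ltry 1)).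
  have e k : (\int[m1]_z (quad_test i a b k z)%:E)%E = (\int[m2]_z (quad_test i a b k z)%:E)%E.
    by apply: m12 => [|z]; [exact: quad_test_test|have /andP[] := quad_test_01 i a b k z].
  move: l1; under eq_fun do rewrite e; move=> l1.
  exact: (cvg_unique _ l1 l2).
- by move=> S mS e; rewrite !giry_setC// e.
- move=> G mG tG e; have mU := bigcupT_measurable _ mG.
  have h1 := measure_semi_bigcup m1 mG tG mU; have h2 := measure_semi_bigcup m2 mG tG mU.
  rewrite -[LHS]/((m1 : {measure set _ -> \bar R}) _) -[RHS]/((m2 : {measure set _ -> \bar R}) _).
  by rewrite h1 h2; apply: eq_eseriesr => k _; exact: e.
- by rewrite -measurable_quadrants.
Qed.

(** Dependence on the starting point is known to be measurable only for expectations of test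
    functions; a Dynkin argument extends it to all events. *)
Lemma kernel_measurable_test d (U : measurableType d) (k : U -> giry (state R) R) :
  (forall x, k x setT = 1%E) ->
  (forall f, test f -> (forall z, 0 <= f z) ->
     measurable_fun setT (fun x => \int[k x]_z (f z)%:E)%E) ->
  measurable_fun setT k.
Proof.
move=> k1 mk; apply: measurable_giry_codensity => // A mA.
apply: (@dynkin_induction _ _ quadrants (fun A => measurable_fun setT (fun x => k x A))
   measurable_quadrants quadrantsI) => //.
- by under eq_fun do rewrite k1; exact: measurable_cst.
- move=> _ [->|[i [a [b ->]]]].
    by under eq_fun do rewrite measure0; exact: measurable_cst.
  apply: (@emeasurable_fun_cvg _ _ _ _ (fun n x => \int[k x]_z (quad_test i a b n z)%:E)%E).
    move=> n; apply: mk; first exact: quad_test_test.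
    by move=> z; have /andP[] := quad_test_01 i a b n z.
  by move=> x _; apply: integral_quad_test; exact: (le_lt_trans (@sprobability_setT _ _ _ (k x)) (ltry 1)).
- move=> S mS mkS.
  have e x : k x (~` S) = (1 - k x S)%E by rewrite giry_setC.
  by under eq_fun do rewrite e; apply: emeasurable_funB => //; exact: measurable_cst.
- move=> G mG tG mkG.
  have e x : k x (\bigcup_n G n) = (\sum_(n <oo) k x (G n))%E.
    exact: (measure_semi_bigcup (k x) mG tG (bigcupT_measurable _ mG)).
  under eq_fun do rewrite e.
  by apply: ge0_emeasurable_sum => // n *.
- by rewrite -measurable_quadrants.
Qed.

End Quadrants.

(** * Limit points of laws on a bounded cell *)

Section UltrafilterLimit.
Context (R : realType) (U : set_system nat) (UU : UltraFilter U).

Lemma ultra_cvg (a : nat -> R) : (forall n, 0 <= a n <= 1) -> exists l : R, a n @[n --> U] --> l.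
Proof.
move=> a01; have PU : ProperFilter U by apply: ultra_proper.
have cK : compact `[(0 : R), 1]%classic by exact: segment_compact.
have aK : (a @ U) `[(0 : R), 1]%classic.
  by apply: (@filterS _ U _ setT); [move=> n _ /=; rewrite in_itv/=|exact: filterT].
have [l [_ cl]] := cK (a @ U) _ aK.
exists l; apply/cvgrPdist_lt => e e0.
have [//|nU] := in_ultra_setVsetC [set n | `|l - a n| < e] UU.
have nb : (a @ U) (~` ball l e) by exact: nU.
by have [x [/= nx bx]] := cl _ _ nb (nbhsx_ballx l e e0).
Qed.

End UltrafilterLimit.

Section Words.
Context (R : realType) (d : measure_display) (Om : measurableType d) (Q : probability Om R).

Fixpoint words (k : nat) : seq (seq bool) :=
  if k is k'.+1 then map (cons true) (words k') ++ map (cons false) (words k') else [:: [::]].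

Lemma words_uniq k : uniq (words k).
Proof.
elim: k => //= k IH; rewrite cat_uniq !map_inj_uniq ?IH//=; try by move=> s t [].
by rewrite andbT; apply/hasPn => _ /mapP[s _ ->]; apply/mapP => -[t _ []].
Qed.

Lemma mem_words k s : (s \in words k) = (size s == k).
Proof.
elim: k s => [|k IH] [|b s] //=.
  by rewrite mem_cat; apply/negP => /orP[] /mapP[].
rewrite mem_cat eqSS -IH; case: b.
  rewrite mem_map; last by move=> s' t [].
  by rewrite orbC; case: mapP => // -[t _ []].
rewrite orbC mem_map; last by move=> s' t [].
by rewrite orbC; case: mapP => // -[t _ []].
Qed.

Lemma word_sum k (F : seq bool -> R) (V : Om -> seq bool) w : size (V w) = k ->
  F (V w) = \sum_(s <- words k) F s * \1_(V @^-1` [set s]) w.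
Proof.
move=> sV; rewrite (bigD1_seq (V w)) ?words_uniq ?mem_words ?sV//=.
rewrite indic_in// mulr1 big1_seq ?addr0// => s /andP[sV' _].
by rewrite indic_out ?mulr0//= => e; rewrite e eqxx in sV'.
Qed.

Lemma Ex_words k (F : seq bool -> R) (V : Om -> seq bool) :
  (forall w, size (V w) = k) -> (forall s, measurable (V @^-1` [set s])) ->
  Ex Q (fun w => F (V w)) = \sum_(s <- words k) F s * fine (Q (V @^-1` [set s])).
Proof.
move=> sV mV; under eq_fun do rewrite (word_sum _ (sV _)).
rewrite Ex_sum; last by move=> s; apply: bmeasZ; exact: bmeas_indic.
by apply: eq_bigr => s _; rewrite ExZ ?Ex_indic//; exact: bmeas_indic.
Qed.

Lemma measurable_words k (F : seq bool -> R) (V : Om -> seq bool) :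
  (forall w, size (V w) = k) -> (forall s, measurable (V @^-1` [set s])) ->
  measurable_fun setT (fun w => F (V w)).
Proof.
move=> sV mV; under eq_fun do rewrite (word_sum _ (sV _)).
suff : bmeas (fun w => \sum_(s <- words k) F s * \1_(V @^-1` [set s]) w) by case.
by apply: bmeas_sum => s; apply: bmeasZ; exact: bmeas_indic.
Qed.

End Words.

(* Words list the most recent bit first. *)
Section Splitting.
Context (R : realType) (p : seq bool -> R).
Hypotheses (p_nil : p [::] = 1) (p_ge0 : forall s, 0 <= p s).
Hypothesis p_cons : forall s, p s = p (false :: s) + p (true :: s).

(** [[0, 1[] is cut into intervals of lengths [p s], each split again by the next bit with the
    [false] part on the left; [word k u] is the address of [u] at depth [k]. *)
Fixpoint left_end (s : seq bool) : R :=
  if s is b :: s' then left_end s' + (if b then p (false :: s') else 0) else 0.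

Fixpoint word (k : nat) (u : R) : seq bool :=
  if k is k'.+1 then let s := word k' u in (left_end s + p (false :: s) <= u) :: s else [::].

Lemma size_word k u : size (word k u) = k.
Proof. by elim: k => //= k ->. Qed.

Lemma wordE k s u : 0 <= u < 1 -> size s = k ->
  (word k u == s) = (left_end s <= u < left_end s + p s).
Proof.
move=> u01; elim: k s => [|k IH] [|b s] //=; first by rewrite p_nil add0r u01.
move=> [sk]; rewrite eqseq_cons.
have p0 := p_ge0 (false :: s); have p1 := p_ge0 (true :: s); have pE := p_cons s.
have := IH s sk; case: eqP => [->|_] => e; last first.
  rewrite andbF; apply/esym/negP => /andP[h1 h2]; move/esym/negP: e; apply.
  by apply/andP; split; case: b h1 h2 => /= h1 h2; lra.
move/esym/andP: e => [h1 h2]; rewrite andbT.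
case: b => /=.
  rewrite eqb_id; apply/idP/idP => [h3|/andP[]//].
  by apply/andP; split; lra.
rewrite addr0 eqbF_neg -ltNge; apply/idP/idP => [h3|/andP[]//].
by apply/andP; split; lra.
Qed.

Lemma word_measurable k s : measurable (word k @^-1` [set s]).
Proof.
elim: k s => [|k IH] s.
  have [->|ns] := eqVneq s [::].
    by rewrite (_ : _ @^-1` _ = setT)//; apply/seteqP; split.
  rewrite (_ : _ @^-1` _ = set0)//; apply/seteqP; split => // u /= e.
  by rewrite -e in ns.
case: s => [|b s].
  by rewrite (_ : _ @^-1` _ = set0)//; apply/seteqP; split.
rewrite (_ : _ @^-1` _ = word k @^-1` [set s] `&`
   [set u | (left_end s + p (false :: s) <= u) = b]).
  apply: measurableI => //; case: b.
    rewrite (_ : [set u | _] = `[left_end s + p (false :: s), +oo[%classic).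
      exact: measurable_itv.
    by apply/seteqP; split => u /=; rewrite in_itv/= andbT.
  rewrite (_ : [set u | _] = `]-oo, left_end s + p (false :: s)[%classic).
    exact: measurable_itv.
  by apply/seteqP; split => u /=; rewrite in_itv/= ltNge; [move=> ->|case: (_ <= _)].
by apply/seteqP; split => u /=; [move=> [<- ->]|move=> [-> <-]].
Qed.

Lemma left_end_ge0 s : 0 <= left_end s.
Proof. by elim: s => //= b s IH; case: b; rewrite ?addr0// addr_ge0. Qed.

Lemma right_end_le1 s : left_end s + p s <= 1.
Proof.
elim: s => [|b s IH] /=; first by rewrite p_nil add0r.
have p0 := p_ge0 (false :: s); have p1 := p_ge0 (true :: s); have pE := p_cons s.
by case: b; lra.
Qed.

Lemma uniform_word k s : size s = k ->
  uniform_prob (@ltr01 R) (word k @^-1` [set s]) = (p s)%:E.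
Proof.
move=> sk; have mW := word_measurable k s.
transitivity (\int[uniform_prob (@ltr01 R)]_u (\1_(word k @^-1` [set s]) u)%:E)%E.
  by rewrite integral_indic// setIT.
rewrite integral_uniform//; last by apply/measurable_EFinP; exact: measurable_indic.
(* The endpoint 1 is outside the scope of [wordE]; it carries no mass. *)
rewrite subr0 invr1 mul1e -integral_itv_bndo_bndc//; last first.
  by apply: measurable_funTS; apply/measurable_EFinP; exact: measurable_indic.
rewrite integral_indic//.
have l0 := left_end_ge0 s; have r1 := right_end_le1 s.
rewrite (_ : _ `&` _ = `[left_end s, left_end s + p s[%classic); last first.
  apply/seteqP; split => u /=; rewrite !in_itv/=.
    by move=> [/eqP + u01]; rewrite wordE.
  move=> h; have u01 : 0 <= u < 1 by case/andP: h => h1 h2; apply/andP; split; lra.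
  by split => //; apply/eqP; rewrite wordE.
transitivity (lebesgue_measure `[left_end s, left_end s + p s[%classic); first by [].
rewrite lebesgue_measure_itv/= lte_fin ltrDl -EFinD (addrC (left_end s)) addrK.
by case: ltP (p_ge0 s) => // ps0 ps1; congr (_%:E); apply/eqP; rewrite eq_le ps1 ps0.
Qed.

End Splitting.

(** * Dyadic addresses of states *)

Section Encoding.
Context (R : realType) (M : R).
Hypothesis M_gt0 : 0 < M.
Implicit Types (s : seq bool) (z : state R).

Definition half (k : nat) : R := 2^-1 ^+ k.

Lemma half_gt0 k : 0 < half k. Proof. by rewrite exprn_gt0 ?invr_gt0. Qed.

Lemma halfS k : half k = half k.+1 + half k.+1.
Proof. by rewrite /half exprS; field. Qed.

(* The first bit is the plane, then the binary digits of the two rescaled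
   coordinates alternate. *)
Fixpoint xs s : R :=
  if s is b :: s' then xs s' + (if odd (size s') && b then half (size s')./2.+1 else 0) else 0.

Fixpoint ys s : R :=
  if s is b :: s' then ys s' + (if [&& ~~ odd (size s'), (0 < size s')%N & b]
    then half (size s')./2 else 0) else 0.

Definition bit s z : bool :=
  if odd (size s) then xs s + half (size s)./2.+1 <= z.2.1 / M
  else if size s == 0 then z.1
  else ys s + half (size s)./2 <= z.2.2 / M.

Fixpoint code k z : seq bool :=
  if k is k'.+1 then let s := code k' z in bit s z :: s else [::].

Definition decode s : state R := (last false s, (M * xs s, M * ys s)).

Lemma size_code k z : size (code k z) = k.
Proof. by elim: k => //= k ->. Qed.

(** The dyadic intervals are nested: left ends increase and right ends decrease. This holds for
    arbitrary words, not only for the codes of points. *)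
Lemma xs_cons b s : xs s <= xs (b :: s) /\
  xs (b :: s) + half (size s).+1./2 <= xs s + half (size s)./2.
Proof.
have h1 := half_gt0 (size s)./2.+1; have hS := halfS (size s)./2.
rewrite /= uphalf_half; case: (odd (size s)) => /=; last by rewrite addr0 add0n.
by rewrite add1n; case: b => /=; lra.
Qed.

Lemma ys_cons b s : ys s <= ys (b :: s) /\
  ys (b :: s) + half (size s)./2 <= ys s + half (size s).-1./2.
Proof.
case: s => [|c s] /=; first by rewrite addr0.
have h1 := half_gt0 (size s)./2.+1; have hS := halfS (size s)./2.
rewrite uphalf_half; case: (odd (size s)) => /=; last by rewrite addr0 add0n.
by rewrite add1n; case: b => /=; lra.
Qed.

Lemma bit_x s z : xs s <= z.2.1 / M < xs s + half (size s)./2 ->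
  xs (bit s z :: s) <= z.2.1 / M < xs (bit s z :: s) + half (size s).+1./2.
Proof.
move=> /andP[h1 h2]; have hS := halfS (size s)./2.
rewrite /= uphalf_half /bit; case: (odd (size s)) => /=.
  by rewrite add1n; case: (leP (xs s + half (size s)./2.+1) _) => h /=; apply/andP; split; lra.
by rewrite addr0 add0n h1.
Qed.

Lemma bit_y s z : ys s <= z.2.2 / M < ys s + half (size s).-1./2 ->
  ys (bit s z :: s) <= z.2.2 / M < ys (bit s z :: s) + half (size s)./2.
Proof.
case n0 : (size s) => [|n]; first by rewrite /= n0 /= addr0.
rewrite /bit [_.+1.-1]/= => /andP[h1 h2]; have hS := halfS n./2.
rewrite [ys (_ :: s)]/= n0 /= uphalf_half; case: (odd n) => /=.
  by rewrite add1n; case: (leP (ys s + half n./2.+1) _) => h /=; apply/andP; split; lra.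
by rewrite addr0 add0n h1.
Qed.

Definition cell : set (state R) := [set z | 0 <= z.2.1 < M /\ 0 <= z.2.2 < M].

Lemma code_xy k z : cell z ->
  xs (code k z) <= z.2.1 / M < xs (code k z) + half k./2 /\
  ys (code k z) <= z.2.2 / M < ys (code k z) + half k.-1./2.
Proof.
move=> [/andP[x0 xM] /andP[y0 yM]]; elim: k => [|k [IHx IHy]].
  rewrite /= /half expr0 add0r !divr_ge0 ?(ltW M_gt0)//=.
  by rewrite !ltr_pdivrMr// mul1r xM yM.
split.
  by have := @bit_x (code k z) z; rewrite !size_code; exact.
by have := @bit_y (code k z) z; rewrite !size_code; exact.
Qed.

Lemma last_code k z : last false (code k.+1 z) = z.1.
Proof. by elim: k => //= k <-. Qed.

Lemma measurable_code k s : measurable [set z | code k z = s].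
Proof.
elim: k s => [|k IH] [|b s] /=.
- by rewrite (_ : [set _ | _] = setT)//; apply/seteqP; split.
- by rewrite (_ : [set _ | _] = set0)//; apply/seteqP; split.
- by rewrite (_ : [set _ | _] = set0)//; apply/seteqP; split.
rewrite (_ : [set _ | _] = [set z | code k z = s] `&` (bit s @^-1` [set b])); last first.
  by apply/seteqP; split => z /=; [case=> <- <-|case=> -> <-].
apply: measurableI; first exact: IH.
have mb : measurable_fun setT (bit s).
  have mc c : measurable_fun setT (fun z : state R => (c : R)) by exact: measurable_cst.
  have mx : measurable_fun setT (fun z : state R => z.2.1 / M).
    apply: measurable_funM => //; exact: measurableT_comp.
  have my : measurable_fun setT (fun z : state R => z.2.2 / M).
    apply: measurable_funM => //; exact: measurableT_comp.
  rewrite /bit; case: (odd (size s)).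
    by apply: measurable_fun_ler => //; exact: mc.
  case: (size s == 0); first exact: measurable_fst.
  by apply: measurable_fun_ler => //; exact: mc.
by rewrite -[X in measurable X]setTI; exact: mb.
Qed.

Lemma code_near K (f : state R -> R) k z : lip_test K f -> cell z -> (0 < k)%N ->
  `|f (decode (code k z)) - f z| <= K * (2 * M * half k.-1./2).
Proof.
case: k => // k [K0 fK] zc _; have [] := code_xy k.+1 zc; have := last_code k z.
rewrite /decode; move: (code k.+1 z) => s ->; case: z {zc} => i [x y] /=.
move: (xs s) (ys s) => a b.
have xE : x = M * (x / M) by rewrite mulrC divfK// gt_eqF.
have yE : y = M * (y / M) by rewrite mulrC divfK// gt_eqF.
move=> /andP[x1 x2] /andP[y1 y2]; apply: (le_trans (fK _ _ _)).
apply: ler_wpM2l => //; rewrite /norm1 /= {1}xE {1}yE -!mulrBr !normrM gtr0_norm//.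
rewrite -mulrDr (mulrC 2) -mulrA ler_pM2l//.
have hk : half (uphalf k) <= half k./2.
  by rewrite uphalf_half; case: (odd k) => //=; rewrite add1n [leRHS]halfS lerDl ltW// half_gt0.
by rewrite (distrC a) (distrC b) !ger0_norm; lra.
Qed.

End Encoding.

Section NestedLimit.
Context (R : realType) (a b : nat -> R).
Hypotheses (a_nd : forall k, a k <= a k.+1) (b_ni : forall k, b k.+1 <= b k).
Hypothesis ab : forall k, a k <= b k.

Let abij i j : a i <= b j.
Proof.
have aD n m : a n <= a (n + m)%N.
  by elim: m => [|m IH]; rewrite ?addn0 ?addnS//; exact: (le_trans IH).
have bD n m : b (n + m)%N <= b n.
  by elim: m => [|m IH]; rewrite ?addn0 ?addnS//; exact: (le_trans (b_ni _)).
by apply: (le_trans (aD i j)); apply: (le_trans (ab _)); rewrite addnC; exact: bD.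
Qed.

Lemma nested_limit : cvgn a /\ forall k, a k <= limn a <= b k.
Proof.
have aP : nondecreasing_seq a by exact/nondecreasing_seqP.
have acv : cvgn a.
  by apply: nondecreasing_is_cvgn => //; exists (b 0%N) => _ [k _ <-]; exact: abij.
split => // k; rewrite nondecreasing_cvgn_le//=.
by apply: limr_le => //; apply: nearW => j; exact: abij.
Qed.

End NestedLimit.

Lemma image_law (R : realType) (d d' : measure_display) (Om : measurableType d)
    (S : measurableType d') (Q : probability Om R) (V : Om -> S) : measurable_fun setT V ->
  exists mu : probability S R, (forall A, mu A = Q (V @^-1` A)) /\
    forall f, bmeas f -> Ex mu f = Ex Q (fun w => f (V w)).
Proof.
move=> mV; pose V' : {mfun Om >-> S} := mfun_Sub (mem_set mV).
exists (distribution Q V'); split=> // f bf.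
have bV := bmeas_comp mV bf.
apply: EFin_inj; rewrite -!Ex_EFin// integral_pushforward//.
- by apply/measurable_EFinP; case: bf.
- exact: bmeas_integrable.
Qed.

(** * The limit law as an image of the uniform law *)

Section Cluster.
Context (R : realType) (M : R).
Hypothesis M_gt0 : 0 < M.
Variable p : seq bool -> R.

Let a u k : R := xs R (word p k u).
Let b u k : R := ys R (word p k u).

(** The limit of the corners of the cells addressed by the words of [u]. It may lie on the upper
    boundary of these cells, so [word p k u] need not be its code; only its distance to the decoded
    corner matters. *)
Definition limit_point (u : measurableTypeR R) : state R :=
  (last false (word p 1 u), (M * limn (a u), M * limn (b u))).

Let a_step u k : a u k <= a u k.+1 /\ a u k.+1 + half R k.+1./2 <= a u k + half R k./2.
Proof. by have := xs_cons R (head false (word p k.+1 u)) (word p k u); rewrite size_word. Qed.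

Let b_step u k : b u k <= b u k.+1 /\ b u k.+1 + half R k.+1.-1./2 <= b u k + half R k.-1./2.
Proof. by have := ys_cons R (head false (word p k.+1 u)) (word p k u); rewrite size_word. Qed.

Let half_ge k : 0 <= half R k. Proof. exact/ltW/half_gt0. Qed.

Let a_limit u : cvgn (a u) /\ forall k, a u k <= limn (a u) <= a u k + half R k./2.
Proof. by apply: nested_limit => k; [case: (a_step u k)..|rewrite lerDl]. Qed.

Let b_limit u : cvgn (b u) /\ forall k, b u k <= limn (b u) <= b u k + half R k.-1./2.
Proof. by apply: nested_limit => k; [case: (b_step u k)..|rewrite lerDl]. Qed.

Lemma limit_point_box u : 0 <= (limit_point u).2.1 <= M /\ 0 <= (limit_point u).2.2 <= M.
Proof.
have := (a_limit u).2 0; have := (b_limit u).2 0; rewrite /a /b /half /= expr0 !add0r.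
by move=> /andP[y0 y1] /andP[x0 x1]; rewrite !mulr_ge0 ?(ltW M_gt0)//= !ler_piMr// ltW.
Qed.

Let last_word k u : last false (word p k.+1 u) = last false (word p 1 u).
Proof. by elim: k => // k <- /=. Qed.

Lemma word_near K (f : state R -> R) k u : lip_test K f -> (0 < k)%N ->
  `|f (decode M (word p k u)) - f (limit_point u)| <= K * (2 * M * half R k.-1./2).
Proof.
case: k => // k [K0 fK] _; have := (a_limit u).2 k.+1; have := (b_limit u).2 k.+1.
rewrite /limit_point /decode last_word /a /b.
move: (limn _) (limn _) (xs _ _) (ys _ _) => x y a' b'.
rewrite [_.+1.-1]/= => /andP[y1 y2] /andP[x1 x2].
apply: (le_trans (fK _ _ _)); apply: ler_wpM2l => //.
rewrite /norm1 -[(_ - _).1]/(M * a' - M * x) -[(_ - _).2]/(M * b' - M * y).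
rewrite -!mulrBr !normrM gtr0_norm// -mulrDr (mulrC 2) -mulrA ler_pM2l//.
have hk : half R k.+1./2 <= half R k./2.
  by rewrite /= uphalf_half; case: (odd k) => //=; rewrite add1n [leRHS]halfS lerDl.
by rewrite (distrC a') (distrC b') !ger0_norm; lra.
Qed.

Lemma measurable_limit_point : measurable_fun setT limit_point.
Proof.
have mw (F : seq bool -> R) k : measurable_fun setT (fun u : measurableTypeR R => F (word p k u)).
  by apply: (measurable_words (k := k)) => [u|s]; [exact: size_word|exact: word_measurable].
apply/measurable_fun_pairP; split.
  have mb : measurable_fun setT (fun u : measurableTypeR R => (1 <= (last false (word p 1 u))%:R :> R)).
    apply: measurable_fun_ler; first exact: measurable_cst.
    exact: (mw (fun s => (last false s)%:R)).
  apply: eq_measurable_fun mb => u _; rewrite -[RHS]/(last false (word p 1 u)).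
  by case: (last false _); rewrite ?lexx// lt_geF.
apply/measurable_fun_pairP; split; apply: measurable_funM => //.
  by apply: (measurable_fun_cvg (h := fun k u => a u k)) => [k|u _]; [exact: mw|exact: (a_limit u).1].
by apply: (measurable_fun_cvg (h := fun k u => b u k)) => [k|u _]; [exact: mw|exact: (b_limit u).1].
Qed.

End Cluster.

Lemma measurable_rectangle (R : realType) (I J : interval R) :
  measurable [set z : state R | z.2.1 \in I /\ z.2.2 \in J].
Proof.
have m1 : measurable_fun setT (fun z : state R => z.2.1).
  exact: (measurableT_comp measurable_fst measurable_snd).
have m2 : measurable_fun setT (fun z : state R => z.2.2).
  exact: (measurableT_comp measurable_snd measurable_snd).
have := measurableI _ _ (m1 measurableT _ (@measurable_itv R I))
  (m2 measurableT _ (@measurable_itv R J)).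
by rewrite !setTI.
Qed.

Lemma measurable_cell (R : realType) (M : R) : measurable (cell M).
Proof.
rewrite (_ : cell M = [set z | (z.2.1 \in `[0, M[) /\ (z.2.2 \in `[0, M[)]).
  exact: measurable_rectangle.
by apply/seteqP; split => z; rewrite /= !in_itv.
Qed.

(** One ultrafilter finer than [\oo] makes the masses of all cells converge at once, and the limits
    stay additive under splitting. Since [Ex (m n) f] converges along [\oo] by assumption, its limit
    along the ultrafilter is the same. *)
Lemma weak_cluster (R : realType) (M : R) (m : nat -> probability (state R) R) : 0 < M ->
  (forall n, m n (cell M) = 1%E) ->
  exists mu : probability (state R) R,
    mu (states R) = 1%E /\
    forall f l, test f -> Ex (m n) f @[n --> \oo] --> l -> Ex mu f = l.
Proof.
move=> M_gt0 mM; have mcell := measurable_cell M.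
have [U [UU sU]] := ultraFilterLemma eventually_filter.
have PU : ProperFilter U by apply: ultra_proper.
pose q n s : R := fine (m n [set z | code M (size s) z = s]).
have q01 n s : 0 <= q n s <= 1.
  rewrite /q fine_ge0//= -[leRHS]/(fine 1%E) fine_le//.
    by rewrite fin_num_measure//; exact: measurable_code.
  by apply: probability_le1; exact: measurable_code.
have /choice[p pP] : forall s, exists l : R, q n s @[n --> U] --> l.
  by move=> s; exact: (ultra_cvg UU).
have p_nil : p [::] = 1.
  apply: (cvg_unique _ (pP [::])) => //; apply: cvg_near_cst; apply: nearW => n.
  rewrite /q (_ : [set z | _] = setT) ?probability_setT//.
  by apply/seteqP; split.
have p_ge0 s : 0 <= p s.
  apply: (@closed_cvg _ _ U _ (q^~ s) (fun x : R => 0 <= x) (@closed_ge R 0) _ _ (pP s)).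
  by apply: nearW => n; have /andP[] := q01 n s.
have p_cons s : p s = p (false :: s) + p (true :: s).
  have qE n : q n s = q n (false :: s) + q n (true :: s).
    rewrite /q -fineD ?fin_num_measure//; try exact: measurable_code.
    rewrite -measureU; try exact: measurable_code.
      congr (fine (m n _)); apply/seteqP; split => z /=.
        by case: (bit M _ z) => ->; [right|left].
      by move=> [] [_].
    by apply/seteqP; split => // z /= [[->]].
  apply: (cvg_unique _ (pP s)) => //; rewrite (funext qE).
  exact: cvgD (pP _) (pP _).
have mG := measurable_limit_point M p.
have [mu [mu_law mu_Ex]] := image_law (uniform_prob (@ltr01 R)) mG.
exists mu; split.
  rewrite mu_law -[RHS](probability_setT (uniform_prob (@ltr01 R))).
  congr (uniform_prob _ _); apply/seteqP; split => // u _.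
  by have [/andP[h1 _] /andP[h2 _]] := limit_point_box M_gt0 p u; split.
move=> f l tf fl; have [[c fc] [K Kf]] := tf.
have bf := test_bmeas tf.
have bG := bmeas_comp mG bf.
pose err k := K * (2 * M * half R k.-1./2).
pose S k := \sum_(s <- words k) f (decode M s) * p s.
have mw k s : measurable (word p k @^-1` [set s]) by exact: word_measurable.
have bw k : bmeas (fun u : measurableTypeR R => f (decode M (word p k u))).
  split; last by exists c => u; exact: fc.
  exact: (@measurable_words R _ (measurableTypeR R) k (fun s => f (decode M s)) (word p k) (size_word p k) (mw k)).
have mu_S k : (0 < k)%N -> `|Ex mu f - S k| <= err k.
  move=> k0; have -> : S k = Ex (uniform_prob (@ltr01 R)) (fun u => f (decode M (word p k u))).
    apply: etrans (esym (@Ex_words R _ (measurableTypeR R) (uniform_prob (@ltr01 R)) k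
      (fun s => f (decode M s)) (word p k) (size_word p k) (mw k))).
    apply: eq_big_seq => s; rewrite mem_words => /eqP sk.
    congr (_ * _); exact: (congr1 fine (esym (uniform_word p_nil p_ge0 p_cons sk))).
  rewrite mu_Ex// -ExB//.
  apply: (@Ex_abs_le_ae _ _ _ _ setT) => //; first exact: probability_setT.
    exact: bmeasB.
  by move=> u _; rewrite distrC; exact: word_near.
(* At a fixed depth the sum over cells is finite, so the limit along [U] can be taken term by
   term. *)
have l_S k : (0 < k)%N -> `|l - S k| <= err k.
  move=> k0; pose Sn n := \sum_(s <- words k) f (decode M s) * q n s.
  have SnU : (Ex (m n) f - Sn n) @[n --> U] --> l - S k.
    apply: cvgB.
      by move=> A /fl; exact: sU.
    rewrite /Sn /S; elim: (words k) => [|s r IH].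
      by under eq_fun do rewrite big_nil; rewrite big_nil; exact: cvg_cst.
    under eq_fun do rewrite big_cons; rewrite big_cons; apply: cvgD => //.
    by apply: cvgMr; exact: pP.
  apply: (@closed_cvg _ _ U _ _ (fun x : R => x <= err k) (@closed_le R (err k)) _ _ (cvg_norm SnU)).
  apply: nearW => n; have mc s : measurable (code M k @^-1` [set s]) by exact: measurable_code.
  have bc : bmeas (fun z => f (decode M (code M k z))).
    split; last by exists c => u; exact: fc.
    exact: (@measurable_words R _ (state R) k (fun s => f (decode M s)) (code M k) (size_code M k) mc).
  have -> : Sn n = Ex (m n) (fun z => f (decode M (code M k z))).
    apply: etrans (esym (@Ex_words R _ (state R) (m n) k
      (fun s => f (decode M s)) (code M k) (size_code M k) mc)).
    apply: eq_big_seq => s; rewrite mem_words => /eqP sk.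
    by rewrite /q sk.
  rewrite -ExB//.
  apply: (Ex_abs_le_ae mcell (mM n)); first exact: bmeasB.
  by move=> z zc; rewrite distrC; exact: code_near.
have dl k : (0 < k)%N -> `|Ex mu f - l| <= err k + err k.
  move=> k0; rewrite (_ : _ - l = (Ex mu f - S k) - (l - S k)); last by ring.
  by apply: (le_trans (ler_normB _ _)); apply: lerD; [exact: mu_S|exact: l_S].
apply/eqP; rewrite -subr_eq0 -normr_le0.
have K0 : 0 <= K by case: Kf.
(* Odd depths suffice, and for them the exponent in [err] is exactly [k]. *)
have err0 : (err k.*2.+1 + err k.*2.+1) @[k --> \oo] --> (0 : R).
  have h0 : half R k @[k --> \oo] --> (0 : R).
    by apply: cvg_expr; rewrite ger0_norm ?invr_ge0// invf_lt1// ltr1n.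
  have e0 : err k.*2.+1 @[k --> \oo] --> K * (2 * M * 0).
    by rewrite /err; under eq_fun do rewrite /= doubleK; do 2 apply: cvgMr.
  suff : (err k.*2.+1 + err k.*2.+1) @[k --> \oo] --> K * (2 * M * 0) + K * (2 * M * 0).
    by rewrite !mulr0 addr0.
  exact: cvgD.
apply: (@closed_cvg _ _ \oo _ _ (fun x : R => `|Ex mu f - l| <= x) (@closed_ge R _) _ _ err0).
by apply: nearW => k; exact: dl.
Qed.

(** * The semigroup of the process *)

Lemma le_of_le_add_inv (R : realType) (x y c : R) :
  (exists n0, forall n, (n0 <= n)%N -> (0 < n)%N -> x <= y + c / n%:R) -> x <= y.
Proof.
move=> [n0 xy]; apply/ler_addgt0Pr => e e0.
pose n := maxn n0 (Num.trunc (`|c| / e)).+1.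
have n_gt0 : (0 < n)%N by rewrite /n leq_max orbT.
have nP : 0 < n%:R :> R by rewrite ltr0n.
apply: (le_trans (xy n (leq_maxl _ _) n_gt0)); rewrite lerD2l ler_pdivrMr//.
apply: (le_trans (ler_norm c)); rewrite mulrC -ler_pdivrMr//.
have /andP[_ h] := truncn_itv (divr_ge0 (normr_ge0 c) (ltW e0)).
by apply: (le_trans (ltW h)); rewrite ler_nat leq_maxr.
Qed.

Lemma distr_le3 (R : realType) (a b a' b' c e : R) :
  `|a - a'| <= e -> `|b - b'| <= e -> `|a' - b'| <= c -> `|a - b| <= c + (e + e).
Proof.
rewrite !ler_norml => /andP[h1 h2] /andP[h3 h4] /andP[h5 h6]; apply/andP; split; lra.
Qed.

Section Box.
Context (R : realType) (phi : bool -> R * R -> R -> R * R) (lam : state R -> R -> R).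
Context (N : R * R -> R) (B : set (R * R)) (nu gam D C L tau c : R).
Hypothesis F : compact_flow phi lam N B nu gam D C L tau c.
Hypothesis cumE : forall z t, 0 <= t -> cumulative_rate nu phi z t = lam z t.
Hypothesis phi_meas : forall i,
  measurable_fun setT (fun a : (R * R) * R => phi i a.1 (Num.max 0 a.2)).
Hypothesis lam_meas : forall i,
  measurable_fun setT (fun a : (R * R) * R => lam (i, a.1) (Num.max 0 a.2)).
Context (d : measure_display) (Om : measurableType d).
Context (P : state R -> probability Om R) (X : R -> Om -> state R) (T : nat -> Om -> \bar R).
Hypothesis X_meas : forall t, 0 <= t -> measurable_fun setT (X t).
Hypothesis T_meas : forall n, measurable_fun setT (T n).
Hypothesis paths : pdmp_paths phi X T.
Hypothesis X_start : forall z, states R z -> P z [set w | X 0 w = z] = 1%E.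
Hypothesis rate : forall z, states R z -> jumps_at_rate nu phi X T (P z).

Let B_states (z : state R) : B z.2 -> states R z. Proof. exact: (cf_ge0 F). Qed.

Definition semigroup t (f : state R -> R) z := Ex (P z) (fun w => f (X t w)).
Local Notation S := semigroup.

Let chain t n (f : state R -> R) := iter n (step phi lam (t / n%:R)) f.

Let near (z : state R) u (f : state R -> R) (a e : R) : B z.2 -> 0 <= u -> bmeas f ->
  (forall v, B v.2 -> `|f v - a| <= e) -> `|S u f z - a| <= e.
Proof.
move=> Bz; have sz := B_states Bz.
exact: (Ex_near F cumE phi_meas lam_meas Bz X_meas T_meas paths (X_start sz) (rate sz)).
Qed.

Lemma semigroup_box z t (A : set (state R)) : B z.2 -> 0 <= t -> measurable A ->
  (forall v, B v.2 -> A v) -> P z (X t @^-1` A) = 1%E.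
Proof.
move=> Bz t0 mA BA.
have mXA : measurable (X t @^-1` A) by rewrite -[X in measurable X]setTI; exact: X_meas.
have : `|S t (\1_A) z - 1| <= 0.
  apply: near => //; first exact: bmeas_indic.
  by move=> v /BA Av; rewrite indic_in// subrr normr0.
rewrite normr_le0 subr_eq0 => /eqP; rewrite /semigroup.
rewrite (_ : (fun w => \1_A (X t w)) = \1_(X t @^-1` A)); last by apply/funext => w; rewrite !indicE.
by rewrite Ex_indic// => e; rewrite -[LHS]fineK ?e// fin_num_measure.
Qed.

Context (f : state R -> R) (M K : R).
Hypotheses (fM : forall z, `|f z| <= M) (fK : lip_test K f).

Let K0 : 0 <= K. Proof. by case: fK. Qed.
Let f_bmeas : bmeas f. Proof. by apply: test_bmeas; split; [exists M|exists K]. Qed.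
Let M0 : 0 <= 2 * M.
Proof. by rewrite mulr_ge0// (le_trans _ (fM (true, (0, 0)))). Qed.
Let f_osc : osc_le B (2 * M) f.
Proof.
move=> i w j v _ _; have := fM (i, w); have := fM (j, v).
by rewrite !ler_norml => /andP[? ?] /andP[? ?]; lra.
Qed.
Let f_lip : lip N B K f.
Proof.
move=> i w v _ _; case: fK => _ /(_ i w v) h; apply: (le_trans h).
by rewrite ler_wpM2l//; have /andP[] := cf_norm F (w - v).
Qed.
Let err t := jump_error C L (2 * M * nu + K) (2 * M) * t ^+ 2.

Let chain_bmeas t n : 0 <= t -> bmeas (chain t n f).
Proof. by move=> t0; apply: bmeas_iter_step => //; rewrite divr_ge0. Qed.

Let approx z u t n : B z.2 -> 0 <= u -> 0 <= t -> (0 < n)%N ->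
  `|S (u + t) f z - S u (chain t n f) z| <= err t / n%:R.
Proof.
move=> Bz u0 t0 n0; have sz := B_states Bz.
exact: (Ex_limit F cumE phi_meas lam_meas Bz X_meas T_meas paths (X_start sz) (rate sz)).
Qed.

Let approx0 z t n : B z.2 -> 0 <= t -> (0 < n)%N ->
  `|S t f z - chain t n f z| <= err t / n%:R.
Proof.
move=> Bz t0 n0; have sz := B_states Bz; have := approx Bz (lexx 0) t0 n0; rewrite add0r.
by rewrite [S 0 _ _](Ex_start X_meas (X_start sz) (chain_bmeas n t0)).
Qed.

(** The bound for the chain is uniform in [n] and passes to the limit. Its constant depends neither
    on [t] nor on the box. *)
Lemma semigroup_lip i w v t : B w -> B v -> 0 <= t ->
  `|S t f (i, w) - S t f (i, v)| <= (2 * M * nu + K) * N (w - v).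
Proof.
move=> Bw Bv t0; apply: (@le_of_le_add_inv _ _ _ (err t + err t)); exists 1%N => n _ n0.
have h1 := @approx0 (i, w) t n Bw t0 n0; have h2 := @approx0 (i, v) t n Bv t0 n0.
have h3 : `|chain t n f (i, w) - chain t n f (i, v)| <= (2 * M * nu + K) * N (w - v).
  have h0 : 0 <= t / n%:R by rewrite divr_ge0.
  apply: (le_trans (iter_step_lip F n h0 M0 K0 f_osc f_lip i Bw Bv)).
  rewrite ler_wpM2r//.
    by have /andP[+ _] := cf_norm F (w - v); apply: le_trans; exact: norm1_ge0.
  rewrite lerD2l ler_piMl// mulNr expRN_le1// !mulr_ge0 ?(ltW (cf_g F)) ?invr_ge0//.
by rewrite [(err t + err t) / _]mulrDl; exact: distr_le3 h1 h2 h3.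
Qed.

(** Chapman-Kolmogorov without conditioning: both sides are approximated by the expectation at [u]
    of the same function [chain s n f]. The function [g] is any bounded measurable extension of
    [S s f] from the box. *)
Lemma semigroupD z u s (g : state R -> R) : B z.2 -> 0 <= u -> 0 <= s ->
  bmeas g -> (forall v, B v.2 -> g v = S s f v) -> S u g z = S (u + s) f z.
Proof.
move=> Bz u0 s0 bg gE; apply/eqP; rewrite -subr_eq0 -normr_le0.
apply: (@le_of_le_add_inv _ _ _ (err s + err s)); exists 1%N => n _ n0; rewrite add0r.
have h1 := approx Bz u0 s0 n0.
have [bgX bcX] := (bmeas_X X_meas u0 bg, bmeas_X X_meas u0 (chain_bmeas n s0)).
have h2 : `|S u (fun v => g v - chain s n f v) z - 0| <= err s / n%:R.
  apply: near => //; first by apply: bmeasB => //; exact: chain_bmeas.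
  by move=> v Bv; rewrite subr0 gE//; exact: approx0.
rewrite subr0 [S u _ z]ExB// in h2.
rewrite [(err s + err s) / _]mulrDl -[leRHS]add0r; apply: (distr_le3 h2 h1); by rewrite subrr normr0.
Qed.

(** The shift [u] on one side makes this both a Cauchy estimate in time and a comparison of starting
    points. *)
Lemma semigroup_mixing : exists t0 th A : R, [/\ 0 < t0, 0 < th < 1 &
  forall k u t z z', 0 <= u -> 0 < t -> k%:R * t0 <= t -> B z.2 -> B z'.2 ->
    `|S (u + t) f z - S t f z'| <= th ^+ k * A].
Proof.
have [t0 [th [t00 th01 erg]]] := iter_step_ergodic F.
exists t0, th, (2 * M + K / (4 * nu)); split => // k u t z z' u0 t_gt0 kt Bz Bz'.
have tw := ltW t_gt0.
(* From this [n] on the step [t / n] is at most 1, as [erg] requires. *)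
apply: (@le_of_le_add_inv _ _ _ (err t + err t)); exists (Num.trunc t).+1 => n nt n0.
have nP : 0 < n%:R :> R by rewrite ltr0n.
have h1 := approx Bz u0 tw n0; have h2 := approx0 Bz' tw n0.
have osc : osc_le B (th ^+ k * (2 * M + K / (4 * nu))) (chain t n f).
  apply: erg => //; last by rewrite [leRHS]mulrC divfK// gt_eqF.
  rewrite divr_gt0//= ler_pdivrMr// mul1r.
  have /andP[_ h] := truncn_itv tw; apply: (le_trans (ltW h)).
  by rewrite ler_nat.
have h3 : `|S u (chain t n f) z - chain t n f z'| <= th ^+ k * (2 * M + K / (4 * nu)).
  apply: near => //; first exact: chain_bmeas.
  move=> [i w] Bw; case: z' Bz' {h2} => j v Bv; rewrite ler_norml lerNl opprB.
  by rewrite !osc.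
by rewrite [(err t + err t) / _]mulrDl; exact: distr_le3 h1 h2 h3.
Qed.

End Box.

(** * Convergence to the invariant measure *)

Section LowerApproximation.
Context (R : realType) (f : state R -> R) (c : R).
Hypothesis f_cont : forall i, continuous (fun w => f (i, w)).
Hypothesis fc : forall z, `|f z| <= c.

Definition inf_conv (n : nat) (z : state R) : R :=
  inf [set f (z.1, v) + n%:R * norm1 (z.2 - v) | v in setT].

Let lb n z : lbound [set f (z.1, v) + n%:R * norm1 (z.2 - v) | v in setT] (- c).
Proof.
move=> _ [v _ <-]; have := fc (z.1, v); rewrite ler_norml => /andP[h _].
by apply: (le_trans h); rewrite lerDl mulr_ge0// norm1_ge0.
Qed.

Let inf_conv_le n i w v : inf_conv n (i, w) <= f (i, v) + n%:R * norm1 (w - v).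
Proof. by apply: ge_inf; [exists (- c); exact: lb|exists v]. Qed.

Let le_inf_conv n i w a : (forall v, a <= f (i, v) + n%:R * norm1 (w - v)) -> a <= inf_conv n (i, w).
Proof.
move=> h; apply: lb_le_inf; first by exists (f (i, 0) + n%:R * norm1 (w - 0)); exists 0.
by move=> _ [v _ <-]; exact: h.
Qed.

Lemma inf_conv_below n z : inf_conv n z <= f z.
Proof.
case: z => i w; apply: (le_trans (inf_conv_le n i w w)).
by rewrite subrr /norm1/= normr0 addr0 mulr0 addr0.
Qed.

Lemma inf_conv_bound n z : `|inf_conv n z| <= c.
Proof.
have h1 := inf_conv_below n z; have := fc z; rewrite !ler_norml => /andP[_ h2].
apply/andP; split; last exact: le_trans h2.
by case: z {h1 h2} => i w; apply: le_inf_conv => v; apply: (@lb n (i, w)); exists v.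
Qed.

Lemma inf_conv_test n : test (inf_conv n).
Proof.
split; first by exists c; exact: inf_conv_bound.
have h i w v : inf_conv n (i, w) - inf_conv n (i, v) <= n%:R * norm1 (w - v).
  rewrite lerBlDl -lerBlDr; apply: le_inf_conv => u; rewrite lerBlDr.
  apply: (le_trans (inf_conv_le n i w u)); rewrite -addrA lerD2l -mulrDr ler_wpM2l//.
  by rewrite [leRHS]addrC norm1_triangle.
exists n%:R; split => // i w v; rewrite ler_norml h andbT lerNl opprB.
by rewrite norm1C; exact: h.
Qed.

Lemma inf_conv_cvg z : inf_conv n z @[n --> \oo] --> f z.
Proof.
case: z => i w; apply/cvgrPdist_le => e e0.
have /cvgrPdist_lt/(_ e e0) := @f_cont i w; rewrite -nbhs_ballE => -[r /= r0 fr].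
have c0 : 0 <= c by apply: le_trans (fc (i, w)).
near=> n.
(* Beyond distance [r] the penalty then exceeds [2 * c], the largest possible drop of [f]; closer,
   [f] varies by less than [e]. *)
have n_big : 2 * c / r <= n%:R by near: n; exact: nbhs_infty_ger.
have h1 := inf_conv_below n (i, w); rewrite ger0_norm ?subr_ge0// lerBlDl -lerBlDr.
apply: le_inf_conv => v; have [wv|wv] := ltP (norm1 (w - v)) r.
  have : `|f (i, w) - f (i, v)| < e.
    apply: fr; split; rewrite /ball/=; apply: le_lt_trans wv; rewrite /norm1 /=.
      by rewrite lerDl.
    by rewrite lerDr.
  rewrite ltr_norml => /andP[_ h2]; have : 0 <= n%:R * norm1 (w - v) by rewrite mulr_ge0// norm1_ge0.
  lra.
have h3 : 2 * c <= n%:R * norm1 (w - v).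
  rewrite -(divfK (lt0r_neq0 r0) (2 * c)).
  by apply: ler_pM => //; rewrite ?divr_ge0// ?mulr_ge0// ltW.
have := fc (i, w); have := fc (i, v); rewrite !ler_norml => /andP[? ?] /andP[? ?]; lra.
Unshelve. all: by end_near.
Qed.

End LowerApproximation.

Lemma Ex_dominated (R : realType) (d : measure_display) (Om : measurableType d)
    (Q : probability Om R) (f_ : nat -> Om -> R) (f : Om -> R) (c : R) :
  (forall n, measurable_fun setT (f_ n)) -> measurable_fun setT f ->
  (forall n w, `|f_ n w| <= c) ->
  (forall w, f_ n w @[n --> \oo] --> f w) -> Ex Q (f_ n) @[n --> \oo] --> Ex Q f.
Proof.
move=> mf_ mf fc f_f.
have b_ n : bmeas (f_ n) by split => //; exists c => w; exact: fc.
have b : bmeas f.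
  split => //; exists c => w.
  by apply: (@closed_cvg _ _ \oo _ _ (fun x : R => x <= c) (@closed_le R c) _ _ (cvg_norm (f_f w)));
    apply: nearW => n; exact: fc.
have [|||||_ _ h] := @dominated_convergence _ _ _ Q setT measurableT (fun n w => (f_ n w)%:E)
  (fun w => (f w)%:E) (fun=> c%:E); last 1 first.
- move: h; under eq_fun do rewrite Ex_EFin//; rewrite Ex_EFin//.
  exact: fine_cvg.
- by move=> n; exact/measurable_EFinP.
- exact/measurable_EFinP.
- by apply: aeW => w _; apply: cvg_EFin; [exact: nearW|exact: f_f].
- exact: (bmeas_integrable Q (bmeas_cst Om c)).
- by apply: aeW => w n _; rewrite /= lee_fin.
Qed.

(** * Law of the process started from a random state *)

Section Mixture.
Context (R : realType) (d : measure_display) (Om : measurableType d).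
Context (mu : probability (state R) R) (Q : state R -> probability Om R) (V : Om -> state R).
Hypothesis V_meas : measurable_fun setT V.
Hypothesis Q_test : forall f, test f -> measurable_fun setT (fun z => Ex (Q z) (fun w => f (V w))).

Let bV (f : state R -> R) : test f -> bmeas (fun w => f (V w)).
Proof. by move=> tf; exact: bmeas_comp V_meas (test_bmeas tf). Qed.

Let k (z : state R) : giry (state R) R := giry_map V_meas (Q z : giry Om R).

Let k_int z (f : state R -> R) : test f -> (forall z, 0 <= f z) ->
  (\int[k z]_v (f v)%:E)%E = (Ex (Q z) (fun w => f (V w)))%:E.
Proof.
move=> tf f0; rewrite -Ex_EFin; last exact: bV.
apply: (giry_int_map V_meas (Q z : giry Om R) (h := fun v => (f v)%:E)).
  by apply/measurable_EFinP; exact: test_measurable.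
by move=> v; rewrite lee_fin.
Qed.

Let k_meas : measurable_fun setT k.
Proof.
apply: kernel_measurable_test => [z|f tf f0]; first exact: probability_setT.
by under eq_fun do rewrite k_int//; apply/measurable_EFinP; exact: Q_test.
Qed.

Lemma measurable_image (A : set (state R)) : measurable A ->
  measurable_fun setT (fun z => Q z (V @^-1` A)).
Proof. by move=> mA; exact: (measurableT_comp (measurable_giry_ev mA) k_meas). Qed.

Lemma mixture : exists m : giry (state R) R,
  [/\ m setT = 1%E,
    forall A, measurable A -> m A = (\int[mu]_z Q z (V @^-1` A))%E &
    forall f, test f -> (forall z, 0 <= f z) ->
      (\int[m]_z (f z)%:E)%E = (\int[mu]_z (Ex (Q z) (fun w => f (V w)))%:E)%E].
Proof.
pose m := giry_bind (mu : giry (state R) R) k_meas.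
have mE (A : set (state R)) : measurable A -> m A = (\int[mu]_z Q z (V @^-1` A))%E.
  move=> mA; have h0 (x : state R) : (0 <= (\1_A x)%:E :> \bar R)%E by rewrite lee_fin indicE.
  have mI : measurable_fun setT (fun x : state R => (\1_A x)%:E : \bar R).
    by apply/measurable_EFinP; exact: measurable_indic.
  have := giry_int_bind (mu : giry (state R) R) k_meas mI h0.
  rewrite /giry_int integral_indic// setIT => ->.
  by apply: eq_integral => z _; rewrite integral_indic// setIT.
exists m; split => //.
  rewrite mE//; under eq_integral do rewrite preimage_setT probability_setT.
  by rewrite integral_cst// mul1e; exact: (probability_setT mu).
move=> f tf f0.
have h0 (x : state R) : (0 <= (f x)%:E)%E by rewrite lee_fin.
have mI : measurable_fun setT (fun x : state R => (f x)%:E).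
  by apply/measurable_EFinP; exact: test_measurable.
have := giry_int_bind (mu : giry (state R) R) k_meas mI h0.
rewrite /giry_int => ->; by apply: eq_integral => z _; exact: k_int.
Qed.

End Mixture.

Section Convergence.
Context (R : realType) (d : measure_display) (Om : measurableType d).
Context (P : state R -> probability Om R) (X : R -> Om -> state R).
Hypothesis X_meas : forall t, 0 <= t -> measurable_fun setT (X t).
Local Notation S := (semigroup P X).
Hypothesis S_test : forall t f, 0 <= t -> test f -> test (fun z => S t f (clip z)).
Hypothesis S_D : forall u s f z, 0 <= u -> 0 <= s -> test f -> states R z ->
  S u (fun v => S s f (clip v)) z = S (u + s) f z.
Hypothesis S_cvg : forall f, test f -> exists l : R, forall z, states R z ->
  S t f z @[t --> +oo] --> l.
Hypothesis S_cell : forall z, states R z -> exists M, 0 < M /\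
  forall t, 0 <= t -> P z (X t @^-1` cell M) = 1%E.

Let S_bound t f c z : 0 <= t -> test f -> (forall z, `|f z| <= c) -> `|S t f z| <= c.
Proof.
move=> t0 tf fc; apply: (@Ex_abs_le_ae _ _ _ _ setT) => //; first exact: probability_setT.
exact (bmeas_X X_meas t0 (test_bmeas tf)).
Qed.

Let nat_cvg (g : R -> R) (l : R) : g t @[t --> +oo] --> l -> g n%:R @[n --> \oo] --> l.
Proof. by move=> gl; apply: cvg_comp gl; exact: cvgr_idn. Qed.

Let measurable_states : measurable (states R).
Proof.
rewrite (_ : states R = [set z | (z.2.1 \in `[0, +oo[) /\ (z.2.2 \in `[0, +oo[)]).
  exact: measurable_rectangle.
by apply/seteqP; split => z; rewrite /= !in_itv/= !andbT.
Qed.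

(** The laws at integer times from one starting point live on a common cell. The limit point
    obtained integrates every test function to the common limit, hence serves all starting
    points. *)
Lemma invariant_measure : exists mu : probability (state R) R,
  mu (states R) = 1%E /\
  forall f z, test f -> states R z -> S t f z @[t --> +oo] --> Ex mu f.
Proof.
pose z0 : state R := (true, (0, 0)).
have sz0 : states R z0 by split => /=.
have [M [M0 PM]] := S_cell sz0.
have /choice[m mP] : forall n : nat, exists m : probability (state R) R,
    (forall A, m A = P z0 (X n%:R @^-1` A)) /\
    forall f, bmeas f -> Ex m f = S n%:R f z0.
  by move=> n; exact: image_law (X_meas _).
have [n|mu [mu1 mu_test]] := @weak_cluster R M m M0; first by rewrite (mP n).1 PM.
exists mu; split => //; move=> f z tf sz; have [l Sl] := S_cvg tf.
suff -> : Ex mu f = l by exact: Sl.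
apply: mu_test => //; have := nat_cvg (Sl _ sz0).
have bf := test_bmeas tf.
by rewrite (_ : (fun n : nat => _) = fun n => Ex (m n) f)//; apply/funext => n; rewrite (mP n).2.
Qed.

Section Limit.
Context (mu : probability (state R) R).
Hypothesis mu_states : mu (states R) = 1%E.
Hypothesis mu_cvg : forall f z, test f -> states R z -> S t f z @[t --> +oo] --> Ex mu f.

(** The family [P] is known to depend measurably on the start only after composition with [clip],
    which changes nothing on a set of full mass. *)
Let restrict_clip (m : probability (state R) R) t A : 0 <= t -> measurable A ->
  m (states R) = 1%E ->
  (\int[m]_(z in states R) P z (X t @^-1` A))%E = (\int[m]_z P (clip z) (X t @^-1` A))%E.
Proof.
move=> t0 mA m1; rewrite (@ge0_negligible_integral _ _ _ m setT (~` states R))//.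
- rewrite setTD setCK; apply: eq_integral => z /set_mem sz; by rewrite clip_id.
- exact: measurableC.
- apply: (measurable_image (Q := fun z => P (clip z)) (X_meas t0)) => // f tf.
  exact: test_measurable (S_test t0 tf).
- by have := probability_setC m measurable_states; rewrite m1 subee.
Qed.

Let mix t (m : probability (state R) R) (t0 : 0 <= t) :=
  @mixture R d Om m (fun z => P (clip z)) (X t) (X_meas t0)
    (fun f tf => test_measurable (S_test t0 tf)).

(** As [s] grows, [S s (S t f)] tends to the [mu]-integral of [S t f]; being [S (s + t) f], it also
    tends to that of [f]. *)
Lemma limit_stationary : stationary P X mu.
Proof.
split => // t A t0 mA; rewrite restrict_clip//.
have [m [m1 mA' mf]] := mix mu t0.
rewrite -mA'//; apply: (@measure_eq_test R m (mu : giry (state R) R)) => //.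
  exact: probability_setT.
move=> f tf f0; rewrite mf//.
have tS := S_test t0 tf.
have bS := test_bmeas tS.
have bf := test_bmeas tf.
rewrite [LHS](Ex_EFin mu bS) [RHS](Ex_EFin mu bf); congr EFin.
pose z0 : state R := (true, (0, 0)).
have sz0 : states R z0 by split => /=.
apply: (cvg_unique _ (nat_cvg (mu_cvg tS sz0))) => //.
have h : S (s + t) f z0 @[s --> +oo] --> Ex mu f.
  by apply: cvg_comp (mu_cvg tf sz0); exact: cvg_addrr.
apply: (nat_cvg (g := fun s => S s (fun z => S t f (clip z)) z0)).
apply: cvg_trans h; apply: near_eq_cvg.
by apply: filterS (nbhs_pinfty_ge (num_real 0)) => s s0; rewrite S_D.
Qed.

(** Stationarity makes the [mu']-integral of [S n f] independent of [n], while dominated convergence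
    sends it to the constant [Ex mu f]. *)
Lemma limit_unique (mu' : probability (state R) R) : stationary P X mu' ->
  forall A, measurable A -> mu' A = mu A.
Proof.
move=> [s1 sE] A mA.
apply: (@measure_eq_test R (mu' : giry (state R) R) (mu : giry (state R) R)) => //;
  try exact: probability_setT.
move=> f tf f0.
have bf := test_bmeas tf.
have bS n := test_bmeas (S_test (ler0n R n) tf).
have fE n : Ex mu' f = Ex mu' (fun z => S n%:R f (clip z)).
  have [m [m1 mA' mf]] := mix mu' (ler0n R n).
  apply: EFin_inj; rewrite -!Ex_EFin// -mf//; apply: eq_measure_integral => B mB _.
  by have := mA' B mB; rewrite -restrict_clip// sE// => e; first [exact: e|exact: esym e].
rewrite [LHS](Ex_EFin mu' bf) [RHS](Ex_EFin mu bf); congr EFin.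
have [[c fc] _] := tf.
have h : Ex mu' (fun z => S n%:R f (clip z)) @[n --> \oo] --> Ex mu' (fun=> Ex mu f).
  apply: (@Ex_dominated _ _ _ _ _ _ c).
  - by move=> n; case: (bS n).
  - exact: measurable_cst.
  - by move=> n z; exact: S_bound.
  - by move=> z; apply: nat_cvg (mu_cvg _ _) => //; exact: clip_states.
move: h; rewrite Ex_cst -(funext (fun n => fE n) : (fun=> Ex mu' f) = _).
by move=> h; apply: (cvg_unique _ _ h) => //; exact: cvg_cst.
Qed.

(** A lower bound is enough: applied to [- f] it gives the upper one. *)
Let lower f c z e : 0 < e -> (forall i, continuous (fun w => f (i, w))) ->
  (forall z, `|f z| <= c) -> states R z -> \forall t \near +oo, Ex mu f - e <= S t f z.
Proof.
move=> e0 f_cont fc sz.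
have f_meas : measurable_fun setT f by exact: continuous_measurable_state.
have bf : bmeas f by split => //; exists c.
have bg n := test_bmeas (inf_conv_test fc n).
have := @Ex_dominated R _ _ mu (inf_conv f) f c (fun n => (bg n).1) f_meas
  (inf_conv_bound fc) (inf_conv_cvg f_cont fc).
have e2 : 0 < e / 2 by rewrite divr_gt0.
move=> /cvgrPdist_le/(_ _ e2)[n _ /(_ n (leqnn n))/=].
rewrite ler_norml => /andP[_ h1].
have := mu_cvg (inf_conv_test fc n) sz => /cvgrPdist_le/(_ _ e2).
apply: filterS2 (nbhs_pinfty_ge (num_real 0)) => t t0 h2.
have h3 : S t (inf_conv f n) z <= S t f z.
  by apply: Ex_le => [||w]; [exact (bmeas_X X_meas t0 (bg n))|exact (bmeas_X X_meas t0 bf)|exact: inf_conv_below].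
move: h2; rewrite ler_norml => /andP[h2 h4]; move: h1 h2 h3 h4.
by move: (S _ _ _) (S _ _ _) (Ex _ _) (Ex _ _) => a b x y; lra.
Qed.

Lemma limit_in_distribution z : states R z -> converges_in_distribution X (P z) mu.
Proof.
move=> sz f f_cont [c fc].
have f_cont' i : continuous (fun w => f (i, w)).
  move=> w A /(f_cont (i, w)) [[B C] /= [iB wC] BC]; apply: filterS wC => v Cv.
  by apply: (BC (i, v)); split => //=; exact: nbhs_singleton iB.
have bf : bmeas f by split; [exact: continuous_measurable_state|exists c].
rewrite Ex_EFin//.
have mX t : 0 <= t -> bmeas (fun w => f (X t w)) by move=> t0; exact (bmeas_X X_meas t0 bf).
apply: cvg_EFin.
  by apply: filterS (nbhs_pinfty_ge (num_real 0)) => t t0; rewrite Ex_EFin//; exact: mX.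
apply/cvgrPdist_le => e e0.
have h1 := lower e0 f_cont' fc sz.
have fN_cont i : continuous (fun w => - f (i, w)) by move=> w; apply: cvgN; exact: f_cont'.
have fNc v : `|- f v| <= c by rewrite normrN.
have h2 := lower e0 fN_cont fNc sz.
near=> t.
have t0 : 0 <= t by near: t; exact: nbhs_pinfty_ge (num_real 0).
have -> : (fine \o (fun t => \int[P z]_w (f (X t w))%:E)%E) t = S t f z.
  by rewrite /= Ex_EFin//; exact: mX.
have h3 : Ex mu f - e <= S t f z by near: t; exact: h1.
have h4 : Ex mu (fun v => - f v) - e <= S t (fun v => - f v) z by near: t; exact: h2.
have e1 : Ex mu (fun v => - f v) = - Ex mu f.
  by rewrite -[RHS]mulN1r -ExZ//; congr Ex; apply/funext => v; rewrite mulN1r.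
have e2 : S t (fun v => - f v) z = - S t f z.
  rewrite /semigroup -[RHS]mulN1r -ExZ; last exact: mX.
  by congr Ex; apply/funext => v; rewrite mulN1r.
move: h3 h4; rewrite e1 e2 ler_norml; move: (S _ _ _) (Ex _ _) => a b h3 h4.
by apply/andP; split; lra.
Unshelve. all: by end_near.
Qed.

End Limit.
End Convergence.

(** * The two plane system *)

Section TwoPlaneFlow.
Context (R : realType) (nu p q alpha beta delta epsilon eta kap g : R).
Hypotheses (nu_gt0 : 0 < nu) (p_gt0 : 0 < p) (q_gt0 : 0 < q).
Hypotheses (alpha_gt0 : 0 < alpha) (beta_gt0 : 0 < beta) (delta_gt0 : 0 < delta).
Hypotheses (epsilon_gt0 : 0 < epsilon) (eta_gt0 : 0 < eta).
Context (phi : bool -> R * R -> R -> R * R).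
Hypothesis phi_flow : is_flow nu p q alpha beta delta epsilon eta phi.
Hypotheses (kap_gt0 : 0 < kap) (kap_le1 : kap <= 1) (g_gt0 : 0 < g).
Local Notation PP := (PP nu p q alpha delta).
Local Notation kk := (kk nu beta epsilon).
Local Notation lam := (lam nu eta phi).
Hypotheses (kapPk : forall i, kap * (PP i + kk i) <= 1).
Hypotheses (g_kap : forall i, g * (2 + kap) <= kap * kk i) (g_1 : g * (2 + kap) <= 1).

Let kap_ge0 : 0 <= kap. Proof. exact: ltW. Qed.

Lemma box_coords r w : box kap r w ->
  [/\ 0 <= w.1, 0 <= w.2, w.1 <= 1 + r & w.2 <= 1 + r].
Proof. by move=> /(box_le kap_gt0 true)[]. Qed.

(** The rate is [g / 2] because [quad_norm] is a square root. After time [(2 + r) / eta] the factor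
    [eta * t - (1 + r)] of [lam_lower] is at least 1, whence the last constant. *)
Lemma two_plane_compact_flow r : box_radius eta kap g <= r ->
  compact_flow phi lam (quad_norm kap) (box kap r) nu (g / 2) (8 * (1 + r))
    (speed nu p q alpha beta delta epsilon eta r) (nu * (1 + r))
    ((2 + r) / eta) (nu / (1 + PP false)).
Proof.
move=> br; have r0 : 0 <= r.
  by apply: le_trans br; rewrite /box_radius !divr_ge0 ?sqr_ge0 ?ltW.
have PP0 i : 0 < PP i by apply: (@PP_gt0 R nu p q alpha delta).
have kk0 i : 0 < kk i by apply: (@kk_gt0 R nu beta epsilon).
split => //.
- by rewrite divr_gt0.
- by rewrite mulr_gt0// ltr_wpDr.
- rewrite /speed; move: (PP0 true) (PP0 false) (kk0 true) (kk0 false).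
  move: (PP _) (PP _) (kk _) (kk _) => a b a' b' *.
  by do ?[apply: mulr_ge0|apply: addr_ge0] => //; exact: ltW.
- by rewrite mulr_ge0 ?addr_ge0// ltW.
- by rewrite divr_ge0 ?addr_ge0// ltW.
- by rewrite divr_gt0// addr_gt0.
- by move=> w [].
- by move=> w; rewrite norm1_le_quad//=; exact: quad_le_norm1.
- by move=> w v; rewrite /quad_norm /= !(distrC w.1) !(distrC w.2).
- move=> w v /box_coords[w1 w2 w3 w4] /box_coords[v1 v2 v3 v4].
  apply: (le_trans (quad_le_norm1 _ _)) => //; rewrite /norm1 /=.
  have h1 : `|w.1 - v.1| <= 1 + r by rewrite ler_norml; apply/andP; split; lra.
  have h2 : `|w.2 - v.2| <= 1 + r by rewrite ler_norml; apply/andP; split; lra.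
  by lra.
- by move=> i w; exact: (flow0 phi_flow).
- by move=> i w s t t0; exact: (@flowD R nu p q alpha beta delta epsilon eta).
- by move=> i w t Bw t0; exact: (@flow_box R nu p q alpha beta delta epsilon eta kap g).
- by move=> i w v t t0; exact: (@flow_contract R nu p q alpha beta delta epsilon eta kap g).
- by move=> i w t Bw t0; exact: (@flow_speed R nu p q alpha beta delta epsilon eta kap g).
- by move=> i w s t t0; exact: (@lamD R nu p q alpha beta delta epsilon eta).
- by move=> i w t [w1 w2 _] t0; exact: (@lam_ge0 R nu p q alpha beta delta epsilon eta).
- by move=> i w t Bw t0; exact: (@lam_le R nu p q alpha beta delta epsilon eta kap g).
- by move=> i w v t t0; exact: (@lam_coupling R nu p q alpha beta delta epsilon eta).
move=> w t Bw tt; have t0 : 0 <= t by apply: le_trans tt; rewrite divr_ge0 ?addr_ge0// ltW.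
have d0 : 0 < 1 + PP false by exact: addr_gt0.
rewrite (ler_pdivrMr _ _ d0) [leRHS]mulrC.
have := @lam_lower R nu p q alpha beta delta epsilon eta kap g nu_gt0 p_gt0 q_gt0 alpha_gt0
  beta_gt0 delta_gt0 epsilon_gt0 eta_gt0 phi phi_flow kap_gt0 g_gt0 kapPk g_kap g_1 r false w t
  br Bw t0.
apply: le_trans.
rewrite ler_pMr//; move: tt; rewrite ler_pdivrMr//; lra.
Qed.

Lemma flow_coord_continuous i w :
  continuous (fun t => (phi i w t).1) /\ continuous (fun t => (phi i w t).2).
Proof.
have [_ h] := phi_flow i w.
split => t; apply/differentiable_continuous/derivable1_diffP; have [d1 d2] := h t.
  exact: (@ex_derive _ _ _ _ _ _ _ d1).
exact: (@ex_derive _ _ _ _ _ _ _ d2).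
Qed.

Lemma measurable_flow i : measurable_fun setT (fun a : (R * R) * R => phi i a.1 (Num.max 0 a.2)).
Proof.
have mc (h : R -> R) : continuous h ->
    measurable_fun setT (fun a : (R * R) * R => h (Num.max 0 a.2)).
  move=> ch; apply: measurableT_comp; first exact: continuous_measurable_fun.
  by apply: measurable_maxr; [exact: measurable_cst|exact: measurable_snd].
have m1 : measurable_fun setT (fun a : (R * R) * R => a.1.1).
  exact: (measurableT_comp measurable_fst measurable_fst).
have m2 : measurable_fun setT (fun a : (R * R) * R => a.1.2).
  exact: (measurableT_comp measurable_snd measurable_fst).
have hE (a : (R * R) * R) : phi i a.1 (Num.max 0 a.2) = phi i 0 (Num.max 0 a.2) +
   (a.1.1 *: linear_flow phi i (1, 0) (Num.max 0 a.2) + a.1.2 *: linear_flow phi i (0, 1) (Num.max 0 a.2)).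
  by apply: (@flow_affine R nu p q alpha beta delta epsilon eta) => //; rewrite le_max lexx.
have hc w : continuous (fun t => (linear_flow phi i w t).1) /\ continuous (fun t => (linear_flow phi i w t).2).
  have [a1 a2] := flow_coord_continuous i w; have [b1 b2] := flow_coord_continuous i 0.
  by split => t; apply: cvgB; [exact: a1|exact: b1|exact: a2|exact: b2].
have [p1 p2] := flow_coord_continuous i 0.
have [[h1 h2] [h3 h4]] := (hc (1, 0), hc (0, 1)).
apply/measurable_fun_pairP; split.
  under eq_fun do rewrite hE /=.
  apply: measurable_funD; first exact: (mc (fun t => (phi i 0 t).1)).
  apply: measurable_funD; apply: measurable_funM => //; [exact: (mc _ h1)|exact: (mc _ h3)].
under eq_fun do rewrite hE /=.
apply: measurable_funD; first exact: (mc (fun t => (phi i 0 t).2)).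
apply: measurable_funD; apply: measurable_funM => //; [exact: (mc _ h2)|exact: (mc _ h4)].
Qed.

Lemma measurable_lam i : measurable_fun setT (fun a : (R * R) * R => lam (i, a.1) (Num.max 0 a.2)).
Proof.
have [m1 m2] := (measurable_fun_pairP _).1 (measurable_flow i).
have m0 : measurable_fun setT (fun a : (R * R) * R => Num.max 0 a.2).
  by apply: measurable_maxr; [exact: measurable_cst|exact: measurable_snd].
have w1 : measurable_fun setT (fun a : (R * R) * R => a.1.1).
  exact: (measurableT_comp measurable_fst measurable_fst).
have w2 : measurable_fun setT (fun a : (R * R) * R => a.1.2).
  exact: (measurableT_comp measurable_snd measurable_fst).
apply: measurable_funM; first exact: measurable_cst.
apply: measurable_funB; last exact: measurable_funD.
apply: measurable_funD; last exact: measurable_funD.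
by apply: measurable_funM => //; exact: measurable_cst.
Qed.

End TwoPlaneFlow.

(** The inverse of [kap] exceeds both sums [P i + k i]. As [kap <= 1], the factor [2 + kap] is at
    most 3, which is the divisor in [g]. *)
Lemma decay_constants (R : realType) (k P : bool -> R) :
  (forall i, 0 < k i) -> (forall i, 0 < P i) ->
  exists kap g : R, [/\ 0 < kap <= 1, 0 < g, forall i, kap * (P i + k i) <= 1,
    forall i, g * (2 + kap) <= kap * k i & g * (2 + kap) <= 1].
Proof.
move=> k0 P0; pose s := 1 + (P true + k true + (P false + k false)).
have [pt pf kt kf] := And4 (P0 true) (P0 false) (k0 true) (k0 false).
have s1 : 1 <= s by rewrite /s; lra.
have s0 : 0 < s by lra.
pose m := Num.min (k true) (k false).
have m0 : 0 < m by rewrite lt_min kt kf.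
have mk i : m <= k i by case: i; rewrite ge_min lexx ?orbT.
have kap0 : 0 < s^-1 by rewrite invr_gt0.
have kap1 : s^-1 <= 1 by rewrite invf_le1.
have kapPk i : s^-1 * (P i + k i) <= 1.
  by rewrite mulrC ler_pdivrMr// mul1r /s; case: i; lra.
have gE : s^-1 * m / 3 * (2 + s^-1) <= s^-1 * m.
  rewrite -[leRHS]mulr1 -mulrA ler_pM2l ?mulr_gt0//.
  by rewrite mulrC ler_pdivrMr//; lra.
have sm i : s^-1 * m <= s^-1 * k i by rewrite ler_pM2l.
exists s^-1, (s^-1 * m / 3); split => //.
- by rewrite kap0.
- by rewrite divr_gt0// mulr_gt0.
- by move=> i; exact: le_trans (sm i).
apply: (le_trans gE); apply: le_trans (kapPk true); apply: (le_trans (sm true)).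
by rewrite ler_pM2l// lerDr ltW.
Qed.

(** * From invariant boxes to the whole quadrant *)

Section Family.
Context (R : realType) (phi : bool -> R * R -> R -> R * R) (lam : state R -> R -> R).
Context (N : R * R -> R) (B : R -> set (R * R)) (nu gam r0 : R) (D C L tau c : R -> R).
Hypothesis F : forall r, r0 <= r -> compact_flow phi lam N (B r) nu gam (D r) (C r) (L r) (tau r) (c r).
Hypothesis B_cover : forall w v, 0 <= w.1 -> 0 <= w.2 -> 0 <= v.1 -> 0 <= v.2 ->
  exists r, [/\ r0 <= r, B r w & B r v].
Hypothesis B_bound : forall r w, r0 <= r -> B r w -> w.1 <= 1 + r /\ w.2 <= 1 + r.
Hypothesis r0_ge0 : 0 <= r0.
Hypothesis cumE : forall z t, 0 <= t -> cumulative_rate nu phi z t = lam z t.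
Hypothesis phi_meas : forall i,
  measurable_fun setT (fun a : (R * R) * R => phi i a.1 (Num.max 0 a.2)).
Hypothesis lam_meas : forall i,
  measurable_fun setT (fun a : (R * R) * R => lam (i, a.1) (Num.max 0 a.2)).
Context (d : measure_display) (Om : measurableType d).
Context (P : state R -> probability Om R) (X : R -> Om -> state R) (T : nat -> Om -> \bar R).
Hypothesis X_meas : forall t, 0 <= t -> measurable_fun setT (X t).
Hypothesis T_meas : forall n, measurable_fun setT (T n).
Hypothesis paths : pdmp_paths phi X T.
Hypothesis X_start : forall z, states R z -> P z [set w | X 0 w = z] = 1%E.
Hypothesis rate : forall z, states R z -> jumps_at_rate nu phi X T (P z).
Local Notation S := (semigroup P X).

Let cover (z v : state R) : states R z -> states R v -> exists r, [/\ r0 <= r, B r z.2 & B r v.2].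
Proof. by move=> [z1 z2] [v1 v2]; exact: B_cover. Qed.

(** Any two states share a box, and the Lipschitz constant of [semigroup_lip] is the same for all
    boxes, so the bound is global. *)
Lemma semigroup_test t f : 0 <= t -> test f -> test (fun z => S t f (clip z)).
Proof.
move=> t0 tf; have [[M fM] [K fK]] := tf; split.
  exists M => z; apply: (@Ex_abs_le_ae _ _ _ _ setT) => //; first exact: probability_setT.
  exact (bmeas_X X_meas t0 (test_bmeas tf)).
have M0 : 0 <= M by apply: le_trans (fM (true, 0)).
have [K0 _] := fK.
have nu0 : 0 <= nu by exact: ltW (cf_nu (F (lexx r0))).
have A0 : 0 <= 2 * M * nu + K by rewrite addr_ge0// !mulr_ge0.
exists ((2 * M * nu + K) * 2); split => [|i w v]; first by rewrite mulr_ge0.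
have [r [rr Bw Bv]] := cover (clip_states (i, w)) (clip_states (i, v)).
have := @semigroup_lip R phi lam N (B r) _ _ _ _ _ _ _ (F rr) cumE phi_meas lam_meas d Om P X T
  X_meas T_meas paths X_start rate f M K fM fK i _ _ t Bw Bv t0.
move=> h; apply: (le_trans h); rewrite -[leRHS]mulrA ler_wpM2l//.
have /andP[_ h2] := cf_norm (F rr) ((clip (i, w)).2 - (clip (i, v)).2).
by apply: (le_trans h2); rewrite ler_pM2l//; exact: norm1_clip.
Qed.

Lemma semigroup_law u s f z : 0 <= u -> 0 <= s -> test f -> states R z ->
  S u (fun v => S s f (clip v)) z = S (u + s) f z.
Proof.
move=> u0 s0 tf sz; have [[M fM] [K fK]] := tf; have [r [rr Bz _]] := cover sz sz.
apply: (@semigroupD R phi lam N (B r) _ _ _ _ _ _ _ (F rr) cumE phi_meas lam_meas d Om P X T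
  X_meas T_meas paths X_start rate f M K fM fK) => //.
- exact: test_bmeas (semigroup_test s0 tf).
- by move=> v Bv; rewrite clip_id//; exact: (cf_ge0 (F rr)).
Qed.

(** The rate of mixing depends on the box that holds [z] and [z0], so the convergence need not be
    uniform in [z]; the limit is still that of [z0]. *)
Lemma semigroup_cvg f : test f -> exists l : R, forall z, states R z ->
  S t f z @[t --> +oo] --> l.
Proof.
move=> [[M fM] [K fK]]; pose z0 : state R := (true, (0, 0)).
have sz0 : states R z0 by split => /=.
have mix z e : states R z -> 0 < e -> exists2 t1, 0 < t1 &
    forall u, 0 <= u -> `|S (u + t1) f z - S t1 f z0| <= e /\
      `|S (u + t1) f z0 - S t1 f z0| <= e.
  move=> sz e0; have [r [rr Bz Bz0]] := cover sz sz0.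
  have [t0 [th [A [t00 /andP[th0 th1] mixing]]]] := @semigroup_mixing R phi lam N (B r) _ _ _ _ _ _ _
    (F rr) cumE phi_meas lam_meas d Om P X T X_meas T_meas paths X_start rate f M K fM fK.
  have h0 : th ^+ k * A @[k --> \oo] --> 0 * A.
    by apply: cvgMl; apply: cvg_expr; rewrite gtr0_norm.
  rewrite mul0r in h0; have := h0 => /cvgrPdist_le/(_ e e0)[k _ /(_ k (leqnn k))/=].
  (* The added 1 keeps the time positive when [k = 0]. *)
  rewrite sub0r normrN => hk; exists (k%:R * t0 + 1).
    by rewrite ltr_wpDl// mulr_ge0// ltW.
  have t1_ge : k%:R * t0 <= k%:R * t0 + 1 by rewrite lerDl.
  have t1_gt0 : 0 < k%:R * t0 + 1 by rewrite ltr_wpDl// mulr_ge0// ltW.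
  have hk' := le_trans (ler_norm _) hk.
  by move=> u u0; split; apply: le_trans hk'; exact: mixing.
have /cauchy_cvgP : cauchy (S t f z0 @[t --> +oo]).
  apply: cauchy_exP => e e0; have e2 : 0 < e / 2 by rewrite divr_gt0.
  have [t1 t10 h] := mix z0 (e / 2) sz0 e2; exists (S t1 f z0).
  apply: filterS (nbhs_pinfty_ge (num_real t1)) => t tt /=.
  rewrite /ball/= distrC; have := h (t - t1); rewrite subr_ge0 subrK => /(_ tt)[_].
  by move/le_lt_trans; apply; rewrite ltr_pdivrMr// ltr_pMr// ltr1n.
move=> cv; exists (lim (S t f z0 @[t --> +oo])) => z sz.
apply/cvgrPdist_le => e e0; have e2 : 0 < e / 2 by rewrite divr_gt0.
have e4 : 0 < e / 2 / 2 by rewrite divr_gt0.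
have [t1 t10 h] := mix z _ sz e4.
have := cv => /cvgrPdist_le/(_ _ e2); apply: filterS2 (nbhs_pinfty_ge (num_real t1)) => t tt ht.
have := h (t - t1); rewrite subr_ge0 subrK => /(_ tt)[].
move: ht; rewrite !ler_norml.
move: (lim _) (S t f z) (S t f z0) (S t1 f z0) => l a b b' /andP[? ?] /andP[? ?] /andP[? ?].
apply/andP; split; lra.
Qed.

Lemma semigroup_cell z : states R z -> exists M, 0 < M /\
  forall t, 0 <= t -> P z (X t @^-1` cell M) = 1%E.
Proof.
move=> sz; have [r [rr Bz _]] := cover sz sz; exists (2 + r).
have r1 : 0 <= r by exact: le_trans rr.
split => [|t t0]; first by rewrite ltr_pwDl.
apply: (@semigroup_box R phi lam N (B r) _ _ _ _ _ _ _ (F rr) cumE phi_meas lam_meas d Om P X T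
  X_meas T_meas paths X_start rate) => //.
  exact: measurable_cell.
move=> v Bv; have [v1 v2] := cf_ge0 (F rr) Bv; have [v3 v4] := B_bound rr Bv.
by split; apply/andP; split => //; lra.
Qed.

End Family.

Unset Implicit Arguments.

Theorem theorem7 (R : realType) (nu p q alpha beta delta epsilon eta : R)
    (nu_gt0 : 0 < nu) (p_gt0 : 0 < p) (p_lt1 : p < 1) (q_def : q = 1 - p)
    (alpha_gt0 : 0 < alpha) (beta_gt0 : 0 < beta) (delta_gt0 : 0 < delta)
    (epsilon_gt0 : 0 < epsilon) (eta_gt0 : 0 < eta)
    (d : measure_display) (Om : measurableType d)
    (P : state R -> probability Om R) (X : R -> Om -> state R)
    (X_process :
       two_plane_process nu p q alpha beta delta epsilon eta P X) :
  exists mu : probability (state R) R,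
    [/\ stationary P X mu,
        forall mu' : probability (state R) R, stationary P X mu' ->
          forall A : set (state R), measurable A -> mu' A = mu A &
        forall z : state R, states R z ->
          converges_in_distribution X (P z) mu].
Proof.
have q_gt0 : 0 < q by rewrite q_def subr_gt0.
have [X_meas [phi [T [phi_flow T_meas paths X_start rate]]]] := X_process.
have kk0 i : 0 < kk nu beta epsilon i by apply: kk_gt0.
have PP0 i : 0 < PP nu p q alpha delta i by apply: PP_gt0.
have [kap [g [/andP[kap_gt0 kap_le1] g_gt0 kapPk g_kap g_1]]] := decay_constants kk0 PP0.
pose r0 := box_radius eta kap g.
have r0_ge0 : 0 <= r0 by rewrite /r0 /box_radius !divr_ge0 ?sqr_ge0 ?ltW.
have F := two_plane_compact_flow nu_gt0 p_gt0 q_gt0 alpha_gt0 beta_gt0 delta_gt0 epsilon_gt0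
  eta_gt0 phi_flow kap_gt0 kap_le1 g_gt0 kapPk g_kap g_1.
have cover (w v : R * R) : 0 <= w.1 -> 0 <= w.2 -> 0 <= v.1 -> 0 <= v.2 ->
    exists r, [/\ r0 <= r, box kap r w & box kap r v].
  move=> w1 w2 v1 v2.
  exists (Num.max r0 (Num.max (quad kap w.1 w.2) (quad kap v.1 v.2))).
  by split; [|split => //|split => //]; rewrite !le_max lexx ?orbT.
have bound r w : r0 <= r -> box kap r w -> w.1 <= 1 + r /\ w.2 <= 1 + r.
  by move=> _ /(box_coords kap_gt0)[].
have cumE := cumulative_rateE phi_flow.
have phi_meas := measurable_flow nu_gt0 p_gt0 q_gt0 alpha_gt0 beta_gt0 delta_gt0 epsilon_gt0 phi_flow.
have lam_meas := measurable_lam nu_gt0 p_gt0 q_gt0 alpha_gt0 beta_gt0 delta_gt0 epsilon_gt0 phi_flow.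
have S_test := semigroup_test F cover cumE phi_meas lam_meas X_meas T_meas paths X_start rate.
have S_D := semigroup_law F cover cumE phi_meas lam_meas X_meas T_meas paths X_start rate.
have S_cvg := semigroup_cvg F cover cumE phi_meas lam_meas X_meas T_meas paths X_start rate.
have S_cell := semigroup_cell F cover bound r0_ge0 cumE phi_meas lam_meas X_meas T_meas paths
  X_start rate.
have [mu [mu1 mu_cvg]] := invariant_measure X_meas S_cvg S_cell.
exists mu; split.
- exact: limit_stationary.
- exact: limit_unique.
- exact: limit_in_distribution.
Qed.
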